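(* Let $k \ge 3$ be an integer, and assume the truth of the $abc$-conjecture. For $H \ge 1$ let $N_{k,\mathrm{loc}}(H)$ be the number of pairs $(a,b) \in \mathbb{Z}^2$ with $0<|a|,|b|\le H$ such that the equation $ax^k+by^k=1$ has a solution over $\mathbb{R}$ and a solution over $\mathbb{Z}_p$ for every prime $p$, and let $N_{k,\mathrm{glob}}(H)$ be the number of pairs $(a,b)\in\mathbb{Z}^2$ with $0<|a|,|b|\le H$ such that $ax^k+by^k=1$ has a solution $(x,y)\in\mathbb{Z}^2$. Then \[ \frac{N_{k,\mathrm{glob}}(H)}{N_{k,\mathrm{loc}}(H)} \to 0 \quad (H\to\infty). \]
   Context: The $abc$-conjecture asserts: for every $\varepsilon>0$ there is a constant $C_\varepsilon$ such that whenever $a,b,c\in\mathbb{Z}$ satisfy $a+b=c$ and $\gcd(a,b,c)=1$, we have $\max\{|a|,|b|,|c|\} \le C_\varepsilon P^{1+\varepsilon}$, where $P=\prod_{p\mid abc} p$ is the product of the distinct primes dividing $abc$. Here $\mathbb{Z}_p$ denotes the ring of $p$-adic integers. *)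

(* Defs.v *)
From HB Require Import structures.
From mathcomp Require Import all_boot all_order all_algebra.
From mathcomp Require Import finmap.
From mathcomp Require Import all_classical all_reals all_analysis.

Set Implicit Arguments.
Unset Strict Implicit.
Unset Printing Implicit Defensive.

Import Order.TTheory GRing.Theory Num.Theory.

Local Open Scope ring_scope.

Definition Zpow_red (p n : nat) (x : 'Z_(p ^ n.+2)) : 'Z_(p ^ n.+1) :=
  (x : nat)%:R.

Record padic_seq (p : nat) := PadicSeq {
  padic_coord :> forall n : nat, 'Z_(p ^ n.+1);
  padic_coherent : forall n, Zpow_red (padic_coord n.+1) = padic_coord n }.

(* The ring Z_p as the inverse limit of the rings Z/p^(n+1), n >= 0, with       *)
(* coordinatewise operations.  The primality proof is a parameter of the type  *)
(* because 'Z_m is Z/mZ, and Zpow_red a ring morphism, only when p > 1; the    *)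
(* ring structure is found by unification from this parameter.                 *)
Definition padic_int (p : nat) (p_pr : prime p) : Type := padic_seq p.

Section PadicIntegers.
Variables (p : nat) (p_pr : prime p).
Local Notation padic_int := (padic_int p_pr).

HB.instance Definition _ := gen_eqMixin padic_int.
HB.instance Definition _ := gen_choiceMixin padic_int.

Lemma padic_ext (x y : padic_int) : (forall n, x n = y n) -> x = y.
Proof.
case: x y => [x xP] [y yP] /= xy.
have {}xy : x = y by apply: functional_extensionality_dep.
by case: _ / xy yP => yP; congr PadicSeq; apply: Prop_irrelevance.
Qed.

Let ppow_gt1 n : (1 < p ^ n.+1)%N.
Proof. by rewrite -{1}(exp1n n.+1) ltn_exp2r // prime_gt1. Qed.

Let ppow_dvd n : (p ^ n.+1 %| p ^ n.+2)%N.
Proof. exact: dvdn_exp2l. Qed.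

Let red_nat n m : Zpow_red (m%:R : 'Z_(p ^ n.+2)) = m%:R.
Proof.
rewrite /Zpow_red val_Zp_nat // -Zp_nat_mod // modn_dvdm //.
by rewrite Zp_nat_mod.
Qed.

Let redD n : {morph @Zpow_red p n : x y / x + y}.
Proof.
move=> x y; rewrite -[x]natr_Zp -[y]natr_Zp -natrD !red_nat.
by rewrite natrD.
Qed.

Let redM n : {morph @Zpow_red p n : x y / x * y}.
Proof.
move=> x y; rewrite -[x]natr_Zp -[y]natr_Zp -natrM !red_nat.
by rewrite natrM.
Qed.

Let red0 n : @Zpow_red p n 0 = 0. Proof. exact: (red_nat n 0). Qed.
Let red1 n : @Zpow_red p n 1 = 1. Proof. exact: (red_nat n 1). Qed.

Let redN n : {morph @Zpow_red p n : x / - x}.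
Proof.
by move=> x; apply: (addrI (Zpow_red x)); rewrite -redD !subrr red0.
Qed.

Definition padic_zero : padic_int := @PadicSeq p (fun=> 0) red0.
Definition padic_one : padic_int := @PadicSeq p (fun=> 1) red1.

Definition padic_opp (x : padic_int) : padic_int.
Proof.
exists (fun n => - x n) => n.
by rewrite redN padic_coherent.
Defined.

Definition padic_add (x y : padic_int) : padic_int.
Proof.
exists (fun n => x n + y n) => n.
by rewrite redD !padic_coherent.
Defined.

Definition padic_mul (x y : padic_int) : padic_int.
Proof.
exists (fun n => x n * y n) => n.
by rewrite redM !padic_coherent.
Defined.

Let addA : associative padic_add.
Proof. by move=> x y z; apply: padic_ext => n; apply: addrA. Qed.
Let addC : commutative padic_add.
Proof. by move=> x y; apply: padic_ext => n; apply: addrC. Qed.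
Let add0 : left_id padic_zero padic_add.
Proof. by move=> x; apply: padic_ext => n; apply: add0r. Qed.
Let addN : left_inverse padic_zero padic_opp padic_add.
Proof. by move=> x; apply: padic_ext => n; apply: addNr. Qed.

HB.instance Definition _ :=
  GRing.isZmodule.Build padic_int addA addC add0 addN.

Let mulA : associative padic_mul.
Proof. by move=> x y z; apply: padic_ext => n; apply: mulrA. Qed.
Let mulC : commutative padic_mul.
Proof. by move=> x y; apply: padic_ext => n; apply: mulrC. Qed.
Let mul1 : left_id padic_one padic_mul.
Proof. by move=> x; apply: padic_ext => n; apply: mul1r. Qed.
Let mulD : left_distributive padic_mul padic_add.
Proof. by move=> x y z; apply: padic_ext => n; apply: mulrDl. Qed.
Let oner_neq0 : padic_one != padic_zero.
Proof.
apply/eqP => /(congr1 (fun x : padic_int => x 0%N)) /= /eqP.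
by rewrite GRing.oner_eq0.
Qed.

HB.instance Definition _ :=
  GRing.Zmodule_isComNzRing.Build padic_int mulA mulC mul1 mulD oner_neq0.

End PadicIntegers.

Definition radical (n : nat) : nat := (\prod_(p <- primes n) p)%N.

(* When a * b * c = 0 every prime divides a * b * c, so the product of these   *)
(* primes is infinite and the inequality is void; hence the nonvanishing       *)
(* condition.                                                                  *)
Definition abc_conjecture (R : realType) : Prop :=
  forall eps : R, 0 < eps -> exists C : R,
    forall a b c : int, a + b = c -> gcdz a (gcdz b c) = 1 ->
      a * b * c != 0 ->
      (maxn `|a| (maxn `|b| `|c|))%:R
        <= C * (radical `|a * b * c|)%:R `^ (1 + eps).

Definition solvable_over (A : comNzRingType) (k : nat) (a b : int) : Prop :=
  exists x y : A, a%:~R * x ^+ k + b%:~R * y ^+ k = 1.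

Definition solvable_locally (R : realType) (k : nat) (a b : int) : Prop :=
  solvable_over R k a b /\
  forall (p : nat) (p_pr : prime p), solvable_over (padic_int p_pr) k a b.

Definition coef_box (R : realType) (H : R) : set (int * int) :=
  [set ab | [/\ 0 < `|ab.1|, `|ab.1|%:~R <= H,
                0 < `|ab.2| & `|ab.2|%:~R <= H]].

(* coef_box H is finite, so fset_set below yields the genuine cardinality.     *)
Definition N_loc (R : realType) (k : nat) (H : R) : nat :=
  #|` fset_set (coef_box H `&`
        [set ab | solvable_locally R k ab.1 ab.2])%classic|%fset.

Definition N_glob (R : realType) (k : nat) (H : R) : nat :=
  #|` fset_set (coef_box H `&`
        [set ab | solvable_over int k ab.1 ab.2])%classic|%fset.

(* Main.v *)
From HB Require Import structures.
Require Import Defs.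
From mathcomp Require Import all_boot all_order all_algebra.
From mathcomp Require Import finmap finfield zify ring lra.
From mathcomp Require Import all_classical all_reals all_analysis.

(** A solution of a x^k + b y^k = 1 gives a coprime triple, and abc bounds X
    = max(|x|, |y|) by about H^(1/(k-2)), because the radical of the triple
    divides abxy. For fixed (x, y) at most 2H/X^k + 1 pairs (a, b) occur.
    For k >= 4 summation over (x, y) gives N_glob << H^(1+eps), whereas the
    pairs (u^k, b) with u prime and b a k-th power residue modulo u are all
    locally soluble, so that N_loc >> H^(1+1/k-eps).

    For k = 3 this leaves the range where a, b, x, y all have size about H.
    There x/y is put on a line q x - p y = d by Dirichlet's theorem; on a
    short piece of such a line four solutions (t_i, a_i, b_i) satisfy that
    the cross-ratio of the (a_i : b_i) equals that of the t_i, because the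
    difference is an integer that is too small. Hence (a : b) is a Moebius
    function of the parameter t, and a quartic equation together with the
    divisor bound leaves H^eps solutions per piece. This saves a fixed power
    of H over H^2. In the other direction N_loc >> H^(2-eps): take for b a
    prime q = 2 mod 3, and for a a number 2^i 5^j p = 1 mod 63 with p = 2
    mod 3 another prime. Modulo a prime l = 1 mod 3, l > 7, solubility
    follows from the cyclotomic numbers of order three, and the supply of
    primes is Mertens' theorem for the class 2 mod 3. *)

Set Implicit Arguments.
Unset Strict Implicit.
Unset Printing Implicit Defensive.

Import Order.TTheory GRing.Theory Num.Theory.
Local Open Scope ring_scope.

Definition at_most (T : eqType) (A : T -> Prop) (n : nat) : Prop :=
  exists s : seq T, (size s <= n)%N /\ forall z, A z -> z \in s.

Section AtMost.
Variable T : eqType.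
Implicit Types A B : T -> Prop.

Lemma at_most_le A B m n :
  at_most A m -> (forall z, B z -> A z) -> (m <= n)%N -> at_most B n.
Proof.
move=> [s [sm sA]] BA mn; exists s; split; first exact: leq_trans mn.
by move=> z /BA /sA.
Qed.

Lemma at_most_empty A n : (forall z, ~ A z) -> at_most A n.
Proof. by move=> A0; exists [::]; split=> // z /A0. Qed.

Lemma at_mostU A B m n :
  at_most A m -> at_most B n -> at_most (fun z => A z \/ B z) (m + n).
Proof.
move=> [s [sm sA]] [r [rn rB]]; exists (s ++ r); rewrite size_cat leq_add //.
by split=> // z [/sA|/rB]; rewrite mem_cat => -> //; rewrite orbT.
Qed.

Lemma at_most_sum (I : eqType) (r : seq I) (A : I -> T -> Prop) (N : I -> nat) :
  (forall i, i \in r -> at_most (A i) (N i)) ->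
  at_most (fun z => exists2 i, i \in r & A i z) (\sum_(i <- r) N i).
Proof.
elim: r => [_|i r IH Ar]; first by apply: at_most_empty => z [].
have [|s [size_s sA]] := at_mostU (Ar i (mem_head _ _)) (IH _).
  by move=> j jr; apply: Ar; rewrite inE jr orbT.
exists s; rewrite big_cons; split=> // z [j]; rewrite inE.
by move=> /predU1P[->|jr] Az; apply: sA; [left|right; exists j].
Qed.

Lemma at_most_bigcup (I : eqType) (r : seq I) (A : I -> T -> Prop) m n :
  (size r <= m)%N -> (forall i, i \in r -> at_most (A i) n) ->
  at_most (fun z => exists2 i, i \in r & A i z) (m * n).
Proof.
move=> rm /at_most_sum Ar; apply: at_most_le Ar _ _ => //.
by rewrite big_const_seq count_predT iter_addn_0 mulnC leq_mul2r rm orbT.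
Qed.

Lemma at_most_image (I : eqType) (f : I -> T) (A : I -> Prop) n :
  at_most A n -> at_most (fun z => exists2 i, A i & z = f i) n.
Proof.
move=> [s [sn sA]]; exists (map f s); rewrite size_map; split=> //.
by move=> z [i /sA si ->]; apply: map_f.
Qed.

Lemma at_most_or_uniq A n :
  at_most A n \/
  exists s : seq T, [/\ uniq s, size s = n.+1 & forall z, z \in s -> A z].
Proof.
elim: n => [|n [An|[s [us size_s sA]]]].
- have [[z Az]|A0] := EM (exists z, A z).
    by right; exists [:: z]; split=> // y; rewrite inE => /eqP->.
  by left; apply: at_most_empty => z Az; apply: A0; exists z.
- by left; apply: at_most_le An _ _.
have [[z Az zs]|sub] := EM (exists2 z, A z & z \notin s).
  right; exists (z :: s); rewrite /= zs us size_s; split=> // y.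
  by rewrite inE => /predU1P[->//|/sA].
left; exists s; rewrite size_s; split=> // z Az.
by apply: contraT => zs; case: sub; exists z.
Qed.

End AtMost.

Lemma at_most_swap (A : int * int -> Prop) n :
  at_most A n -> at_most (fun z => A (z.2, z.1)) n.
Proof.
move=> /(at_most_image (fun z : int * int => (z.2, z.1))) An.
by apply: at_most_le An _ _ => // -[a b] Aba; exists (b, a).
Qed.

Definition int_range (n : nat) : seq int :=
  [seq (i : nat)%:Z - n%:Z | i <- iota 0 (2 * n + 1)].

Lemma size_int_range n : size (int_range n) = (2 * n + 1)%N.
Proof. by rewrite size_map size_iota. Qed.

Lemma mem_int_range n (a : int) : (a \in int_range n) = (`|a| <= n%:Z).
Proof.
apply/mapP/idP => [[i]|an]; first by rewrite mem_iota => i_le ->; lia.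
by exists `|(a + n%:Z)%R|%N; [rewrite mem_iota|]; lia.
Qed.

Lemma at_most_box m n :
  at_most (fun z : int * int => `|z.1| <= m%:Z /\ `|z.2| <= n%:Z)
    ((2 * m + 1) * (2 * n + 1)).
Proof.
exists [seq (a, b) | a <- int_range m, b <- int_range n].
rewrite size_allpairs !size_int_range; split=> // -[a b] [am bn].
by apply/allpairsP; exists (a, b); rewrite !mem_int_range.
Qed.

Lemma at_most_congruent (n m : nat) (A : int -> Prop) : (0 < m)%N ->
  (forall a, A a -> `|a| <= n%:Z) ->
  (forall a b, A a -> A b -> (m%:Z %| a - b)%Z) ->
  at_most A ((2 * n) %/ m).+1.
Proof.
move=> m_gt0 A_le A_congr.
have [[c Ac]|A0] := EM (exists a, A a); last first.
  by apply: at_most_empty => a Aa; apply: A0; exists a.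
pose shifted_class (i : nat) : int :=
  i%:Z * m%:Z + ((c + n%:Z) %% m%:Z)%Z - n%:Z.
exists [seq shifted_class i | i <- iota 0 ((2 * n) %/ m).+1].
rewrite size_map size_iota; split=> // a Aa; have a_le := A_le a Aa.
have shift_ge0 : 0 <= a + n%:Z by lia.
apply/mapP; exists `|((a + n%:Z) %/ m%:Z)%Z|%N.
  rewrite mem_iota /= add0n ltnS -(gez0_abs shift_ge0) divz_nat /= leq_div2r //.
  by lia.
have -> : shifted_class `|((a + n%:Z) %/ m%:Z)%Z|%N =
    ((a + n%:Z) %/ m%:Z)%Z * m%:Z + ((a + n%:Z) %% m%:Z)%Z - n%:Z.
  rewrite /shifted_class gez0_abs ?divz_ge0 ?ltz_nat //; congr (_ + _ - _).
  apply/eqP; rewrite eqz_mod_dvd.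
  by rewrite (_ : c + n%:Z - (a + n%:Z) = c - a) ?A_congr //; ring.
by rewrite -divz_eq addrK.
Qed.

(** * Four solutions on a short piece of a line *)

Definition minor (z w : int * int) : int := z.1 * w.2 - w.1 * z.2.

(* (t, (a, b)) stands for the point of parameter t on a line, together with
   a pair of coefficients attached to it. *)
Definition marked_point : Type := (int * (int * int))%type.

(* Up to sign the determinant of the rows (a_i, b_i, t_i a_i, t_i b_i); it
   vanishes when the (a_i : b_i) and the t_i have the same cross-ratio. *)
Definition cross_det (P1 P2 P3 P4 : marked_point) : int :=
  minor P1.2 P2.2 * minor P3.2 P4.2 * ((P1.1 - P4.1) * (P2.1 - P3.1))
  - minor P1.2 P4.2 * minor P2.2 P3.2 * ((P1.1 - P2.1) * (P3.1 - P4.1)).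

Section CubicsOnLine.
Variables (x0 y0 p q : int).

Definition line_x (t : int) : int := x0 + p * t.
Definition line_y (t : int) : int := y0 + q * t.
Definition line_const : int := q * x0 - p * y0.

Definition cubic_through (P : marked_point) : Prop :=
  P.2.1 * line_x P.1 ^+ 3 + P.2.2 * line_y P.1 ^+ 3 = 1.

(* (X^3 - Z^3) / (X - Z) at X = x(t) y(u), Z = x(u) y(t) *)
Definition cube_cofactor (t u : int) : int :=
  (line_x t * line_y u) ^+ 2
  + (line_x t * line_y u) * (line_x u * line_y t)
  + (line_x u * line_y t) ^+ 2.

Definition minor_main (P Q : marked_point) : int :=
  P.2.1 * line_y P.1 ^+ 3 - Q.2.1 * line_y Q.1 ^+ 3.

Definition minor_chord (P Q : marked_point) : int :=
  P.2.1 * Q.2.1 * (line_const * (P.1 - Q.1) * cube_cofactor P.1 Q.1).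

Definition mixed_sum (t1 t2 t3 t4 : int) : int :=
  line_x t1 * line_x t2 * line_y t3 * line_y t4
  + line_x t1 * line_x t3 * line_y t2 * line_y t4
  + line_x t1 * line_x t4 * line_y t2 * line_y t3
  + line_x t2 * line_x t3 * line_y t1 * line_y t4
  + line_x t2 * line_x t4 * line_y t1 * line_y t3
  + line_x t3 * line_x t4 * line_y t1 * line_y t2.

Lemma minor_on_line P Q : cubic_through P -> cubic_through Q ->
  (line_y P.1 * line_y Q.1) ^+ 3 * minor P.2 Q.2 =
  minor_main P Q - minor_chord P Q.
Proof.
case: P Q => [t [a b]] [u [c d]]; rewrite /cubic_through /minor /minor_main.
rewrite /minor_chord /cube_cofactor /line_const /= => abP cdP.
transitivity (a * line_y t ^+ 3 * (d * line_y u ^+ 3)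
              - c * line_y u ^+ 3 * (b * line_y t ^+ 3)); first by ring.
have -> : b * line_y t ^+ 3 = 1 - a * line_x t ^+ 3 by rewrite -abP addrC addKr.
have -> : d * line_y u ^+ 3 = 1 - c * line_x u ^+ 3 by rewrite -cdP addrC addKr.
by rewrite /line_x /line_y; ring.
Qed.

Lemma cube_cofactor_det t1 t2 t3 t4 :
  cube_cofactor t1 t2 * cube_cofactor t3 t4
  - cube_cofactor t1 t4 * cube_cofactor t2 t3 =
  - (line_const ^+ 2 * ((t1 - t3) * (t2 - t4)) * mixed_sum t1 t2 t3 t4).
Proof.
have cross t u : line_x t * line_y u - line_x u * line_y t =
    - (line_const * (t - u)).
  by rewrite /line_x /line_y /line_const; ring.
transitivity (- ((line_x t1 * line_y t3 - line_x t3 * line_y t1)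
   * (line_x t2 * line_y t4 - line_x t4 * line_y t2) * mixed_sum t1 t2 t3 t4)).
  by rewrite /cube_cofactor /mixed_sum; ring.
by rewrite !cross; ring.
Qed.

(* The terms that are quadratic in minor_chord cancel up to the small factor
   of cube_cofactor_det. *)
Lemma cross_det_on_line P1 P2 P3 P4 :
  cubic_through P1 -> cubic_through P2 -> cubic_through P3 ->
  cubic_through P4 ->
  let M := minor_main in let K := minor_chord in
  let T1423 := (P1.1 - P4.1) * (P2.1 - P3.1) in
  let T1234 := (P1.1 - P2.1) * (P3.1 - P4.1) in
  let T1324 := (P1.1 - P3.1) * (P2.1 - P4.1) in
  (line_y P1.1 * line_y P2.1 * line_y P3.1 * line_y P4.1) ^+ 3
    * cross_det P1 P2 P3 P4 =
  (M P1 P2 * M P3 P4 * T1423 - M P1 P4 * M P2 P3 * T1234)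
  - ((M P1 P2 * K P3 P4 + K P1 P2 * M P3 P4) * T1423
     - (M P1 P4 * K P2 P3 + K P1 P4 * M P2 P3) * T1234)
  - P1.2.1 * P2.2.1 * P3.2.1 * P4.2.1 * line_const ^+ 4
    * (T1423 * T1234 * T1324) * mixed_sum P1.1 P2.1 P3.1 P4.1.
Proof.
move=> C1 C2 C3 C4 M K T1423 T1234 T1324.
have quadratic_terms :
    K P1 P2 * K P3 P4 * T1423 - K P1 P4 * K P2 P3 * T1234 =
    P1.2.1 * P2.2.1 * P3.2.1 * P4.2.1 * line_const ^+ 2 * (T1423 * T1234)
    * (cube_cofactor P1.1 P2.1 * cube_cofactor P3.1 P4.1
       - cube_cofactor P1.1 P4.1 * cube_cofactor P2.1 P3.1).
  by rewrite /K /minor_chord /T1423 /T1234; ring.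
have -> : (line_y P1.1 * line_y P2.1 * line_y P3.1 * line_y P4.1) ^+ 3
    * cross_det P1 P2 P3 P4 =
  ((line_y P1.1 * line_y P2.1) ^+ 3 * minor P1.2 P2.2)
   * ((line_y P3.1 * line_y P4.1) ^+ 3 * minor P3.2 P4.2) * T1423
  - ((line_y P1.1 * line_y P4.1) ^+ 3 * minor P1.2 P4.2)
   * ((line_y P2.1 * line_y P3.1) ^+ 3 * minor P2.2 P3.2) * T1234.
  by rewrite /cross_det /T1423 /T1234; ring.
rewrite !minor_on_line // -!/(M _ _) -!/(K _ _).
transitivity ((M P1 P2 * M P3 P4 * T1423 - M P1 P4 * M P2 P3 * T1234)
  - ((M P1 P2 * K P3 P4 + K P1 P2 * M P3 P4) * T1423
     - (M P1 P4 * K P2 P3 + K P1 P4 * M P2 P3) * T1234)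
  + (K P1 P2 * K P3 P4 * T1423 - K P1 P4 * K P2 P3 * T1234)); first by ring.
by rewrite quadratic_terms cube_cofactor_det /T1324; ring.
Qed.

End CubicsOnLine.

Section NormBounds.
Variable R : numDomainType.
Implicit Types x y A B : R.

Lemma ler_normM_le x y A B : `|x| <= A -> `|y| <= B -> `|x * y| <= A * B.
Proof. by move=> *; rewrite normrM ler_pM. Qed.

Lemma ler_normD_le x y A B : `|x| <= A -> `|y| <= B -> `|x + y| <= A + B.
Proof. by move=> xA yB; apply: le_trans (ler_normD _ _) (lerD xA yB). Qed.

Lemma ler_normB_le x y A B : `|x| <= A -> `|y| <= B -> `|x - y| <= A + B.
Proof. by move=> xA yB; apply: le_trans (ler_normB _ _) (lerD xA yB). Qed.

Lemma ler_normX_le x A n : `|x| <= A -> `|x ^+ n| <= A ^+ n.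
Proof. by move=> xA; rewrite normrX lerXn2r // nnegrE (le_trans _ xA). Qed.

End NormBounds.

Ltac bound_norm := repeat first [
  match goal with
  | H : is_true (`|?x| <= _) |- is_true (`|?y| <= _) => constr_eq x y; exact: H
  end |
  lazymatch goal with
  | |- is_true (`|_ - _| <= _) => apply: ler_normB_le
  | |- is_true (`|_ + _| <= _) => apply: ler_normD_le
  | |- is_true (`|_ * _| <= _) => apply: ler_normM_le
  | |- is_true (`|_ ^+ _| <= _) => apply: ler_normX_le
  end ].

Lemma PoszX m n : (m ^ n)%N%:Z = m%:Z ^+ n.
Proof. by elim: n => // n IHn; rewrite expnS PoszM IHn exprS. Qed.

Definition cross_det_bound (n D tau Y : nat) : nat :=
  (8 * n ^ 2 * Y ^ 6 * tau ^ 2 + 24 * n ^ 3 * D * tau ^ 3 * Y ^ 7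
   + 6 * n ^ 4 * D ^ 4 * tau ^ 6 * Y ^ 4)%N.

Section CrossDetVanishes.
Variables (n D tau Y : nat) (x0 y0 p q : int).
Local Notation x_ := (line_x x0 p).
Local Notation y_ := (line_y y0 q).

Definition bounded_point (P : marked_point) : Prop :=
  [/\ `|P.2.1| <= n%:Z, `|x_ P.1| <= Y%:Z & `|y_ P.1| <= Y%:Z].

Definition nearby (P Q : marked_point) : Prop := `|P.1 - Q.1| <= tau%:Z.

Lemma normr_minor_main P Q : bounded_point P -> bounded_point Q ->
  `|minor_main y0 q P Q| <= 2 * n%:Z * Y%:Z ^+ 3.
Proof.
move=> [? _ ?] [? _ ?]; rewrite /minor_main.
by apply: le_trans; [bound_norm|
  rewrite le_eqVlt; apply/orP; left; apply/eqP; ring].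
Qed.

Lemma normr_minor_chord P Q : `|line_const x0 y0 p q| <= D%:Z ->
  bounded_point P -> bounded_point Q -> nearby P Q ->
  `|minor_chord x0 y0 p q P Q| <= 3 * n%:Z ^+ 2 * D%:Z * tau%:Z * Y%:Z ^+ 4.
Proof.
rewrite /nearby /minor_chord /cube_cofactor => ? [? ? ?] [? ? ?] ?.
by apply: le_trans; [bound_norm|
  rewrite le_eqVlt; apply/orP; left; apply/eqP; ring].
Qed.

Lemma normr_cross_det_on_line P1 P2 P3 P4 : `|line_const x0 y0 p q| <= D%:Z ->
  bounded_point P1 -> bounded_point P2 -> bounded_point P3 ->
  bounded_point P4 ->
  cubic_through x0 y0 p q P1 -> cubic_through x0 y0 p q P2 ->
  cubic_through x0 y0 p q P3 -> cubic_through x0 y0 p q P4 ->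
  nearby P1 P2 -> nearby P1 P3 -> nearby P1 P4 ->
  nearby P2 P3 -> nearby P2 P4 -> nearby P3 P4 ->
  `|(y_ P1.1 * y_ P2.1 * y_ P3.1 * y_ P4.1) ^+ 3 * cross_det P1 P2 P3 P4|
    <= (cross_det_bound n D tau Y)%:Z.
Proof.
move=> dD B1 B2 B3 B4 C1 C2 C3 C4 N12 N13 N14 N23 N24 N34.
rewrite (cross_det_on_line C1 C2 C3 C4).
have M12 := normr_minor_main B1 B2; have M34 := normr_minor_main B3 B4.
have M14 := normr_minor_main B1 B4; have M23 := normr_minor_main B2 B3.
have K12 := normr_minor_chord dD B1 B2 N12.
have K34 := normr_minor_chord dD B3 B4 N34.
have K14 := normr_minor_chord dD B1 B4 N14.
have K23 := normr_minor_chord dD B2 B3 N23.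
move: B1 B2 B3 B4 => [? ? ?] [? ? ?] [? ? ?] [? ? ?].
rewrite /nearby in N12 N13 N14 N23 N24 N34; rewrite /= /mixed_sum.
apply: le_trans; first by bound_norm.
rewrite le_eqVlt; apply/orP; left; apply/eqP.
by rewrite /cross_det_bound; ring.
Qed.
Lemma cross_det_eq0 (y_min : nat) P1 P2 P3 P4 :
  `|line_const x0 y0 p q| <= D%:Z ->
  (cross_det_bound n D tau Y < y_min ^ 12)%N ->
  (forall P, P \in [:: P1; P2; P3; P4] ->
    [/\ bounded_point P, cubic_through x0 y0 p q P & y_min%:Z <= y_ P.1]) ->
  {in [:: P1; P2; P3; P4] &, forall P Q, nearby P Q} ->
  cross_det P1 P2 P3 P4 = 0.
Proof.
move=> dD small on_line near.
have [|B1 C1 m1] := on_line P1; first by rewrite !inE eqxx.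
have [|B2 C2 m2] := on_line P2; first by rewrite !inE eqxx !orbT.
have [|B3 C3 m3] := on_line P3; first by rewrite !inE eqxx !orbT.
have [|B4 C4 m4] := on_line P4; first by rewrite !inE eqxx !orbT.
have upper :
    `|(y_ P1.1 * y_ P2.1 * y_ P3.1 * y_ P4.1) ^+ 3 * cross_det P1 P2 P3 P4|
    <= (cross_det_bound n D tau Y)%:Z.
  by apply: normr_cross_det_on_line => //; apply: near; rewrite !inE eqxx ?orbT.
apply: contraTeq small => det0; rewrite -leqNgt -lez_nat.
apply: le_trans upper; rewrite normrM.
have m0 : 0 <= y_min%:Z by [].
have le_y t : y_min%:Z <= y_ t -> y_min%:Z <= `|y_ t|.
  by move=> /le_trans; apply; apply: ler_norm.
have -> : (y_min ^ 12)%N%:Z =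
    (y_min%:Z * y_min%:Z * y_min%:Z * y_min%:Z) ^+ 3 * 1.
  by rewrite PoszX; ring.
apply: ler_pM; rewrite ?exprn_ge0 ?mulr_ge0 //;
  last by rewrite -gtz0_ge1 normr_gt0.
rewrite normrX lerXn2r ?nnegrE ?mulr_ge0 // !normrM.
by rewrite !ler_pM ?mulr_ge0 // le_y.
Qed.

End CrossDetVanishes.

Lemma bezout_coprimez (a b u v : int) : a * u + b * v = 1 -> coprimez u v.
Proof. by move=> abuv; apply/coprimezP; exists (a, b). Qed.

Lemma minor_eq0_multiple (z u : int * int) :
  coprimez z.1 z.2 -> minor u z = 0 ->
  exists g : int, u = (g * z.1, g * z.2).
Proof.
case: z u => [a b] [c d] /= /coprimezP[[r s] /= rs] /eqP.
rewrite subr_eq0 /= => /eqP cb_ad; exists (r * c + s * d).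
rewrite -[c in LHS]mul1r -[d in LHS]mul1r -rs; congr (_, _).
  by rewrite !mulrDl -!mulrA [b * c]mulrC cb_ad; ring.
by rewrite !mulrDl -!mulrA -cb_ad; ring.
Qed.

Lemma coprimez_minor_eq0 (z w : int * int) : coprimez z.1 z.2 ->
  coprimez w.1 w.2 -> minor w z = 0 -> w \in [:: z; (- z.1, - z.2)].
Proof.
move=> co_z co_w /(minor_eq0_multiple co_z)[g w_gz].
have : (g %| gcdz w.1 w.2)%Z by rewrite w_gz dvdz_gcd !dvdz_mulr.
rewrite (eqP co_w) dvdz1 => /eqP g1; rewrite w_gz !inE.
have [->|->] : g = 1 \/ g = -1 by lia.
  by rewrite !mul1r -surjective_pairing eqxx.
by rewrite !mulN1r eqxx orbT.
Qed.

Lemma at_most4_or_independent (A : int * int -> Prop) :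
  (forall z, A z -> coprimez z.1 z.2) ->
  at_most A 4 \/
  exists z1 z2 z3, [/\ A z1, A z2 & A z3] /\
    [/\ minor z1 z2 != 0, minor z1 z3 != 0 & minor z2 z3 != 0].
Proof.
move=> co_A; pose line z : seq (int * int) := [:: z; (- z.1, - z.2)].
have parallel z w : A z -> A w -> minor z w = 0 -> w \in line z.
  move=> Az Aw zw0; apply: coprimez_minor_eq0; [exact: co_A|exact: co_A|].
  by rewrite -[RHS]oppr0 -zw0 /minor; ring.
have [[z1 A1]|A0] := EM (exists z, A z); last first.
  by left; apply: at_most_empty => z Az; apply: A0; exists z.
have [[z2 A2 z12]|A_line] := EM (exists2 z, A z & minor z1 z != 0); last first.
  left; exists (line z1); split=> // z Az; apply: parallel => //.
  by apply/eqP; apply: contraT => z1z; case: A_line; exists z.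
have [[z3 A3 [z13 z23]]|A_lines] :=
    EM (exists2 z, A z & minor z1 z != 0 /\ minor z2 z != 0).
  by right; exists z1, z2, z3.
left; exists (line z1 ++ line z2); split=> // z Az; rewrite mem_cat.
have [/(parallel _ _ A1 Az)->//|z1z] := eqVneq (minor z1 z) 0.
have [/(parallel _ _ A2 Az)->|z2z] := eqVneq (minor z2 z) 0.
  by rewrite orbT.
by case: A_lines; exists z.
Qed.

Section DiagonalEquation.
Variables (a b c d u v : int).
Hypotheses (abuv : a * u + b * v = 1) (cduv : c * u + d * v = 1).

Lemma dvdz_diagonal_diff : (v %| a - c)%Z.
Proof.
have co_vu : coprimez v u by apply: (@bezout_coprimez b a); rewrite addrC.
rewrite -(@Gauss_dvdzl _ _ u) //; apply/dvdzP; exists (d - b).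
by move: abuv cduv; lia.
Qed.

Lemma diagonal_coef_inj (n : int) :
  `|a| <= n -> `|c| <= n -> 2 * n < v -> (a, b) = (c, d).
Proof.
move=> an cn nv; have [g ac] := dvdzP dvdz_diagonal_diff.
have v0 : 0 < v by lia.
have {}ac : a = c.
  suff g0 : g = 0 by apply/eqP; rewrite -subr_eq0 ac g0 mul0r.
  apply: contraTeq nv => g0; rewrite -leNgt.
  have : v <= `|a - c| by rewrite ac normrM (gtr0_norm v0) ler_peMl -?gtz0_ge1
    ?normr_gt0 // ltW.
  by lia.
rewrite ac; congr pair; apply: (mulIf (lt0r_neq0 v0)).
by move: abuv cduv; rewrite ac; lia.
Qed.

End DiagonalEquation.

(* The x^2 y^2 coefficient, in the basis of quartic forms in the linear
   polynomials x = x0 + p t and y = y0 + q t, kills L2 x^3 - L1 y^3 for linear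
   L1, L2 but not a nonzero constant. *)
Lemma quartic_fiber_size (x0 y0 p q a1 b1 a2 b2 g : int) (s : seq int) :
  p != 0 -> q != 0 -> g != 0 -> uniq s ->
  (forall t, t \in s -> (a2 * t + b2) * line_x x0 p t ^+ 3
    - (a1 * t + b1) * line_y y0 q t ^+ 3 = g) ->
  (size s <= 4)%N.
Proof.
move=> p0 q0 g0 us on_s; rewrite leqNgt; apply/negP => s_gt4.
pose c0 := b2 * x0 ^+ 3 - b1 * y0 ^+ 3 - g.
pose c1 := a2 * x0 ^+ 3 + 3 * b2 * x0 ^+ 2 * p
  - a1 * y0 ^+ 3 - 3 * b1 * y0 ^+ 2 * q.
pose c2 := 3 * a2 * x0 ^+ 2 * p + 3 * b2 * x0 * p ^+ 2
  - 3 * a1 * y0 ^+ 2 * q - 3 * b1 * y0 * q ^+ 2.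
pose c3 := 3 * a2 * x0 * p ^+ 2 + b2 * p ^+ 3
  - 3 * a1 * y0 * q ^+ 2 - b1 * q ^+ 3.
pose c4 := a2 * p ^+ 3 - a1 * q ^+ 3.
pose coefs := [:: c0; c1; c2; c3; c4].
have quartic0 : Poly coefs = 0.
  apply: (@roots_geq_poly_eq0 _ _ s) => //;
    last exact: leq_trans (size_Poly _) _.
  apply/allP => t /on_s quartic_t; rewrite /root horner_Poly /=; apply/eqP.
  by rewrite -[RHS](subrr g) -{1}quartic_t /c0 /c1 /c2 /c3 /c4 /line_x /line_y;
    ring.
have coef0 i : nth 0 coefs i = 0 by rewrite -coef_Poly quartic0 coef0.
have : c0 * (6 * p ^+ 2 * q ^+ 2) - c1 * (3 * p * q * (q * x0 + p * y0))
   + c2 * (x0 ^+ 2 * q ^+ 2 + 4 * x0 * y0 * p * q + y0 ^+ 2 * p ^+ 2)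
   - c3 * (3 * x0 * y0 * (q * x0 + p * y0)) + c4 * (6 * x0 ^+ 2 * y0 ^+ 2)
   = - (6 * g * p ^+ 2 * q ^+ 2) by rewrite /c0 /c1 /c2 /c3 /c4; ring.
have [-> -> -> -> ->] : [/\ c0 = 0, c1 = 0, c2 = 0, c3 = 0 & c4 = 0].
  by split; [apply: (coef0 0)|apply: (coef0 1)|apply: (coef0 2)
            |apply: (coef0 3)|apply: (coef0 4)].
rewrite !mul0r !(subr0, addr0) => /eqP; rewrite eq_sym oppr_eq0 !mulf_eq0.
by rewrite (negPf g0) (negPf p0) (negPf q0).
Qed.

Definition signed_divisors (m : nat) : seq int :=
  [seq d%:Z | d <- divisors m] ++ [seq - d%:Z | d <- divisors m].

Lemma size_signed_divisors m :
  size (signed_divisors m) = (2 * size (divisors m))%N.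
Proof. by rewrite size_cat !size_map addnn mul2n. Qed.

Lemma mem_signed_divisors m (g : int) : (0 < m)%N -> (g %| m%:Z)%Z ->
  g \in signed_divisors m.
Proof.
rewrite dvdzE => m0 gm.
have gd : `|g|%N \in divisors m by rewrite -dvdn_divisors.
rewrite mem_cat; apply/orP; have [g_ge0|g_lt0] := leP 0 g.
  by left; apply/mapP; exists `|g|%N; rewrite ?gez0_abs.
by right; apply/mapP; exists `|g|%N; rewrite ?ltz0_abs ?opprK.
Qed.

(* (a : b) as the Moebius function of t taking the values P1.2, P2.2, P3.2 at
   P1.1, P2.1, P3.1. *)
Definition moebius (P1 P2 P3 : marked_point) (t : int) : int * int :=
  let U := minor P1.2 P2.2 * (P2.1 - P3.1) in
  let V := minor P2.2 P3.2 * (P1.1 - P2.1) in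
  (U * (P1.1 - t) * P3.2.1 - V * (P3.1 - t) * P1.2.1,
   U * (P1.1 - t) * P3.2.2 - V * (P3.1 - t) * P1.2.2).

Definition moebius_det (P1 P2 P3 : marked_point) : int :=
  minor P1.2 P2.2 * minor P2.2 P3.2 * minor P1.2 P3.2
  * ((P1.1 - P2.1) * (P2.1 - P3.1) * (P1.1 - P3.1)).

Lemma minor_moebius P1 P2 P3 P :
  minor (moebius P1 P2 P3 P.1) P.2 = cross_det P1 P2 P3 P.
Proof. by rewrite /moebius /cross_det /minor /=; ring. Qed.

Lemma dvdz_moebius_det P1 P2 P3 P (g : int) :
  moebius P1 P2 P3 P.1 = (g * P.2.1, g * P.2.2) ->
  (g %| moebius_det P1 P2 P3)%Z.
Proof.
move=> M_g; apply/dvdzP.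
exists (minor P1.2 P2.2 * (P2.1 - P3.1) * minor P.2 P3.2
        - minor P2.2 P3.2 * (P1.1 - P2.1) * minor P.2 P1.2).
transitivity (minor P1.2 P2.2 * (P2.1 - P3.1) *
  minor (moebius P1 P2 P3 P.1) P3.2
  - minor P2.2 P3.2 * (P1.1 - P2.1) * minor (moebius P1 P2 P3 P.1) P1.2).
  by rewrite /moebius_det /moebius /minor /=; ring.
by rewrite M_g /minor /=; ring.
Qed.

Section LineBlock.
Variables (n Y y_min tau D K : nat) (x0 y0 p q t0 : int).
Hypotheses (p_neq0 : p != 0) (q_neq0 : q != 0).
Hypothesis line_const_le : `|line_const x0 y0 p q| <= D%:Z.
Hypothesis coef_small : (2 * n < y_min ^ 3)%N.
Hypothesis cross_det_small : (cross_det_bound n D tau Y < y_min ^ 12)%N.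
Hypothesis divisors_le : forall m : nat, (0 < m)%N ->
  (m <= (2 * n ^ 2) ^ 3 * tau ^ 3)%N -> (size (divisors m) <= K)%N.

Definition block_point (P : marked_point) : Prop :=
  [/\ t0 <= P.1 <= t0 + tau%:Z, cubic_through x0 y0 p q P,
      bounded_point n Y x0 y0 p q P, `|P.2.2| <= n%:Z &
      y_min%:Z <= line_y y0 q P.1].

Lemma block_point_nearby P Q : block_point P -> block_point Q -> nearby tau P Q.
Proof. by move=> [Pt _ _ _ _] [Qt _ _ _ _]; rewrite /nearby; lia. Qed.

Lemma block_point_coprime P : block_point P -> coprimez P.2.1 P.2.2.
Proof.
move=> [_ C _ _ _]; apply: bezout_coprimez.
by rewrite mulrC [X in _ + X]mulrC; exact: C.
Qed.

Lemma block_point_inj P Q :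
  block_point P -> block_point Q -> P.1 = Q.1 -> P = Q.
Proof.
case: P Q => [t [a b]] [u [c d]].
move=> [_ C1 [a_le _ _] _ y_ge] [_ C2 [c_le _ _] _ _] /= tu.
rewrite tu in C1 y_ge *; congr pair.
apply: (diagonal_coef_inj C1 C2 a_le c_le).
apply: (@lt_le_trans _ _ (y_min%:Z ^+ 3)).
  by rewrite -PoszX -PoszM ltz_nat.
by apply: lerXn2r => //; rewrite nnegrE // (le_trans _ y_ge).
Qed.

Lemma block_points_minor_neq0 P Q :
  block_point P -> block_point Q -> minor P.2 Q.2 != 0 -> P.1 - Q.1 != 0.
Proof.
move=> bP bQ; apply: contraNneq => /eqP; rewrite subr_eq0 => /eqP PQ.
by rewrite (block_point_inj bP bQ PQ) /minor subrr.
Qed.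

Lemma block_points_cross_det P1 P2 P3 P4 :
  block_point P1 -> block_point P2 -> block_point P3 -> block_point P4 ->
  cross_det P1 P2 P3 P4 = 0.
Proof.
move=> B1 B2 B3 B4.
have block P : P \in [:: P1; P2; P3; P4] -> block_point P.
  by rewrite !inE => /or4P[] /eqP->.
apply: (cross_det_eq0 (D := D) (x0 := x0) (y0 := y0) (p := p) (q := q)) => //.
  exact: cross_det_small.
  by move=> P /block[].
by move=> P Q /block bP /block bQ; apply: block_point_nearby.
Qed.

Section ThreePoints.
Variables P1 P2 P3 : marked_point.
Hypotheses (B1 : block_point P1) (B2 : block_point P2) (B3 : block_point P3).
Hypotheses (minor12 : minor P1.2 P2.2 != 0) (minor13 : minor P1.2 P3.2 != 0)
  (minor23 : minor P2.2 P3.2 != 0).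

Lemma moebius_det_neq0 : moebius_det P1 P2 P3 != 0.
Proof. by rewrite /moebius_det !mulf_neq0 // block_points_minor_neq0. Qed.

Lemma moebius_det_le :
  (`|moebius_det P1 P2 P3| <= (2 * n ^ 2) ^ 3 * tau ^ 3)%N.
Proof.
have minor_le P Q : block_point P -> block_point Q ->
    `|minor P.2 Q.2| <= n%:Z * n%:Z + n%:Z * n%:Z.
  by move=> [_ _ [? _ _] ? _] [_ _ [? _ _] ? _]; rewrite /minor; bound_norm.
have minor12_le := minor_le _ _ B1 B2; have minor13_le := minor_le _ _ B1 B3.
have minor23_le := minor_le _ _ B2 B3; rewrite -lez_nat abszE.
have := block_point_nearby B1 B2; have := block_point_nearby B1 B3.
have := block_point_nearby B2 B3; rewrite /nearby /moebius_det => ? ? ?.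
apply: le_trans; first by bound_norm.
by rewrite le_eqVlt !(PoszM, PoszX); apply/orP; left; apply/eqP; ring.
Qed.

Lemma block_point_moebius P : block_point P ->
  exists2 g : int, g \in signed_divisors `|moebius_det P1 P2 P3| &
    g != 0 /\ moebius P1 P2 P3 P.1 = (g * P.2.1, g * P.2.2).
Proof.
move=> bP; have [|g M_g] := minor_eq0_multiple (u := moebius P1 P2 P3 P.1)
  (block_point_coprime bP).
  by rewrite minor_moebius; apply: block_points_cross_det.
have g_dvd := dvdz_moebius_det M_g.
exists g; last first.
  by split=> //; apply: contraTneq g_dvd => ->; rewrite dvd0z moebius_det_neq0.
apply: mem_signed_divisors; first by rewrite absz_gt0 moebius_det_neq0.
by move: g_dvd; rewrite !dvdzE.
Qed.

Definition moebius_multiple (g : int) (P : marked_point) : Prop :=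
  block_point P /\ moebius P1 P2 P3 P.1 = (g * P.2.1, g * P.2.2).

Lemma moebius_multiple_few (g : int) : g != 0 -> at_most (moebius_multiple g) 4.
Proof.
move=> g_neq0.
have [//|[s [us size_s sP]]] := at_most_or_uniq (moebius_multiple g) 4.
suff : (size (map fst s) <= 4)%N by rewrite size_map size_s.
pose U := minor P1.2 P2.2 * (P2.1 - P3.1).
pose V := minor P2.2 P3.2 * (P1.1 - P2.1).
apply: (@quartic_fiber_size x0 y0 p q (U * P3.2.2 - V * P1.2.2)
  (V * P3.1 * P1.2.2 - U * P1.1 * P3.2.2) (V * P1.2.1 - U * P3.2.1)
  (U * P1.1 * P3.2.1 - V * P3.1 * P1.2.1) g) => //.
  rewrite map_inj_in_uniq // => P Q /sP[bP _] /sP[bQ _]; exact: block_point_inj.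
move=> t /mapP[P /sP[[_ C _ _ _] [M1 M2]] ->].
transitivity
  (g * P.2.1 * line_x x0 p P.1 ^+ 3 + g * P.2.2 * line_y y0 q P.1 ^+ 3).
  by rewrite -M1 -M2 -/U -/V; ring.
by rewrite -[RHS]mulr1 -C; ring.
Qed.

Lemma block_points_few : at_most block_point (8 * K).
Proof.
pose W := `|moebius_det P1 P2 P3|%N.
pose gs := [seq g <- signed_divisors W | g != 0].
have size_gs : (size gs <= 2 * K)%N.
  apply: leq_trans (_ : size (signed_divisors W) <= _)%N.
    by rewrite size_filter count_size.
  rewrite size_signed_divisors leq_mul2l divisors_le ?moebius_det_le //.
  by rewrite absz_gt0 moebius_det_neq0.
have few := @at_most_bigcup _ _ gs moebius_multiple _ 4 size_gs.
apply: at_most_le (few _) _ _ => [g|P bP|]; last by rewrite mulnAC.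
  by rewrite mem_filter => /andP[/moebius_multiple_few].
have [g gW [g0 M_g]] := block_point_moebius bP.
by exists g; [rewrite mem_filter g0|].
Qed.

End ThreePoints.

Lemma block_coefs_few :
  at_most (fun z : int * int => exists t, block_point (t, z)) (8 * K + 4).
Proof.
have [|A4|] := @at_most4_or_independent (fun z => exists t, block_point (t, z)).
- by move=> z [t /block_point_coprime].
- by apply: at_most_le A4 _ _; rewrite ?leq_addl.
move=> [z1 [z2 [z3 [[[t1 B1] [t2 B2] [t3 B3]] [m12 m13 m23]]]]].
apply: at_most_le
  (at_most_image snd (block_points_few B1 B2 B3 m12 m13 m23)) _ _.
  by move=> z [t bz]; exists (t, z).
exact: leq_addr.
Qed.

End LineBlock.

(** * The divisor bound and Dirichlet approximation *)

Lemma size_divisors_pfactor p e m : prime p -> (0 < m)%N -> coprime p m ->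
  (size (divisors (p ^ e * m)) <= e.+1 * size (divisors m))%N.
Proof.
move=> p_pr m0 co_pm.
have n0 : (0 < p ^ e * m)%N by rewrite muln_gt0 expn_gt0 prime_gt0.
rewrite -(size_iota 0 e.+1) -(size_allpairs (fun i d => (p ^ i * d)%N)).
apply: uniq_leq_size (divisors_uniq _) _ => d.
rewrite -dvdn_divisors // => d_dvd.
have [d' co_pd' dE] := pfactor_coprime p_pr (dvdn_gt0 n0 d_dvd).
apply/allpairsP; exists (logn p d, d'); split; last by rewrite /= mulnC.
  have : (p ^ logn p d %| p ^ e * m)%N by rewrite (dvdn_trans _ d_dvd) // {2}dE
    dvdn_mull.
  rewrite mem_iota ltnS Gauss_dvdl ?coprimeXl //.
  by rewrite dvdn_Pexp2l ?prime_gt1.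
have : (d' %| p ^ e * m)%N by rewrite (dvdn_trans _ d_dvd) // {1}dE dvdn_mulr.
by rewrite -dvdn_divisors //= Gauss_dvdr // coprime_sym coprimeXl.
Qed.

Lemma expnS_le_exp2 E e : (0 < E)%N -> (e.+1 ^ E <= 2 * E ^ E * 2 ^ e)%N.
Proof.
move=> E0; have eE : (e.+1 <= E * 2 ^ (e.+1 %/ E))%N.
  apply: (@leq_trans (E * (e.+1 %/ E).+1)).
    by rewrite ltnW // mulnC ltn_ceil.
  by rewrite leq_mul2l ltn_expl ?orbT.
apply: leq_trans (_ : (E * 2 ^ (e.+1 %/ E)) ^ E <= _)%N.
  by rewrite leq_exp2r.
rewrite expnMn -expnM -mulnA mulnCA leq_mul2l -expnS leq_exp2l //.
by rewrite leq_trunc_div orbT.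
Qed.

Lemma expnS_le_exp_prime E p e : (0 < E)%N -> prime p -> (0 < e)%N ->
  (e.+1 ^ E <= (2 * E ^ E) ^ (p < 2 ^ E) * p ^ e)%N.
Proof.
move=> E0 p_pr e0; have [p_lt|p_ge] := ltnP p (2 ^ E).
  apply: leq_trans (expnS_le_exp2 e E0) _.
  by rewrite leq_mul2l leq_exp2r // prime_gt1 ?orbT.
rewrite mul1n; apply: leq_trans (_ : (2 ^ e) ^ E <= _)%N.
  by rewrite leq_exp2r // ltn_expl.
by rewrite -expnM mulnC expnM leq_exp2r.
Qed.

Lemma perm_primes_pfactor p e m : prime p -> (0 < e)%N -> (0 < m)%N ->
  coprime p m -> perm_eq (primes (p ^ e * m)) (p :: primes m).
Proof.
move=> p_pr e0 m0 co_pm; apply: uniq_perm; rewrite ?primes_uniq //=.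
  by rewrite primes_uniq andbT mem_primes p_pr m0 -prime_coprime.
by move=> r; rewrite primesM ?expn_gt0 ?(prime_gt0 p_pr) // primesX //
  primes_prime // inE.
Qed.

Lemma size_divisors_le_small_primes E n : (0 < E)%N -> (0 < n)%N ->
  (size (divisors n) ^ E
    <= (2 * E ^ E) ^ count (fun p => p < 2 ^ E) (primes n) * n)%N.
Proof.
move=> E0; elim/ltn_ind: n => n IHn n0.
have [n1|n1] := leqP n 1.
  have -> : n = 1%N by lia.
  by rewrite (_ : divisors 1 = [:: 1%N]) // exp1n.
have p_pr := pdiv_prime n1; set p := pdiv n in p_pr.
have [m co_pm nE] := pfactor_coprime p_pr n0; set e := logn p n in nE.
have e0 : (0 < e)%N by rewrite logn_gt0 mem_primes p_pr n0 pdiv_dvd.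
have m0 : (0 < m)%N by move: n0; rewrite nE; case: (m).
have mn : (m < n)%N.
  by rewrite nE -{1}[m]muln1 ltn_mul2l m0 -{1}(expn0 p) ltn_exp2l // prime_gt1.
rewrite nE mulnC (permP (perm_primes_pfactor p_pr e0 m0 co_pm)) /= expnD.
apply: leq_trans (_ : (e.+1 * size (divisors m)) ^ E <= _)%N.
  by rewrite leq_exp2r // size_divisors_pfactor.
by rewrite expnMn mulnACA leq_mul ?expnS_le_exp_prime ?IHn.
Qed.

Lemma divisor_bound E : (0 < E)%N ->
  exists C, forall n, (0 < n)%N -> (size (divisors n) ^ E <= C * n)%N.
Proof.
move=> E0; exists ((2 * E ^ E) ^ 2 ^ E)%N => n n0.
apply: leq_trans (size_divisors_le_small_primes E0 n0) _.
rewrite leq_mul2r leq_pexp2l ?orbT ?muln_gt0 ?expn_gt0 ?E0 //.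
rewrite -size_filter -[leqRHS](size_iota 0); apply: uniq_leq_size.
  by rewrite filter_uniq // primes_uniq.
by move=> p; rewrite mem_filter mem_iota => /andP[].
Qed.

Lemma pigeonhole_ltn (Q : nat) (f : nat -> nat) :
  (forall i, (i <= Q)%N -> (f i < Q)%N) ->
  exists i j, (i < j <= Q)%N /\ f i = f j.
Proof.
move=> f_lt; pose g (i : 'I_Q.+1) := Ordinal (f_lt i (ltn_ord i)).
have /injectivePn[i [j neq_ij gij]] : ~~ injectiveb g.
  by apply/negP => /injectiveP /leq_card; rewrite !card_ord ltnn.
have {gij}fij : f i = f j by have := congr1 val gij.
case: (ltngtP i j) => [ij|ji|/val_inj ij].
- by exists i, j; rewrite ij -ltnS ltn_ord.
- by exists j, i; rewrite ji -ltnS ltn_ord.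
by rewrite ij eqxx in neq_ij.
Qed.

Lemma dist_ltn_of_eq_divn (y Q r s : nat) : (0 < y)%N ->
  ((Q * r) %/ y = (Q * s) %/ y)%N -> `|r%:Z - s%:Z| * Q%:Z < y%:Z.
Proof.
move=> y0 same_cell; have := ltn_pmod (Q * r) y0; have := ltn_pmod (Q * s) y0.
rewrite -(ger0_norm (le0z_nat Q)) -normrM mulrBl.
have := divn_eq (Q * r) y; have := divn_eq (Q * s) y; rewrite same_cell.
by move: (_ %/ y)%N (Q * r %% y)%N (Q * s %% y)%N; lia.
Qed.

Lemma approx_by_fraction (x y Q : nat) : (0 < y)%N -> (0 < Q)%N ->
  exists p q : nat,
    (0 < q <= Q)%N /\ `|q%:Z * x%:Z - p%:Z * y%:Z| * Q%:Z < y%:Z.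
Proof.
move=> y0 Q0; have [|i [j [ij same_cell]]] :=
  @pigeonhole_ltn Q (fun i => (Q * (x * i %% y)) %/ y)%N.
  by move=> i _; rewrite ltn_divLR // ltn_mul2l Q0 ltn_pmod.
have xij : (x * i %/ y <= x * j %/ y)%N by rewrite leq_div2r // leq_mul2l; lia.
exists (x * j %/ y - x * i %/ y)%N, (j - i)%N; split; first by lia.
rewrite (_ : _ - _ = (x * j %% y)%N%:Z - (x * i %% y)%N%:Z).
  by apply: dist_ltn_of_eq_divn.
have /andP[/ltnW leij _] := ij; rewrite -!subzn // !mulrBl.
have := divn_eq (x * j) y; have := divn_eq (x * i) y.
by move: (x * i %/ y)%N (x * j %/ y)%N (x * i %% y)%N (x * j %% y)%N; lia.
Qed.

Lemma approx_by_reduced_fraction (x y Q : nat) : (0 < y)%N -> (0 < Q)%N ->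
  exists p q : nat, [/\ (0 < q <= Q)%N, coprime p q &
    `|q%:Z * x%:Z - p%:Z * y%:Z| * Q%:Z < y%:Z].
Proof.
move=> y0 Q0; have [p [q [/andP[q0 qQ] approx]]] := approx_by_fraction x y0 Q0.
have g0 : (0 < gcdn p q)%N by rewrite gcdn_gt0 q0 orbT.
exists (p %/ gcdn p q)%N, (q %/ gcdn p q)%N; split.
- by rewrite divn_gt0 // dvdn_leq ?dvdn_gcdr //= (leq_trans (leq_div _ _)).
- by rewrite /coprime -(eqn_pmul2r g0) mul1n muln_gcdl !divnK ?dvdn_gcdl
    ?dvdn_gcdr.
apply: le_lt_trans approx; apply: ler_wpM2r => //.
have := divnK (dvdn_gcdr p q); have := divnK (dvdn_gcdl p q).
move: (gcdn p q) g0 (q %/ _)%N (p %/ _)%N => g g0 q' p' <- <-.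
rewrite (_ : (q' * g)%N%:Z * _ - _ = g%:Z * (q'%:Z * x%:Z - p'%:Z * y%:Z)).
  by rewrite normrM ler_peMl // ger0_norm.
by rewrite !PoszM; ring.
Qed.

(** * Solutions with x and y in the middle range *)

Lemma line_parameter (p q x y x1 y1 : nat) : (0 < q)%N -> coprime p q ->
  q%:Z * x%:Z - p%:Z * y%:Z = q%:Z * x1%:Z - p%:Z * y1%:Z ->
  let t := (y %/ q)%N%:Z - (y1 %/ q)%N%:Z in
  line_x x1 p t = x /\ line_y y1 q t = y.
Proof.
move=> q0 co_pq same_line t; have qz : q%:Z != 0 by rewrite eqz_nat -lt0n.
have mod_eq : (y %% q = y1 %% q)%N.
  apply/eqP; rewrite -eqz_nat -!modz_nat eqz_mod_dvd.
  rewrite -(@Gauss_dvdzr _ p%:Z); last by rewrite coprimezE /= coprime_sym.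
  by apply/dvdzP; exists (x%:Z - x1%:Z); lia.
have yE : y%:Z = y1%:Z + q%:Z * t.
  rewrite /t {1}(divn_eq y q) {1}(divn_eq y1 q) mod_eq !PoszD !PoszM; ring.
split; last by rewrite yE.
by apply: (mulfI qz); rewrite yE in same_line; rewrite /line_x; lia.
Qed.

Section MiddleRange.
Variables (n Y y_min tau Q K : nat).
Let D := (Y %/ Q)%N.
Let slope_max := (Y %/ y_min).+1.
Hypotheses (y_min_gt0 : (0 < y_min)%N) (Q_gt0 : (0 < Q)%N).
Hypothesis tau_gt0 : (0 < tau)%N.
Hypothesis range_narrow : (Y < y_min * Q)%N.
Hypothesis coef_small : (2 * n < y_min ^ 3)%N.
Hypothesis cross_det_small : (cross_det_bound n D tau Y < y_min ^ 12)%N.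
Hypothesis divisors_le : forall m : nat, (0 < m)%N ->
  (m <= (2 * n ^ 2) ^ 3 * tau ^ 3)%N -> (size (divisors m) <= K)%N.

Definition middle_solution (z : int * int) (x y : nat) : Prop :=
  [/\ (y_min <= x <= Y)%N, (y_min <= y <= Y)%N,
      z.1 * x%:Z ^+ 3 + z.2 * y%:Z ^+ 3 = 1 & `|z.1| <= n%:Z /\ `|z.2| <= n%:Z].

Definition on_block (p q : nat) (d : int) (j : nat) (z : int * int) : Prop :=
  exists x y, [/\ middle_solution z x y, q%:Z * x%:Z - p%:Z * y%:Z = d &
    ((y %/ q) %/ tau)%N = j].

Lemma on_block_few p q d j : (0 < p)%N -> (0 < q)%N -> coprime p q ->
  `|d| <= D%:Z -> at_most (on_block p q d j) (8 * K + 4).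
Proof.
move=> p0 q0 co_pq dD.
have [[z1 [x1 [y1 [_ d1 _]]]]|no_z] :=
  EM (exists z, on_block p q d j z); last first.
  by apply: at_most_empty => z bz; apply: no_z; exists z.
have few := @block_coefs_few n Y y_min tau D K x1%:Z y1%:Z p%:Z q%:Z
  ((j * tau)%N%:Z - (y1 %/ q)%N%:Z).
apply: at_most_le (few _ _ _ _ _ _) _ _ => //; rewrite ?eqz_nat -?lt0n //.
  by rewrite /line_const d1.
move=> z [x [y [[/andP[xm xY] /andP[ym yY] e [an bn]] dE jE]]].
pose t := (y %/ q)%N%:Z - (y1 %/ q)%N%:Z.
have [xE yE] := line_parameter q0 co_pq (etrans dE (esym d1)).
rewrite -/t in xE yE.
exists t; split; rewrite /cubic_through ?xE ?yE //=; last first.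
  by split; rewrite ?xE ?yE.
rewrite /t -jE; have := divn_eq (y %/ q) tau; have := ltn_pmod (y %/ q) tau_gt0.
move: ((y %/ q) %/ tau)%N ((y %/ q) %% tau)%N (y1 %/ q)%N => a b c b_lt ->.
by clear -b_lt; lia.
Qed.

Definition on_line (p q : nat) (d : int) (z : int * int) : Prop :=
  exists x y, middle_solution z x y /\ q%:Z * x%:Z - p%:Z * y%:Z = d.

Lemma on_line_few p q d : (0 < p)%N -> (0 < q)%N -> coprime p q ->
  `|d| <= D%:Z -> at_most (on_line p q d) ((Y %/ (q * tau)).+1 * (8 * K + 4)).
Proof.
move=> p0 q0 co_pq dD; pose js := iota 0 (Y %/ (q * tau)).+1.
have few := @at_most_bigcup _ _ js (on_block p q d)
  (Y %/ (q * tau)).+1 (8 * K + 4).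
apply: at_most_le (few _ _) _ _ => //; first by rewrite size_iota.
  by move=> j _; apply: on_block_few.
move=> z [x [y [s dE]]]; exists ((y %/ q) %/ tau)%N; last by exists x, y.
by case: s => _ /andP[_ yY] _ _;
  rewrite mem_iota /= add0n ltnS -divnMA leq_div2r.
Qed.

Definition near_slope (p q : nat) (z : int * int) : Prop :=
  exists x y, middle_solution z x y /\ `|q%:Z * x%:Z - p%:Z * y%:Z| <= D%:Z.

Lemma near_slope_few p q : (0 < p)%N -> (0 < q)%N -> coprime p q ->
  at_most (near_slope p q) ((2 * D + 1) * ((Y %/ (q * tau)).+1 * (8 * K + 4))).
Proof.
move=> p0 q0 co_pq.
have few := @at_most_bigcup _ _ (int_range D) (on_line p q) (2 * D + 1).
apply: at_most_le (few _ _ _) _ (leqnn _); first by rewrite size_int_range.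
  by move=> d; rewrite mem_int_range => dD; apply: on_line_few.
move=> z [x [y [s dD]]]; exists (q%:Z * x%:Z - p%:Z * y%:Z).
  by rewrite mem_int_range.
by exists x, y.
Qed.

Lemma near_slope_denominator_few q : (0 < q <= Q)%N ->
  at_most (fun z => exists2 p,
    p \in [seq p <- iota 1 (slope_max * q) | coprime p q]
                                 & near_slope p q z)
    (slope_max * ((2 * D + 1) * ((Y %/ tau + Q) * (8 * K + 4)))).
Proof.
move=> /andP[q0 qQ]; set ps := [seq p <- _ | _].
have size_ps : (size ps <= slope_max * q)%N.
  by rewrite size_filter -[leqRHS](size_iota 1) count_size.
have few := at_most_bigcup (A := fun p => near_slope p q) size_ps.
apply: at_most_le (few _ _) _ _ => [p|//|].
  by rewrite mem_filter mem_iota => /and3P[co_pq p0 _]; apply: near_slope_few.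
rewrite -mulnA leq_mul2l mulnCA leq_mul2l mulnA leq_mul2r mulnS.
rewrite [(q + _)%N]addnC leq_add ?orbT //.
by rewrite [(q * tau)%N]mulnC divnMA mulnC leq_trunc_div.
Qed.

Lemma middle_solution_near_slope z x y : middle_solution z x y ->
  exists p q, [/\ (0 < q <= Q)%N, (0 < p <= slope_max * q)%N, coprime p q &
    near_slope p q z].
Proof.
move=> s; have [/andP[xm xY] /andP[ym yY] _ _] := s.
have y0 : (0 < y)%N by apply: leq_trans ym.
have [p [q [/andP[q0 qQ] co_pq approx]]] :=
  approx_by_reduced_fraction x y0 Q_gt0.
exists p, q; split; rewrite ?q0 //; last first.
  exists x, y; split=> //; rewrite -abszE lez_nat leq_divRL //.
  by rewrite (leq_trans _ yY) // -lez_nat PoszM abszE ltW.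
have p0 : (0 < p)%N.
  rewrite lt0n; apply: contraTneq approx => ->.
  rewrite mul0r subr0 -leNgt ger0_norm // -!PoszM lez_nat.
  apply: leq_trans yY _; apply: leq_trans (ltnW range_narrow) _.
  by rewrite leq_mul2r (leq_trans xm) ?orbT // leq_pmull.
rewrite p0 /=; have x_le : (x <= slope_max * y)%N.
  apply: leq_trans xY _; apply: leq_trans (_ : slope_max * y_min <= _)%N.
    by rewrite ltnW // ltn_ceil.
  by rewrite leq_mul2l ym orbT.
have dist_lt : `|q%:Z * x%:Z - p%:Z * y%:Z| < y%:Z.
  by apply: le_lt_trans approx; rewrite ler_peMr.
have py_lt : (p * y < q * x + y)%N by lia.
suff : (p * y < (slope_max * q).+1 * y)%N by rewrite ltn_mul2r y0 ltnS.
apply: leq_trans py_lt _.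
by rewrite mulSn addnC leq_add2l mulnAC mulnC leq_mul2r x_le orbT.
Qed.

Lemma middle_range_few :
  at_most (fun z => exists x y, middle_solution z x y)
    (Q * (slope_max * ((2 * D + 1) * ((Y %/ tau + Q) * (8 * K + 4)))))%N.
Proof.
pose at_denominator q z := exists2 p,
  p \in [seq p <- iota 1 (slope_max * q) | coprime p q] & near_slope p q z.
have few := @at_most_bigcup _ _ (iota 1 Q) at_denominator Q.
apply: at_most_le (few _ _ _) _ (leqnn _); first by rewrite size_iota.
  by move=> q; rewrite mem_iota add1n ltnS; apply: near_slope_denominator_few.
move=> z [x [y /middle_solution_near_slope[p [q [qQ pq co_pq near]]]]].
exists q; first by rewrite mem_iota add1n ltnS.
by exists p; rewrite // mem_filter mem_iota add1n ltnS co_pq.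
Qed.

End MiddleRange.

(** * Counting coefficients of soluble equations *)

Definition coef_bounded (n : nat) (z : int * int) : Prop :=
  [/\ `|z.1| <= n%:Z, `|z.2| <= n%:Z, z.1 != 0 & z.2 != 0].

Definition nat_solution (k n : nat) (z : int * int) (x y : nat) : Prop :=
  coef_bounded n z /\ z.1 * x%:Z ^+ k + z.2 * y%:Z ^+ k = 1.

Definition globally_soluble (k n : nat) (z : int * int) : Prop :=
  coef_bounded n z /\ solvable_over int k z.1 z.2.

Lemma nat_solution_swap k n a b x y :
  nat_solution k n (a, b) x y -> nat_solution k n (b, a) y x.
Proof. by move=> [[/= an bn a0 b0] e]; split; rewrite //= addrC. Qed.

Lemma nat_solution_few_l k n x y : (0 < y)%N ->
  at_most (fun z => nat_solution k n z x y) ((2 * n) %/ y ^ k).+1.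
Proof.
move=> y0; have yk0 : (0 < y ^ k)%N by rewrite expn_gt0 y0.
have a_few : at_most (fun a => exists b, nat_solution k n (a, b) x y)
  ((2 * n) %/ y ^ k).+1.
  apply: at_most_congruent => // [a [b [[]]] //|a c [b [_ e]] [d [_ e']]].
  by rewrite PoszX; apply: dvdz_diagonal_diff e e'.
pose pair_of a := (a, ((1 - a * x%:Z ^+ k) %/ y%:Z ^+ k)%Z).
apply: at_most_le (at_most_image pair_of a_few) _ (leqnn _) => -[a b] s.
exists a; first by exists b.
case: s => _ /= e; congr pair.
by rewrite -e addrC addKr mulzK // -PoszX eqz_nat -lt0n //.
Qed.

Lemma nat_solution_few k n x y : (0 < x)%N -> (0 < y)%N ->
  at_most (fun z => nat_solution k n z x y) ((2 * n) %/ maxn x y ^ k).+1.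
Proof.
move=> x0 y0; have [xy|yx] := leqP x y; first exact: nat_solution_few_l.
apply: at_most_le (at_most_swap (nat_solution_few_l k n y x0)) _ (leqnn _).
by move=> [a b] /nat_solution_swap.
Qed.

Lemma sum_divn_square n N : (\sum_(1 <= m < N.+1) n %/ m ^ 2 <= 2 * n)%N.
Proof.
suff telescope : (0 < N)%N ->
    (\sum_(1 <= m < N.+1) n %/ m ^ 2)%N%:R + n%:R / N%:R <= 2 * n%:R :> rat.
  case: N telescope => [|N] telescope; first by rewrite big_geq.
  rewrite -(ler_nat rat) natrM; apply: le_trans (telescope isT).
  by rewrite lerDl divr_ge0.
case: N => // N _; elim: N => [|N IHN].
  by rewrite big_nat1 exp1n divn1 divr1 mulr_natl mulr2n.
rewrite big_nat_recr //= natrD; apply: le_trans IHN; rewrite -addrA lerD2l.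
have : (n %/ N.+2 ^ 2)%N%:R <= n%:R / N.+2%:R ^+ 2 :> rat.
  by rewrite ler_pdivlMr ?exprn_gt0 // -natrX -natrM ler_nat leq_trunc_div.
move=> /(lerD)/(_ (lexx (n%:R / N.+2%:R)))/le_trans; apply.
have N1 : N.+1%:R != 0 :> rat by rewrite pnatr_eq0.
have N2 : N.+1%:R + 1 != 0 :> rat by rewrite natr1 pnatr_eq0.
rewrite -[N.+2%:R]natr1 -subr_ge0.
rewrite (_ : _ - _ = n%:R / (N.+1%:R * (N.+1%:R + 1) ^+ 2))
  ?divr_ge0 ?mulr_ge0 //.
by move: (N.+1%:R) (n%:R) N1 N2 => u v u0 u1; field; rewrite u0 u1.
Qed.

Lemma nat_solution_below_few k n N : (2 < k)%N ->
  at_most (fun z => exists x y,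
      [/\ (0 < x <= N)%N, (0 < y <= N)%N & nat_solution k n z x y])
    (8 * n + 2 * N ^ 2).
Proof.
move=> k2; pose c m := ((2 * n) %/ m ^ k).+1.
pose height_eq m z := exists2 u : nat, u \in iota 1 m &
  nat_solution k n z u m \/ nat_solution k n z m u.
have height_few m : (0 < m)%N -> at_most (height_eq m) (m * (c m + c m)).
  move=> m0; apply: at_most_bigcup; first by rewrite size_iota.
  move=> u; rewrite mem_iota add1n ltnS => /andP[u0 um]; apply: at_mostU.
    by have := nat_solution_few k n u0 m0; rewrite (maxn_idPr um).
  by have := nat_solution_few k n m0 u0; rewrite (maxn_idPl um).
have [|s [size_s sP]] := @at_most_sum _ _ (index_iota 1 N.+1) height_eq
    (fun m => m * (c m + c m))%N.
  by move=> m; rewrite mem_index_iota => /andP[m0 _]; apply: height_few.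
exists s; split=> [|z [x [y [/andP[x0 xN] /andP[y0 yN] sol]]]]; last first.
  apply: sP; have [xy|yx] := leqP x y.
    exists y; first by rewrite mem_index_iota y0 ltnS.
    by exists x; [rewrite mem_iota x0 add1n ltnS|left].
  exists x; first by rewrite mem_index_iota x0 ltnS.
  by exists y; [rewrite mem_iota y0 add1n ltnS ltnW|right].
apply: leq_trans size_s _.
apply: leq_trans
  (_ : \sum_(1 <= m < N.+1) (2 * ((2 * n) %/ m ^ 2) + 2 * N) <= _)%N.
  rewrite [leqLHS]big_nat [leqRHS]big_nat; apply: leq_sum => m /andP[m0 mN].
  rewrite addnn -mul2n mulnCA -mulnDr leq_mul2l /= mulnS addnC leq_add //.
  rewrite leq_divRL ?expn_gt0 ?m0 // mulnAC -expnS mulnC.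
  apply: leq_trans (leq_trunc_div _ (m ^ k)); rewrite leq_mul2l.
  by rewrite leq_pexp2l ?orbT.
rewrite big_split /= -big_distrr /= sum_nat_const_nat subn1 /=.
rewrite [(N * _)%N]mulnCA mulnn.
by rewrite leq_add2r; have := sum_divn_square (2 * n) N; lia.
Qed.

Lemma unit_of_mulX (b y : int) k : b * y ^+ k = 1 -> b \in [:: 1; -1].
Proof.
move=> /(congr1 absz)/eqP; rewrite abszM muln_eq1 => /andP[/eqP b1 _].
by rewrite !inE; lia.
Qed.

Lemma sgzX_unit (x : int) k : x != 0 -> sgz x ^+ k \in [:: 1; -1].
Proof.
move=> x0; apply: (@unit_of_mulX _ (sgz x) k); rewrite -exprMn.
by case: sgzP x0 => [_ /eqP|_ _|_ _] //; rewrite ?mulrNN mulr1 expr1n.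
Qed.

Lemma globally_soluble_few k n m : (0 < k)%N ->
  at_most (fun z => exists x y, [/\ (0 < x)%N, (0 < y)%N &
    nat_solution k n z x y]) m ->
  at_most (globally_soluble k n) (4 * (2 * n + 1) + 4 * m).
Proof.
move=> k0 few; set positive := fun z => _ in few.
pose units : seq int := [:: 1; -1].
have unit_few : at_most (fun z : int * int => z.1 \in units /\ `|z.2| <= n%:Z)
    (2 * (2 * n + 1)).
  exists [seq (a, b) | a <- units, b <- int_range n].
  rewrite size_allpairs size_int_range; split=> // -[a b] [a_unit bn].
  by apply/allpairsP; exists (a, b); rewrite mem_int_range.
pose signs := [seq (s, t) | s <- units, t <- units].
pose signed (st : int * int) z :=
  exists2 w, positive w & z = (st.1 * w.1, st.2 * w.2).
have signed_few := at_most_bigcup (leqnn (size signs))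
  (fun st _ => at_most_image (fun w => (st.1 * w.1, st.2 * w.2)) few).
apply: at_most_le
  (at_mostU (at_mostU unit_few (at_most_swap unit_few)) signed_few) _ _;
  last by rewrite /signs /units /=; lia.
move=> [a b] [[/= an bn a0 b0]] [x [y]]; rewrite !intz => e.
have [x0|x0] := eqVneq x 0.
  left; right; split=> //=; apply: (@unit_of_mulX b y k).
  by rewrite -e x0 expr0n gtn_eqF // mulr0 add0r.
have [y0|y0] := eqVneq y 0.
  left; left; split=> //=; apply: (@unit_of_mulX a x k).
  by rewrite -e y0 expr0n gtn_eqF // mulr0 addr0.
have sx := sgzX_unit k x0; have sy := sgzX_unit k y0.
have unit_sqr s : s \in units -> s * s = 1 by rewrite !inE => /orP[]/eqP->.
have norm_unit s c : s \in units -> `|s * c| = `|c|.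
  by rewrite !inE => /orP[]/eqP->; rewrite ?mul1r // mulN1r normrN.
have unit_neq0 s : s \in units -> s != 0 by rewrite !inE => /orP[]/eqP->.
right; exists (sgz x ^+ k, sgz y ^+ k).
  by apply/allpairsP; exists (sgz x ^+ k, sgz y ^+ k).
exists (sgz x ^+ k * a, sgz y ^+ k * b); last first.
  by rewrite /= !mulrA !unit_sqr // !mul1r.
exists `|x|%N, `|y|%N; rewrite !absz_gt0; split=> //; split.
  by split; rewrite /= ?norm_unit // mulf_neq0 // unit_neq0.
by rewrite -e [in RHS](intEsg x) [in RHS](intEsg y) !exprMn /=; ring.
Qed.

(** * Cyclotomic numbers of order three *)

Lemma card_le_fibers (T U : finType) (g : T -> U) (D : {set T}) m :
  (forall y, #|[set x in D | g x == y]| <= m)%N -> (#|D| <= m * #|g @: D|)%N.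
Proof.
move=> fiber_le.
rewrite -sum1_card (partition_big g (mem (g @: D))) /=; last first.
  by move=> x xD; apply: imset_f.
rewrite mulnC -sum_nat_const; apply: leq_sum => y _.
by apply: leq_trans (fiber_le y); rewrite sum1dep_card subset_leq_card.
Qed.

Lemma sum_Z3 (G : 'Z_3 -> nat) : (\sum_i G i = G 0%R + G 1%R + G 2%R)%N.
Proof.
rewrite !big_ord_recr big_ord0 /= add0n.
by congr (_ + _ + _)%N; congr G; apply: val_inj.
Qed.

Section PowersInFiniteField.
Variable F : finFieldType.

Lemma expf_card_pred (x : F) : x != 0 -> x ^+ #|F|.-1 = 1.
Proof.
move=> x0; apply: (mulfI x0); rewrite -exprS prednK ?expf_card ?mulr1 //.
by rewrite (cardD1 0).
Qed.

Lemma card_exprf_eq k (y : F) :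
  (0 < k)%N -> (#|[set x : F | x ^+ k == y]| <= k)%N.
Proof.
move=> k0; have P0 : 'X^k - y%:P != 0 by rewrite -size_poly_eq0 size_XnsubC.
rewrite -ltnS -(size_XnsubC y k0) cardE.
apply: max_poly_roots (enum_uniq _) => //.
by apply/allP => x; rewrite mem_enum inE /root !hornerE subr_eq0.
Qed.

Lemma card_exprf_image k : (0 < k)%N ->
  (#|F|.-1 <= k * #|[set x ^+ k | x in ~: [set (0%R : F)]]|)%N.
Proof.
move=> k0; rewrite -(cardsC1 (0 : F)); apply: card_le_fibers => y.
apply: leq_trans (card_exprf_eq y k0); apply: subset_leq_card.
by apply/fintype.subsetP => x; rewrite !inE => /andP[].
Qed.

End PowersInFiniteField.

Section CyclotomicNumbers.
Variables (F : finFieldType) (f : nat).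
Hypotheses (cardF : #|F| = (3 * f).+1) (f_gt0 : (0 < f)%N).

Lemma expf_cube (x : F) : x != 0 -> (x ^+ f) ^+ 3 = 1.
Proof. by move=> x0; rewrite -exprM mulnC -[RHS](expf_card_pred x0) cardF. Qed.

Lemma cube_of_expf1 (x : F) : x ^+ f = 1 -> exists y, x = y ^+ 3.
Proof.
move=> xf; pose cubes := [set y ^+ 3 | y in ~: [set (0%R : F)]].
have cubes_sub : cubes \subset [set y : F | y ^+ f == 1].
  apply/fintype.subsetP => _ /imsetP[y y0 ->]; rewrite !inE in y0 *.
  by rewrite -exprM mulnC exprM expf_cube.
have /eqP cubesE : cubes == [set y : F | y ^+ f == 1].
  rewrite eqEcard cubes_sub (leq_trans (card_exprf_eq 1 f_gt0)) //.
  rewrite -(@leq_pmul2l 3) //.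
  by have := @card_exprf_image F 3 isT; rewrite cardF.
by have : x \in cubes; [rewrite cubesE inE xf|case/imsetP => y _ ->; exists y].
Qed.

Lemma cube_multiple (x c : F) : c != 0 -> x ^+ f = c ^+ f ->
  exists y, x = c * y ^+ 3.
Proof.
move=> c0 xc; have [|y xcE] := @cube_of_expf1 (x / c).
  by rewrite expr_div_n xc mulfV // expf_neq0.
by exists y; rewrite -xcE mulrC divfK.
Qed.

Section CubicClasses.
Variable w : F.
Hypotheses (w_neq1 : w != 1) (w_cube : w ^+ 3 = 1).
Implicit Types (x y : F) (i j k l m : 'Z_3).

Lemma cube_root_primitive : 3.-primitive_root w.
Proof.
have [m w_prim m3] := prim_order_exists (isT : (0 < 3)%N) w_cube.
have [_ /(_ m m3)/pred2P[m1|<- //]] := primeP (isT : prime 3).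
by move: w_neq1; rewrite -(prim_expr_order w_prim) m1 expr1 eqxx.
Qed.

Let w_prim := cube_root_primitive.

Definition cubic_class i : {set F} := [set x | x ^+ f == w ^+ i].

Lemma cubic_class_neq0 i x : x \in cubic_class i -> x != 0.
Proof.
rewrite inE; apply: contraTneq => ->; rewrite expr0n gtn_eqF // eq_sym.
by rewrite expf_eq0 negb_and (prim_root_eq0 w_prim) orbT.
Qed.

Lemma cubic_classM i j x y : x \in cubic_class i -> y \in cubic_class j ->
  x * y \in cubic_class (i + j).
Proof.
rewrite !inE => /eqP xi /eqP yj; rewrite exprMn xi yj -exprD.
by rewrite -(prim_expr_mod w_prim).
Qed.

Lemma cubic_classMr i j x y : y \in cubic_class j ->
  (x * y \in cubic_class i) = (x \in cubic_class (i - j)).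
Proof.
move=> yj; have y0 := cubic_class_neq0 yj.
apply/idP/idP => [|xij]; last by have := cubic_classM xij yj; rewrite subrK.
rewrite !inE in yj *; rewrite exprMn (eqP yj) => /eqP xyi.
have wj0 : w ^+ j != 0 by rewrite -(eqP yj) expf_neq0.
apply/eqP/(mulIf wj0).
by rewrite xyi -{1}(subrK j i) -exprD -[RHS](prim_expr_mod w_prim).
Qed.

Lemma cubic_class1 : 1 \in cubic_class 0.
Proof. by rewrite inE expr1n expr0. Qed.

Lemma cubic_classN i x : (- x \in cubic_class i) = (x \in cubic_class i).
Proof.
have N1f : (-1 : F) ^+ f = 1.
  have -> : -1 = (-1) ^+ 3 :> F by ring.
  by rewrite -exprM mulnC exprM expf_cube // oppr_eq0 oner_neq0.
by rewrite !inE -mulN1r exprMn N1f mul1r.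
Qed.

Lemma cubic_classV i x : x \in cubic_class i -> x^-1 \in cubic_class (- i).
Proof.
move=> xi; have := cubic_class1.
by rewrite -(mulVf (cubic_class_neq0 xi)) (cubic_classMr 0 _ xi) sub0r.
Qed.

Lemma sum_by_cubic_class (D : {set F}) (h : F -> F) (G : F -> nat) :
  {in D, forall x, h x != 0} ->
  (\sum_(x in D) G x = \sum_i \sum_(x in D | h x \in cubic_class i) G x)%N.
Proof.
move=> h0; rewrite (exchange_big_dep (mem D)) /=; last by move=> i x _ /andP[].
apply: eq_bigr => x xD; have [i xi] := prim_rootP w_prim (expf_cube (h0 x xD)).
rewrite (big_pred1 i) // => j.
by rewrite xD inE xi (eq_prim_root_expr w_prim) !modn_small // eq_sym.
Qed.

Lemma card_cubic_class i : #|cubic_class i| = f.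
Proof.
have card_le j : (#|cubic_class j| <= f)%N by apply: card_exprf_eq.
have : (\sum_j #|cubic_class j| = \sum_(j : 'Z_3) f)%N.
  rewrite sum_nat_const card_ord -[RHS]/((3 * f).+1.-1).
  rewrite -cardF -(cardsC1 (0 : F)).
  rewrite -sum1_card (@sum_by_cubic_class _ id); last by move=> x; rewrite !inE.
  apply: eq_bigr => j _; rewrite -sum1_card; apply: eq_bigl => x.
  apply/idP/andP => [xj|[]//]; split=> //.
  by have := cubic_class_neq0 xj; rewrite !inE.
have [_ sum_eq] := leqif_sum (fun j (_ : true) => leqif_eq (card_le j)).
by move=> /eqP; rewrite sum_eq => /forallP/(_ i)/eqP.
Qed.

Definition cyclotomic_number i j : nat :=
  #|[set x in cubic_class i | 1 - x \in cubic_class j]|.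
Local Notation cyc i j := (cyclotomic_number i%R j%R).

Lemma cyclotomic_numberC i j : cyc i j = cyc j i.
Proof.
rewrite /cyclotomic_number -(card_imset _ (_ : injective (fun x : F => 1 - x))).
  apply: eq_card => x; rewrite [RHS]inE; apply/imsetP/andP.
    by move=> [y]; rewrite inE => /andP[yi yj] ->; rewrite subKr.
  by move=> [xj xi]; exists (1 - x); rewrite ?subKr // inE subKr xi.
by move=> x y /addrI /oppr_inj.
Qed.

Lemma cyclotomic_numberV i j : cyc i j = cyc (- i) (j - i).
Proof.
rewrite /cyclotomic_number -(card_imset _ (@invr_inj F)); apply: eq_card => x.
have V_class k l y : y \in cubic_class k -> 1 - y \in cubic_class l ->
    y^-1 \in cubic_class (- k) /\ 1 - y^-1 \in cubic_class (l - k).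
  move=> yk yl; split; first exact: cubic_classV.
  have := cubic_classM yl (cubic_classV yk).
  by rewrite mulrBl mul1r mulfV ?(cubic_class_neq0 yk) // -cubic_classN opprB.
rewrite [RHS]inE; apply/imsetP/andP => [[y]|[xi xj]].
  by rewrite inE => /andP[yi yj] ->; apply: V_class.
exists x^-1; rewrite ?invrK // inE; have [] := V_class _ _ _ xi xj.
by rewrite opprK subrK => -> ->.
Qed.

Lemma card_cubic_sum l i j n : n \in cubic_class l ->
  #|[set x in cubic_class i | n - x \in cubic_class j]| = cyc (i - l) (j - l).
Proof.
move=> nl; have n0 := cubic_class_neq0 nl.
rewrite /cyclotomic_number -[RHS](card_imset _ (mulIf n0)); apply: eq_card => x.
rewrite inE; apply/andP/imsetP => [[xi xj]|[y]].
  exists (x / n); last by rewrite divfK.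
  rewrite inE -!(cubic_classMr _ _ nl) divfK // mulrBl mul1r divfK //.
  by rewrite xi.
rewrite inE -!(cubic_classMr _ _ nl) mulrBl mul1r => /andP[yi yj] ->.
by [].
Qed.

Lemma cyclotomic_row_sum i : (\sum_j cyc i j + (i == 0%R) = f)%N.
Proof.
rewrite -(card_cubic_class i) (cardsD1 1) addnC; congr (_ + _)%N.
  rewrite inE expr1n -[X in _ = (X == _) :> nat](expr0 w).
  by rewrite (eq_prim_root_expr w_prim) !modn_small // eq_sym.
rewrite -sum1_card (@sum_by_cubic_class _ (fun x => 1 - x)).
  apply: eq_bigr => j _; rewrite sum1dep_card; apply: eq_card => x.
  rewrite [LHS]inE [RHS]inE in_setD1; have [->|//] := eqVneq x 1.
  rewrite subrr andbC; apply/negbTE/negP => /andP[/cubic_class_neq0].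
  by rewrite eqxx.
by move=> x; rewrite !inE subr_eq0 eq_sym => /andP[].
Qed.

Definition ternary_count i j k n : nat :=
  #|[set u : F * F | [&& u.1 \in cubic_class i, u.2 \in cubic_class j
                       & n - u.1 - u.2 \in cubic_class k]]|.

Lemma ternary_countC i j k n : ternary_count i j k n = ternary_count k j i n.
Proof.
pose swap (u : F * F) := (n - u.1 - u.2, u.2).
have thirdK x y : n - (n - x - y) - y = x by ring.
have swapK : involutive swap by move=> [x y]; rewrite /swap /= thirdK.
rewrite /ternary_count -(card_imset _ (inv_inj swapK)).
apply: eq_card => -[x y].
rewrite [RHS]inE; apply/imsetP/and3P => [[[z t]]|[xk yj zi]].
  by rewrite inE => /and3P[zi tj tk] [-> ->]; split; rewrite //= thirdK.
by exists (swap (x, y)); rewrite ?swapK // inE /= thirdK xk yj zi.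
Qed.

Lemma ternary_countE i j k m n : n \in cubic_class m -> m != i ->
  ternary_count i j k n =
    (\sum_(l : 'Z_3) cyc (i - m) (l - m) * cyc (j - l) (k - l))%N.
Proof.
move=> nm mi; rewrite /ternary_count.
transitivity (\sum_(x in cubic_class i)
    #|[set y in cubic_class j | (n - x - y)%R \in cubic_class k]|)%N.
  under [RHS]eq_bigr do rewrite -sum1dep_card.
  by rewrite pair_big_dep /= -sum1dep_card.
rewrite (@sum_by_cubic_class _ (fun x => n - x)); last first.
  move=> x xi; rewrite subr_eq0; apply: contraNneq mi => nx.
  move: nm xi; rewrite nx !inE => /eqP-> ; rewrite (eq_prim_root_expr w_prim).
  by rewrite !modn_small.
apply: eq_bigr => l _; rewrite -(card_cubic_sum i l nm) -sum_nat_const.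
apply: eq_big => x; first by rewrite !inE.
by move=> /andP[_ nxl]; rewrite (card_cubic_sum j k nxl).
Qed.

(* Both sides count x + y + z = n with x, y cubes, z in the class of w and
   n in the class of w^2; they are broken up according to the class of y + z,
   respectively of x + y. *)
Lemma cyclotomic_associativity :
  (cyc 1 1 * cyc 0 1 + cyc 1 2 * cyc 2 0 + cyc 1 0 * cyc 1 2 =
   cyc 2 1 * cyc 0 0 + cyc 2 2 * cyc 2 2 + cyc 2 0 * cyc 1 1)%N.
Proof.
have /card_gt0P[n n2] : (0 < #|cubic_class 2%R|)%N by rewrite card_cubic_class.
have := ternary_countC 0 0 1 n; rewrite !(ternary_countE _ _ n2) //.
rewrite !sum_Z3 => count_eq; apply: etrans (etrans count_eq _); [symmetry|];
  congr (_ + _ + _)%N; congr (_ * _)%N; congr cyclotomic_number; exact: val_inj.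
Qed.

Lemma cyclotomic_numbers_gt0 : (2 < f)%N -> (0 < cyc 1 1)%N /\ (0 < cyc 1 2)%N.
Proof.
have cyc20 : cyc 2 0 = cyc 1 1.
  by rewrite [RHS]cyclotomic_numberV; congr cyclotomic_number; apply: val_inj.
have cyc22 : cyc 2 2 = cyc 0 1.
  rewrite [RHS]cyclotomic_numberC [RHS]cyclotomic_numberV.
  by congr cyclotomic_number; apply: val_inj.
have := cyclotomic_row_sum 0; have := cyclotomic_row_sum 1.
have := cyclotomic_associativity; rewrite !sum_Z3 /= cyc20 cyc22.
rewrite (cyclotomic_numberC 0 2) cyc20 (cyclotomic_numberC 1 0)
  (cyclotomic_numberC 2 1).
move: (cyc 0 0) (cyc 0 1) (cyc 1 1) (cyc 1 2) => A B C D assoc row1 row0 f_gt2.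
split; last by lia.
rewrite lt0n; apply: contraTneq f_gt2 => C0; rewrite C0 in assoc row1 row0.
have D_A : D = A.+1 by lia.
have B_le1 : (B <= 1)%N by nia.
by nia.
Qed.

End CubicClasses.

Lemma diagonal_cubic_solvable (a b : F) : (2 < f)%N -> a != 0 -> b != 0 ->
  exists x y, a * x ^+ 3 + b * y ^+ 3 = 1.
Proof.
move=> f_gt2 a0 b0; have cube0 : 0 ^+ 3 = 0 :> F by rewrite expr0n.
have [a1|a1] := eqVneq (a ^+ f) 1.
  have [|x xE] := @cube_multiple 1 a a0; first by rewrite expr1n a1.
  by exists x, 0; rewrite cube0 mulr0 addr0.
have [b1|b1] := eqVneq (b ^+ f) 1.
  have [|y yE] := @cube_multiple 1 b b0; first by rewrite expr1n b1.
  by exists 0, y; rewrite cube0 mulr0 add0r.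
have w_cube := expf_cube a0.
have [j bj] := prim_rootP (cube_root_primitive a1 w_cube) (expf_cube b0).
have [cyc11_gt0 cyc12_gt0] := cyclotomic_numbers_gt0 a1 w_cube f_gt2.
have /card_gt0P[x] : (0 < cyclotomic_number (a ^+ f) 1%R j)%N.
  case: j bj => -[|[|[|//]]] j_lt3 bj; first by rewrite bj expr0 eqxx in b1.
    by rewrite (_ : Ordinal j_lt3 = 1) //; apply: val_inj.
  by rewrite (_ : Ordinal j_lt3 = 2%R) //; apply: val_inj.
rewrite !inE expr1 -bj => /andP[/eqP xa /eqP xb].
have [y xE] := cube_multiple a0 xa; have [z zE] := cube_multiple b0 xb.
by exists y, z; rewrite -xE -zE addrC subrK.
Qed.

End CyclotomicNumbers.

Lemma power_residues_many k n u : (0 < k)%N -> prime u -> (u <= n)%N ->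
  exists bs : seq nat, [/\ uniq bs, (n <= 4 * k * size bs)%N &
    forall b, b \in bs ->
      (0 < b <= n)%N /\ exists2 w : 'F_u, w != 0 & b%:R = w ^+ k].
Proof.
move=> k0 u_pr un; have u1 := prime_gt1 u_pr; have u0 := prime_gt0 u_pr.
pose residues := [set w ^+ k | w in ~: [set (0%R : 'F_u)]].
have residueP r : r \in residues -> exists2 w : 'F_u, w != 0 & r = w ^+ k.
  by move=> /imsetP[w]; rewrite !inE => w0 ->; exists w.
have val_lt (r : 'F_u) : (r < u)%N.
  by have := ltn_ord r; rewrite [X in (_ < X)%N]Fp_cast.
pose shift (r : 'F_u) m := (r + m * u)%N.
have shift_residue r m : (shift r m)%:R = r :> 'F_u.
  by rewrite natrD natrM pchar_Fp_0 // mulr0 addr0 natr_Zp.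
exists [seq shift r m | r <- enum residues, m <- iota 0 (n %/ u)]; split.
- apply: allpairs_uniq; rewrite ?enum_uniq ?iota_uniq // =>
    -[r m] [s l] _ _ /= eq_shift.
  have rs : r = s by rewrite -(shift_residue r m) eq_shift shift_residue.
  by move: eq_shift; rewrite rs => /addnI/eqP; rewrite eqn_pmul2r // => /eqP->.
- rewrite size_allpairs size_iota -cardE.
  have n_lt := ltn_ceil n u0; have q0 : (0 < n %/ u)%N by rewrite divn_gt0.
  have card_res := @card_exprf_image 'F_u k k0.
  rewrite card_Fp // -/residues in card_res.
  have : (n <= 4 * (u.-1 * (n %/ u)))%N by move: (n %/ u)%N n_lt q0; nia.
  move=> /leq_trans; apply.
  by rewrite -mulnA leq_mul2l mulnA leq_mul2r card_res orbT.
move=> b /allpairsP[[r m] [/= rR mq ->]].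
rewrite mem_enum in rR; have [w w0 rE] := residueP r rR.
split; last by exists w; rewrite ?shift_residue.
apply/andP; split.
  rewrite lt0n; apply: contraNneq (expf_neq0 k w0) => shift0.
  by rewrite -rE -(shift_residue r m) shift0.
move: mq; rewrite mem_iota add0n => /andP[_ mq].
apply: leq_trans (leq_trunc_div n u).
apply: leq_trans (_ : m.+1 * u <= _)%N; last by rewrite leq_mul2r orbC mq.
by rewrite mulSn leq_add2r ltnW.
Qed.

(** * Globally soluble pairs under the abc conjecture *)

Definition integral_abc (E C : nat) : Prop := forall a b c : int, a + b = c ->
  gcdz a (gcdz b c) = 1 -> a * b * c != 0 ->
  (maxn `|a| (maxn `|b| `|c|) ^ E <= C * radical `|(a * b * c)%R| ^ E.+1)%N.

Lemma abc_conjecture_integral (R : realType) E :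
  abc_conjecture R -> (0 < E)%N ->
  exists C, integral_abc E C.
Proof.
move=> abc E0; have Einv_gt0 : 0 < E%:R^-1 :> R by rewrite invr_gt0 ltr0n.
have [C abcC] := abc _ Einv_gt0; pose C' := Num.max C 0.
have C'_ge0 : 0 <= C' by rewrite le_max lexx orbT.
exists (Num.truncn (C' ^+ E)).+1 => a b c abc_sum co_abc abc_neq0.
have := abcC a b c abc_sum co_abc abc_neq0.
set M := maxn _ _; set r := radical _ => M_le.
rewrite -(ler_nat R) natrM !natrX.
have {}M_le : M%:R <= C' * r%:R `^ (1 + E%:R^-1).
  by apply: le_trans M_le _; rewrite ler_wpM2r ?powR_ge0 // le_max lexx.
have ME_le : M%:R ^+ E <= (C' * r%:R `^ (1 + E%:R^-1)) ^+ E.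
  by apply: lerXn2r => //; rewrite nnegrE ?mulr_ge0 ?powR_ge0.
apply: le_trans ME_le _; rewrite exprMn -(powR_mulrn E (powR_ge0 _ _)) -powRrM.
have -> : (1 + E%:R^-1) * E%:R = E.+1%:R :> R.
  by rewrite mulrDl mul1r mulVf ?pnatr_eq0 -?lt0n // natr1.
by rewrite powR_mulrn // ler_wpM2r ?exprn_ge0 // ltW // truncnS_gt.
Qed.

Lemma radical_leq n : (0 < n)%N -> (radical n <= n)%N.
Proof.
move=> n0; rewrite /radical {2}(prod_prime_decomp n0) prime_decompE big_map /=.
rewrite big_seq [leqRHS]big_seq; apply: leq_prod => p p_n.
have p_pr : prime p by move: p_n; rewrite mem_primes => /andP[].
by rewrite -{1}(expn1 p) leq_pexp2l ?logn_gt0 ?prime_gt0.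
Qed.

Lemma radical_mulX a b x y k : (0 < a)%N -> (0 < b)%N -> (0 < x)%N ->
  (0 < y)%N -> (0 < k)%N ->
  radical (a * x ^ k * (b * y ^ k)) = radical (a * x * (b * y)).
Proof.
move=> a0 b0 x0 y0 k0; rewrite /radical; congr (\prod_(p <- _) _)%N.
apply/eq_primes => p; rewrite !primesM ?muln_gt0 ?expn_gt0 ?a0 ?b0 ?x0 ?y0 //.
by rewrite !primesX.
Qed.

Lemma expn_cancel A M c N E : (0 < A)%N ->
  ((A * M) ^ E <= c * (A * N) ^ E.+1 -> M ^ E <= c * A * N ^ E.+1)%N.
Proof.
move=> A0 AM_le.
rewrite -(leq_pmul2l (_ : 0 < A ^ E)%N) ?expn_gt0 ?A0 // -expnMn.
rewrite (_ : A ^ E * _ = c * (A * N) ^ E.+1)%N //.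
by rewrite expnMn !expnS; ring.
Qed.

(* The radical of a x^k b y^k divides a x b y, which is at most a n X^2. *)
Lemma abc_bounds_solution E C k n z x y : integral_abc E C -> (0 < k)%N ->
  (0 < x)%N -> (0 < y)%N -> nat_solution k n z x y ->
  (maxn x y ^ (k * E) <= C * n ^ (E + 2) * maxn x y ^ (2 * E + 2))%N.
Proof.
move=> abc k0; case: z => a b.
wlog yx : a b x y / (y <= x)%N.
  move=> wlog_yx x0 y0 s; case/orP: (leq_total y x) => xy.
    exact: (wlog_yx a b x y xy).
  by rewrite maxnC; apply: (wlog_yx b a y x xy) => //; apply: nat_solution_swap.
move=> x0 y0 [[/= an bn a0 b0] e]; rewrite (maxn_idPl yx).
have xk0 : x%:Z ^+ k != 0 by rewrite -PoszX eqz_nat -lt0n expn_gt0 x0.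
have yk0 : y%:Z ^+ k != 0 by rewrite -PoszX eqz_nat -lt0n expn_gt0 y0.
have := abc _ _ _ e; rewrite !gcdz1 mulr1 => /(_ erefl);
  rewrite !mulf_neq0 // => /(_ isT).
rewrite -!PoszX !abszM !absz_nat.
have := an; have := bn; rewrite -!abszE !lez_nat; move: a0 b0;
  rewrite -!absz_gt0.
move: `|a|%N `|b|%N => A B A0 B0 Bn An.
rewrite radical_mulX // => abc_le.
have rad_le : (radical (A * x * (B * y)) <= A * (n * x ^ 2))%N.
  apply: leq_trans (radical_leq _) _; first by rewrite !muln_gt0 A0 B0 x0.
  by rewrite -mulnA leq_mul2l mulnCA leq_mul ?orbT // expnS expn1 leq_mul.
have {abc_le} Ax_le : ((A * x ^ k) ^ E <= C * (A * (n * x ^ 2)) ^ E.+1)%N.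
  apply: leq_trans (_ : C * radical (A * x * (B * y)) ^ E.+1 <= _)%N.
    apply: leq_trans abc_le; case: (E) => // E'.
    by rewrite leq_exp2r // leq_max leqnn.
  by rewrite leq_mul2l leq_exp2r // rad_le orbT.
rewrite expnM; apply: leq_trans (expn_cancel A0 Ax_le) _.
rewrite expnMn -expnM mulnS [(2 + _)%N]addnC mulnA leq_mul2r.
by rewrite [(E + 2)%N]addn2 (expnS n E.+1) -!mulnA !leq_mul2l leq_mul2r An
  !orbT.
Qed.

Lemma leq_mul_expn c h a b : (c <= h)%N -> (a < b)%N -> (c * h ^ a <= h ^ b)%N.
Proof.
case: h => [|h] ch ab; first by move: ch; rewrite leqn0 => /eqP->.
apply: leq_trans (_ : h.+1 ^ a.+1 <= _)%N; last by rewrite leq_pexp2l.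
by rewrite expnS leq_mul2r ch orbT.
Qed.

(* The bound X^((k-2)E-2) <= C n^(E+2) on X = max(x, y), solved for X in powers
   of h. *)
Lemma abc_height_le E C k n h e A c z x y : integral_abc E C -> (2 < k)%N ->
  (0 < x)%N -> (0 < y)%N -> nat_solution k n z x y -> (n <= A * h ^ c)%N ->
  (C * A ^ (E + 2) < h)%N -> (2 * E + 2 <= k * E)%N ->
  (c * (E + 2) + e * (2 * E + 2) < e * (k * E))%N -> (maxn x y <= h ^ e)%N.
Proof.
move=> abc k2 x0 y0 s nA h_large kE_ge e_large.
have h0 : (0 < h)%N by apply: leq_ltn_trans h_large.
rewrite leqNgt; apply/negP => X_gt.
have := abc_bounds_solution abc (ltnW (ltnW k2)) x0 y0 s.
move: X_gt; set X := maxn x y => X_gt.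
rewrite -{1}(subnK kE_ge) expnD leq_pmul2r ?expn_gt0 ?(leq_ltn_trans _ X_gt) //.
set d := (k * E - _)%N => X_le.
have : (h ^ (e * d) <= C * A ^ (E + 2) * h ^ (c * (E + 2)))%N.
  rewrite expnM; apply: leq_trans (_ : X ^ d <= _)%N.
    by case: (d) => // i; rewrite leq_exp2r // ltnW.
  apply: leq_trans X_le _.
  by rewrite -mulnA leq_mul2l expnM -expnMn leq_exp2r ?addn2 // nA orbT.
rewrite leqNgt => /negP; apply;
  apply: leq_trans (_ : h * h ^ (c * (E + 2)) <= _)%N.
  by rewrite ltn_pmul2r // expn_gt0 h0.
by rewrite -expnS leq_pexp2l // /d mulnBr ltn_subRL addnC.
Qed.

Lemma globally_soluble_upper_ge4 (R : realType) k :
  abc_conjecture R -> (3 < k)%N ->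
  exists C h0, forall h n, (h0 <= h)%N -> (n <= 2 ^ (6 * k) * h ^ (6 * k))%N ->
    at_most (globally_soluble k n) (C * h ^ (6 * k + 2)).
Proof.
move=> abc k3; pose E := (9 * k + 2)%N.
have [C abcC] : exists C, integral_abc E C.
  by apply: abc_conjecture_integral abc _; rewrite /E addn2.
pose A := (2 ^ (6 * k))%N.
exists (40 * A + 12)%N, (C * A ^ (E + 2)).+1 => h n h_large nA.
have h0 : (0 < h)%N by apply: leq_trans h_large.
pose e := (3 * k + 1)%N.
have height_le z x y : (0 < x)%N -> (0 < y)%N -> nat_solution k n z x y ->
    (maxn x y <= h ^ e)%N.
  move=> x0 y0 s; apply: (abc_height_le abcC (ltnW k3) x0 y0 s nA h_large);
    by rewrite /E /e; move: k3; clear; nia.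
have few := at_most_le (nat_solution_below_few n (h ^ e) (ltnW k3)) _ (leqnn _).
apply: at_most_le (globally_soluble_few (ltnW (ltnW (ltnW k3))) (few _ _))
  (fun=> id) _ => //.
  move=> z [x [y [x0 y0 s]]]; exists x, y; rewrite x0 y0 /=.
  by have := height_le _ _ _ x0 y0 s; rewrite geq_max => /andP[-> ->].
rewrite -expnM (_ : e * 2 = 6 * k + 2)%N; last by rewrite /e; clear; lia.
have n_le : (n <= A * h ^ (6 * k + 2))%N.
  by apply: leq_trans nA _; rewrite leq_mul2l leq_pexp2l ?orbT // leq_addr.
have : (0 < h ^ (6 * k + 2))%N by rewrite expn_gt0 h0.
by move: n_le; move: (h ^ (6 * k + 2))%N (A) => H B; clear; nia.
Qed.

Lemma leq_monomial c A h n i a j b l d m e : (n <= A * h ^ i)%N ->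
  (c * n ^ a * (h ^ j) ^ b * (h ^ l) ^ d * (h ^ m) ^ e
   <= c * A ^ a * h ^ (i * a + j * b + l * d + m * e))%N.
Proof.
move=> nA.
apply: leq_trans
  (_ : c * (A * h ^ i) ^ a * (h ^ j) ^ b * (h ^ l) ^ d * (h ^ m) ^ e <= _)%N.
  rewrite !leq_mul2r leq_mul2l; case: a => [|a].
    by rewrite !expn0 leqnn !orbT.
  by rewrite leq_exp2r // nA !orbT.
by rewrite expnMn -!expnM !expnD !mulnA.
Qed.

(* The scale: |a|, |b| <= A h^100, x and y between h^98 and h^102, slopes of
   denominator at most h^50, and blocks of h^25 consecutive parameters. *)
Section CubicMiddleRange.
Variables (A Cd h n : nat).
Hypotheses (A_gt0 : (0 < A)%N) (n_le : (n <= A * h ^ 100)%N).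
Hypothesis h_large : (24 * A ^ 4 <= h)%N.

Let A_lt_h : (A.+1 < h)%N.
Proof.
apply: leq_trans h_large; apply: leq_trans (_ : 24 * A <= _)%N; first by lia.
by rewrite leq_mul2l -{1}(expn1 A) leq_pexp2l.
Qed.

Let h_gt3 : (3 < h)%N.
Proof.
apply: leq_trans h_large; apply: leq_trans (_ : 24 * 1 <= _)%N => //.
by rewrite leq_mul2l expn_gt0 A_gt0.
Qed.

Let hX_gt0 e : (0 < h ^ e)%N.
Proof. by rewrite expn_gt0 (leq_trans _ h_gt3). Qed.

Lemma cross_det_bound_power :
  (cross_det_bound n (h ^ 52) (h ^ 25) (h ^ 102) < (h ^ 98) ^ 12)%N.
Proof.
have absorb c a e : (c <= 24)%N -> (a <= 4)%N -> (e < 1170)%N ->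
    (c * A ^ a * h ^ e <= h ^ 1170)%N.
  move=> c24 a4 e_lt; apply: leq_mul_expn e_lt; apply: leq_trans h_large.
  by rewrite leq_mul // leq_pexp2l.
have := @leq_monomial 8 A h n 100 2 102 6 25 2 0 0 n_le.
have := @leq_monomial 24 A h n 100 3 52 1 25 3 102 7 n_le.
have := @leq_monomial 6 A h n 100 4 52 4 25 6 102 4 n_le.
rewrite expn0 (expn1 (h ^ 52)).
move=> /leq_trans/(_ (absorb 6 4 1166 isT isT isT)) chord_term.
move=> /leq_trans/(_ (absorb 24 3 1141 isT isT isT)) mixed_term.
move=> /leq_trans/(_ (absorb 8 2 862 isT isT isT)); rewrite muln1 => main_term.
apply: leq_ltn_trans (leq_add (leq_add main_term mixed_term) chord_term) _.
rewrite -expnM.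
apply: leq_trans (_ : 4 * h ^ 1170 <= _)%N; last exact: leq_mul_expn.
by move: (hX_gt0 1170); move: (h ^ 1170)%N; clear; lia.
Qed.

Lemma divisors_le_power m :
  (forall d, (0 < d)%N -> (size (divisors d) ^ 676 <= Cd * d)%N) ->
  (Cd * (8 * A ^ 6) <= h)%N -> (0 < m)%N ->
  (m <= (2 * n ^ 2) ^ 3 * (h ^ 25) ^ 3)%N -> (size (divisors m) <= h)%N.
Proof.
move=> Cd_bound Cd_le m0 m_le; rewrite -(@leq_exp2r _ _ 676) //.
apply: leq_trans (Cd_bound m m0) _.
apply: leq_trans (_ : Cd * (8 * A ^ 6 * h ^ 675) <= _)%N; last first.
  by rewrite mulnA; apply: leq_mul_expn.
rewrite leq_mul2l (leq_trans m_le) ?orbT //.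
have := @leq_monomial 8 A h n 100 6 25 3 0 0 0 0 n_le.
by rewrite !expn0 !muln1 expnMn -(expnM n).
Qed.

Lemma cubic_middle_range_few :
  (forall m, (0 < m)%N -> (m <= (2 * n ^ 2) ^ 3 * (h ^ 25) ^ 3)%N ->
     (size (divisors m) <= h)%N) ->
  at_most (fun z => exists x y, middle_solution n (h ^ 102) (h ^ 98) z x y)
    (144 * h ^ 199).
Proof.
move=> divisors_le.
have divX i j : (h ^ (i + j) %/ h ^ j = h ^ i)%N by rewrite expnD mulnK.
have few := @middle_range_few n (h ^ 102) (h ^ 98) (h ^ 25) (h ^ 50) h.
rewrite (divX 52 50) (divX 4 98) (divX 77 25) in few.
apply: at_most_le (few _ _ _ _ _ _ divisors_le) (fun=> id) _ => //.
- by rewrite -expnD ltn_exp2l // ltnW // ltnW.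
- rewrite -expnM; apply: leq_ltn_trans (leq_mul (leqnn 2) n_le) _.
  apply: leq_trans (_ : 4 * (A * h ^ 100) <= _)%N.
    by rewrite ltn_mul2r muln_gt0 A_gt0 hX_gt0.
  apply: leq_trans (_ : h ^ 1 * (h ^ 1 * h ^ 100) <= _)%N.
    by rewrite leq_mul ?leq_mul ?expn1 // ?(ltnW (ltnW A_lt_h)) // ltnW.
  by rewrite -!expnD leq_pexp2l // (leq_trans _ h_gt3).
- exact: cross_det_bound_power.
apply: leq_trans (_ :
  h ^ 50 * (2 * h ^ 4 * (3 * h ^ 52 * (2 * h ^ 77 * (12 * h ^ 1)))) <= _)%N.
  rewrite leq_mul2l; apply/orP; right; do ?apply: leq_mul.
  - by move: (hX_gt0 4); move: (h ^ 4)%N; clear; lia.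
  - by move: (hX_gt0 52); move: (h ^ 52)%N; clear; lia.
  - by rewrite mul2n -addnn leq_add2l leq_pexp2l // (leq_trans _ h_gt3).
  - by rewrite expn1; move: h_gt3; clear; lia.
rewrite (_ : h ^ 50 * _ =
  144 * (h ^ 50 * (h ^ 4 * (h ^ 52 * (h ^ 77 * h ^ 1)))))%N.
  by rewrite -!expnD leq_mul2l leq_pexp2l // (leq_trans _ h_gt3).
by move: (h ^ 50)%N (h ^ 4)%N (h ^ 52)%N (h ^ 77)%N (h ^ 1)%N; clear => *; ring.
Qed.

Lemma small_coef_few :
  at_most (fun z : int * int => `|z.1| <= (h ^ 99)%N%:Z /\ `|z.2| <= n%:Z)
    (9 * A * h ^ 199).
Proof.
apply: at_most_le (at_most_box (h ^ 99) n) (fun=> id) _.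
apply: leq_trans (_ : 3 * h ^ 99 * (3 * (A * h ^ 100)) <= _)%N.
  apply: leq_mul; first by move: (hX_gt0 99); move: (h ^ 99)%N; clear; lia.
  have : (0 < A * h ^ 100)%N by rewrite muln_gt0 A_gt0 hX_gt0.
  by move: (A * _)%N n_le => u; clear; lia.
rewrite (_ : 3 * _ * _ = 9 * A * (h ^ 99 * h ^ 100))%N; first by rewrite -expnD.
by move: (h ^ 99)%N (h ^ 100)%N; clear => *; ring.
Qed.

Lemma height_lower a b x y : nat_solution 3 n (a, b) x y ->
  (h ^ 99 < x)%N -> (h ^ 99 < `|a|)%N -> (h ^ 98 <= y)%N.
Proof.
move=> [[/= _ bn _ _] e] x_large a_large; rewrite leqNgt; apply/negP => y_small.
have ax_le : (`|a| * x ^ 3 <= n * y ^ 3 + 1)%N.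
  have -> : (`|a| * x ^ 3 = `|(1 - b * y%:Z ^+ 3)%R|)%N.
    by rewrite -e addrK abszM -PoszX absz_nat.
  apply: leq_trans (_ : `|b| * y ^ 3 + 1 <= _)%N.
    by rewrite -[(y ^ 3)%N]absz_nat PoszX -abszM;
      move: (b * _) => u; clear; lia.
  by rewrite leq_add2r leq_mul2r -lez_nat abszE bn orbT.
have ax_ge : (h ^ 99 * (h ^ 99) ^ 3 <= `|a| * x ^ 3)%N.
  by rewrite leq_mul ?leq_exp2r // ltnW.
have ny_le : (n * y ^ 3 <= A * h ^ 100 * (h ^ 98) ^ 3)%N.
  by rewrite leq_mul ?leq_exp2r // ltnW.
have := leq_trans ax_ge (leq_trans ax_le (leq_add ny_le (leqnn 1))).
rewrite -mulnA -!expnM -!expnD leqNgt => /negP; apply.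
rewrite (_ : h ^ (99 + 99 * 3) = h * (h * h ^ (100 + 98 * 3)))%N;
  last by rewrite -!expnS.
move: (h ^ (100 + 98 * 3))%N (hX_gt0 (100 + 98 * 3)) => u u0.
apply: leq_ltn_trans (_ : A.+1 * u < _)%N.
  by rewrite mulSn addnC leq_add2r.
apply: leq_trans (_ : h * u <= _)%N.
  by rewrite ltn_pmul2r // (ltnW A_lt_h).
by rewrite leq_mul2l leq_pmull ?orbT // (leq_trans _ h_gt3).
Qed.

Lemma cubic_solution_cases z x y : (0 < x)%N -> (0 < y)%N ->
  (maxn x y <= h ^ 102)%N -> nat_solution 3 n z x y ->
  [\/ (x <= h ^ 99)%N && (y <= h ^ 99)%N,
      middle_solution n (h ^ 102) (h ^ 98) z x y,
      `|z.1| <= (h ^ 99)%N%:Z | `|z.2| <= (h ^ 99)%N%:Z].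
Proof.
move=> x0 y0; case: z => a b; rewrite geq_max => /andP[xY yY] s.
have [[/= an bn _ _] e] := s.
have [a_small|a_large] := leqP `|a|%N (h ^ 99).
  by constructor 3; rewrite -abszE lez_nat.
have [b_small|b_large] := leqP `|b|%N (h ^ 99).
  by constructor 4; rewrite -abszE lez_nat.
have h98_le : (h ^ 98 <= h ^ 99)%N by rewrite leq_pexp2l // (leq_trans _ h_gt3).
have [x_small|x_large] := leqP x (h ^ 99); last first.
  constructor 2; split=> //; rewrite ?xY ?yY andbT.
    exact: leq_trans h98_le (ltnW x_large).
  exact: height_lower s x_large a_large.
have [y_small|y_large] := leqP y (h ^ 99); first by constructor 1.
constructor 2; split=> //; rewrite ?xY ?yY andbT.
  exact: height_lower (nat_solution_swap s) y_large b_large.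
exact: leq_trans h98_le (ltnW y_large).
Qed.

End CubicMiddleRange.

Lemma globally_soluble_upper_cubic (R : realType) A :
  abc_conjecture R -> (0 < A)%N ->
  exists C h0, forall h n, (h0 <= h)%N -> (n <= A * h ^ 100)%N ->
    at_most (globally_soluble 3 n) (C * h ^ 199).
Proof.
move=> abc A0; have [C abcC] := abc_conjecture_integral (E := 203) abc isT.
have [Cd Cd_bound] := divisor_bound (E := 676) isT.
exists (1000 * A.+1)%N, (C * A ^ (203 + 2) + 24 * A ^ 4 + Cd * (8 * A ^ 6)).+1.
move=> h n h_ge nA.
have [C_le A_le Cd_le] : [/\ (C * A ^ (203 + 2) < h)%N, (24 * A ^ 4 <= h)%N
    & (Cd * (8 * A ^ 6) <= h)%N].
  move: h_ge; move: (C * _)%N (24 * _)%N (Cd * _)%N => u v w.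
  by clear; split; lia.
have h0 : (0 < h)%N by apply: leq_ltn_trans C_le.
have middle := cubic_middle_range_few A0 nA A_le
  (fun m => divisors_le_power nA Cd_bound Cd_le (m := m)).
have below := nat_solution_below_few n (h ^ 99) (isT : (2 < 3)%N).
have box := small_coef_few A0 nA A_le.
have pieces :=
  at_mostU (at_mostU below middle) (at_mostU box (at_most_swap box)).
have few := @globally_soluble_few 3 n _ isT (at_most_le pieces _ (leqnn _)).
apply: at_most_le (few _) (fun=> id) _.
  move=> z [x [y [x0 y0 s]]].
  have xyY : (maxn x y <= h ^ 102)%N.
    by apply: (abc_height_le abcC _ x0 y0 s nA C_le); rewrite //; clear; lia.
  have [[an bn _ _] _] := s.
  case: (cubic_solution_cases A0 nA A_le x0 y0 xyY s) =>
    [/andP[xX yX]|mid|a_le|b_le].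
  - by left; left; exists x, y; rewrite x0 y0 xX yX.
  - by left; right; exists x, y.
  - by right; left.
  - by right; right.
have n_le : (n <= A * h ^ 199)%N.
  by rewrite (leq_trans nA) // leq_mul2l leq_pexp2l ?orbT.
have square_le : ((h ^ 99) ^ 2 <= h ^ 199)%N by rewrite -expnM leq_pexp2l.
have : (0 < h ^ 199)%N by rewrite expn_gt0 h0.
by move: A0 square_le n_le; move: ((h ^ 99) ^ 2)%N (h ^ 199)%N; clear; nia.
Qed.

(** * Mertens' theorem for the primes congruent to 2 modulo 3 *)

Section Mertens.
Variable R : realType.

Lemma ln_nat_ge0 n : 0 <= ln n%:R :> R.
Proof. by case: n => [|n]; [rewrite ln0|rewrite ln_ge0 // ler1n]. Qed.

Lemma ler_ln_nat m n : (0 < m <= n)%N -> ln m%:R <= ln n%:R :> R.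
Proof.
by move=> /andP[m0 mn]; rewrite ler_ln ?posrE ?ltr0n ?ler_nat // (leq_trans m0).
Qed.

Lemma ln2_le1 : ln 2 <= 1 :> R.
Proof. by have := @le_ln1Dx R 1; rewrite -[1 + 1]/(2%:R); apply; lra. Qed.

Lemma ln2_ge_half : 2^-1 <= ln 2 :> R.
Proof.
have half_gt : -1 < - 2^-1 :> R by lra.
have := le_ln1Dx half_gt; rewrite (_ : 1 + - 2^-1 = 2^-1 :> R); last by lra.
by rewrite lnV ?posrE //; lra.
Qed.

Lemma ln4E : ln 4 = 2 * ln 2 :> R.
Proof. by rewrite (_ : 4 = 2 ^+ 2) ?lnXn -?natrX // mulr2n; lra. Qed.

Lemma ler_mul_ln_succ n : (0 < n)%N -> n%:R * (ln n.+1%:R - ln n%:R) <= 1 :> R.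
Proof.
move=> n0; have n_gt0 : 0 < n%:R :> R by rewrite ltr0n.
rewrite -ln_div ?posrE ?ltr0n // -(natr1 n) mulrDl mul1r mulfV ?gt_eqF //.
rewrite mulrC -ler_pdivlMr // div1r; apply: le_ln1Dx.
by rewrite (lt_trans _ (_ : 0 < _)) ?invr_gt0 ?ltrN10.
Qed.

Lemma ler_ln_div_succ m :
  (4 <= m)%N -> ln m.+1%:R / m.+1%:R <= ln m%:R / m%:R :> R.
Proof.
move=> m4; have m0 : (0 < m)%N by apply: leq_trans m4.
have m_gt0 : 0 < m%:R :> R by rewrite ltr0n.
have ln_ge1 : 1 <= ln m%:R :> R.
  apply: (@le_trans _ _ (ln 4%:R)); last exact: ler_ln_nat.
  by rewrite ln4E; have := ln2_ge_half; lra.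
rewrite ler_pdivrMr ?ltr0n // mulrAC ler_pdivlMr // -natr1.
have := ler_mul_ln_succ m0; rewrite -(natr1 m).
move: (ln (m%:R + 1)) (ln m%:R) ln_ge1 => a b.
by rewrite mulrBr !mulrDr !mulr1 ![_ * m%:R]mulrC; lra.
Qed.

Definition chi3 (n : nat) : R :=
  if (n %% 3 == 1)%N then 1 else if (n %% 3 == 2)%N then -1 else 0.

Lemma chi3M m n : chi3 (m * n) = chi3 m * chi3 n.
Proof.
rewrite /chi3 -modnMm.
have := ltn_pmod m (isT : (0 < 3)%N); have := ltn_pmod n (isT : (0 < 3)%N).
case: (n %% 3)%N => [|[|[|?]]] // _; case: (m %% 3)%N => [|[|[|?]]] // _ /=;
  by rewrite ?mul1r ?mulr1 ?mul0r ?mulr0 ?mulrNN ?mulr1.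
Qed.

Lemma normr_chi3 n : `|chi3 n| <= 1.
Proof.
by rewrite /chi3; do 2?case: ifP => _; rewrite ?normrN ?normr1 ?normr0.
Qed.

Lemma sum_chi3_decreasing (g : nat -> R) s N :
  (forall m, (s <= m)%N -> 0 <= g m.+1 <= g m) ->
  (forall m, (s <= m)%N -> 0 <= g m) ->
  let S := \sum_(s <= m < N) chi3 m * g m in
  if (s %% 3 == 2)%N then - g s <= S <= 0 else 0 <= S <= g s.
Proof.
move=> /=; have [d] := ubnP (N - s); elim: d s => // d IHd s dN g_dec g_ge0.
have [Ns|sN] := leqP N s.
  by rewrite big_geq //; case: ifP => _; rewrite lexx ?andbT ?oppr_le0 g_ge0.
rewrite big_ltn //; have sN_d : (N - s.+1 < d)%N by lia.
have := IHd s.+1 sN_d (fun m sm => g_dec m (ltnW sm))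
  (fun m sm => g_ge0 m (ltnW sm)).
have /andP[gs1_ge0 gs1_le] := g_dec s (leqnn s); rewrite /chi3.
have [s3|[s3|s3]] : (s %% 3 = 0 \/ s %% 3 = 1 \/ s %% 3 = 2)%N by lia.
- have -> : (s.+1 %% 3 = 1)%N by lia.
  by rewrite s3 /=; move: (\sum_(_ <= _ < _) _) => S; lra.
- have -> : (s.+1 %% 3 = 2)%N by lia.
  by rewrite s3 /=; move: (\sum_(_ <= _ < _) _) => S; lra.
have -> : (s.+1 %% 3 = 0)%N by lia.
by rewrite s3 /=; move: (\sum_(_ <= _ < _) _) => S; lra.
Qed.

(* Sums over prime powers d = p^j weighted by ln p, i.e. by the von Mangoldt
   function; complete if F vanishes beyond B. *)
Definition mangoldt_sum (B : nat) (F : nat -> R) : R :=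
  \sum_(1 <= p < B.+1 | prime p) \sum_(1 <= j < B.+1) ln p%:R * F (p ^ j)%N.

Section MangoldtSumAlgebra.
Variable B : nat.
Implicit Types F G : nat -> R.
Local Notation V := (mangoldt_sum B).

Lemma ler_mangoldt_sum F G : (forall d, (0 < d)%N -> F d <= G d) -> V F <= V G.
Proof.
move=> FG; apply: ler_sum => p p_pr; apply: ler_sum => j _.
by apply: ler_wpM2l; rewrite ?ln_nat_ge0 // FG // expn_gt0 prime_gt0.
Qed.

Lemma eq_mangoldt_sum F G : (forall d, (0 < d)%N -> F d = G d) -> V F = V G.
Proof.
by move=> FG; apply: le_anti; rewrite !ler_mangoldt_sum // => d d0; rewrite FG.
Qed.

Lemma mangoldt_sumD F G : V (fun d => F d + G d) = V F + V G.
Proof.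
rewrite /mangoldt_sum -big_split; apply: eq_bigr => p _; rewrite -big_split.
by apply: eq_bigr => j _; rewrite mulrDr.
Qed.

Lemma mangoldt_sumZ c F : V (fun d => c * F d) = c * V F.
Proof.
rewrite /mangoldt_sum mulr_sumr; apply: eq_bigr => p _; rewrite mulr_sumr.
by apply: eq_bigr => j _; rewrite mulrCA.
Qed.

Lemma mangoldt_sumB F G : V (fun d => F d - G d) = V F - V G.
Proof.
rewrite -[- V G]mulN1r -mangoldt_sumZ -mangoldt_sumD.
by apply: eq_mangoldt_sum => d _; rewrite mulN1r.
Qed.

Lemma mangoldt_sum_sum m n (c : nat -> R) (F : nat -> nat -> R) :
  \sum_(m <= i < n) c i * V (F i) = V (fun d => \sum_(m <= i < n) c i * F i d).
Proof.
under eq_bigr do rewrite -mangoldt_sumZ.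
rewrite /mangoldt_sum exchange_big /=; apply: eq_bigr => p _.
by rewrite exchange_big /=; apply: eq_bigr => j _; rewrite mulr_sumr.
Qed.

Lemma ler_norm_mangoldt_sum F G :
  (forall d, (0 < d)%N -> `|F d| <= G d) -> `|V F| <= V G.
Proof.
move=> FG; rewrite ler_norml; apply/andP; split.
  rewrite -mulN1r -mangoldt_sumZ; apply: ler_mangoldt_sum => d /FG.
  by rewrite ler_norml mulN1r => /andP[].
by apply: ler_mangoldt_sum => d /FG; rewrite ler_norml => /andP[].
Qed.

End MangoldtSumAlgebra.
Local Notation V := mangoldt_sum.

Lemma ln_nat_logn B n : (0 < n <= B)%N ->
  ln n%:R = \sum_(1 <= p < B.+1 | prime p) ln p%:R * (logn p n)%:R :> R.
Proof.
elim/ltn_ind: n => n IHn /andP[n0 nB]; have [n1|n1] := leqP n 1.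
  have -> : n = 1%N by lia.
  by rewrite ln1 big1 // => p _; rewrite logn1 mulr0.
have [m nE] := dvdnP (pdiv_dvd n); have p_pr := pdiv_prime n1.
have pB : (pdiv n <= B)%N by apply: leq_trans nB; apply: dvdn_leq (pdiv_dvd n).
move: (pdiv n) p_pr nE pB => p p_pr nE pB.
have m0 : (0 < m)%N by move: n0; rewrite nE muln_gt0 => /andP[].
have mn : (m < n)%N by rewrite nE -{1}(muln1 m) ltn_pmul2l // prime_gt1.
rewrite nE natrM lnM ?posrE ?ltr0n ?(prime_gt0 p_pr) // (IHn m mn); last first.
  by rewrite m0 (leq_trans (ltnW mn)).
have -> : ln p%:R = \sum_(1 <= q < B.+1 | prime q) ln q%:R * (logn q p)%:R :> R.
  rewrite big_mkcond (bigD1_seq p) ?iota_uniq //=;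
    last by rewrite mem_index_iota prime_gt0.
  rewrite p_pr logn_prime // eqxx mulr1 big1 ?addr0 // => q qp.
  case: ifP => // q_pr.
  by rewrite logn_prime // (negPf qp) mulr0.
rewrite -big_split; apply: eq_bigr => q q_pr /=.
by rewrite lognM ?(prime_gt0 p_pr) // natrD mulrDr.
Qed.

Lemma ln_nat_mangoldt B n :
  (0 < n <= B)%N -> ln n%:R = V B (fun d => (d %| n)%N%:R).
Proof.
move=> n_range; rewrite (ln_nat_logn n_range); apply: eq_bigr => p p_pr.
have /andP[n0 nB] := n_range.
rewrite -mulr_sumr -natr_sum logn_count_dvd //; congr (_ * _%:R).
rewrite [RHS](big_cat_nat _ (n := n)) //=; last exact: leqW.
rewrite [X in (_ = _ + X)%N]big_nat_cond [X in (_ = _ + X)%N]big1 ?addn0 //.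
move=> j /andP[/andP[nj _] _]; rewrite gtnNdvd //.
by apply: leq_trans (ltn_expl j (prime_gt1 p_pr)); rewrite ltnS.
Qed.

Definition log_fact (N : nat) : R := \sum_(1 <= n < N.+1) ln n%:R.

Lemma log_factS N : log_fact N.+1 = log_fact N + ln N.+1%:R.
Proof. by rewrite /log_fact big_nat_recr. Qed.

Lemma log_factE N : log_fact N = ln (N`!)%:R.
Proof.
elim: N => [|N IHN]; first by rewrite /log_fact big_geq // fact0 ln1.
by rewrite log_factS IHN factS natrM lnM ?posrE ?ltr0n ?fact_gt0 // addrC.
Qed.

Lemma log_fact_mangoldt B N :
  (N <= B)%N -> log_fact N = V B (fun d => (N %/ d)%N%:R).
Proof.
move=> NB; transitivity (\sum_(1 <= n < N.+1) 1 * V B (fun d => (d %| n)%N%:R)).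
  apply: eq_big_nat => n /andP[n0 nN]; rewrite mul1r; apply: ln_nat_mangoldt.
  by rewrite n0 (leq_trans _ NB).
rewrite mangoldt_sum_sum; apply: eq_mangoldt_sum => d d0.
by rewrite divn_count_dvd natr_sum; apply: eq_bigr => i _; rewrite mul1r.
Qed.

Lemma log_fact_lower N : (0 < N)%N -> N%:R * ln N%:R - N%:R <= log_fact N.
Proof.
elim: N => // -[_ _|N IHN _]; first by rewrite /log_fact big_nat1 ln1; lra.
rewrite log_factS; have := IHN isT; have := ler_mul_ln_succ (ltn0Sn N).
rewrite -(natr1 N.+1) mulrBr mulrDl mul1r.
move: (log_fact _) (ln _) (ln (_ + 1)) => c a b.
by move: (_ * a) (_ * b) => *; lra.
Qed.

Lemma log_fact_upper N : log_fact N <= N%:R * ln N%:R.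
Proof.
have -> : N%:R * ln N%:R = \sum_(1 <= n < N.+1) ln N%:R :> R.
  by rewrite sumr_const_nat subn1 mulr_natl.
rewrite /log_fact big_nat [leRHS]big_nat; apply: ler_sum => n n_range.
exact: ler_ln_nat.
Qed.

(* Chebyshev's psi(N), provided N <= B. *)
Definition psi_sum (B N : nat) : R := V B (fun d => (d <= N)%N%:R).

Lemma divn_double_sub_double d M : (0 < d)%N ->
  (2 * (M %/ d) + (d <= 2 * M) <= (2 * M) %/ d + (d <= M))%N.
Proof.
move=> d0; have [dM|dM] := leqP d M.
  have -> : (d <= 2 * M)%N by lia.
  by rewrite leq_add2r leq_divRL // -mulnA leq_mul2l leq_trunc_div orbT.
rewrite divn_small // muln0 addn0 add0n.
by case: (leqP d (2 * M)) => // dM2; rewrite divn_gt0.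
Qed.

Lemma ln_central_bin_le M : ln 'C(2 * M, M)%:R <= (2 * M)%:R :> R.
Proof.
have C_gt0 : (0 < 'C(2 * M, M))%N by rewrite bin_gt0; lia.
have C_le : ('C(2 * M, M) <= 2 ^ (2 * M))%N.
  have -> : (2 ^ (2 * M) =
      \sum_(i < (2 * M).+1) 'C(2 * M, i) * (1 ^ (2 * M - i) * 1 ^ i))%N.
    exact: (expnDn 1 1).
  have M_lt : (M < (2 * M).+1)%N by lia.
  by rewrite (bigD1 (Ordinal M_lt)) //= !exp1n !muln1 leq_addr.
apply: (@le_trans _ _ (ln (2 ^ (2 * M))%N%:R)).
  by apply: ler_ln_nat; rewrite C_gt0.
by rewrite natrX lnXn // -[leLHS]mulr_natr ler_piMl // ln2_le1.
Qed.

Lemma log_fact_double M : log_fact (2 * M) - 2 * log_fact M <= (2 * M)%:R.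
Proof.
have M_le : (M <= 2 * M)%N by lia.
have C_gt0 : (0 < 'C(2 * M, M))%N by rewrite bin_gt0.
rewrite !log_factE -(bin_fact M_le) (_ : 2 * M - M = M)%N; last by lia.
rewrite !natrM !lnM ?posrE ?mulr_gt0 ?ltr0n ?fact_gt0 //.
by have := ln_central_bin_le M; move: (ln _) (ln (M`!)%:R) => *; lra.
Qed.

Lemma psi_sum_double B M :
  (2 * M <= B)%N -> psi_sum B (2 * M) <= psi_sum B M + (2 * M)%:R.
Proof.
move=> MB; rewrite addrC -lerBlDr; apply: le_trans (log_fact_double M).
rewrite !(@log_fact_mangoldt B) //; last by apply: leq_trans MB; lia.
rewrite -mangoldt_sumZ -!mangoldt_sumB; apply: ler_mangoldt_sum => d d0.
have := divn_double_sub_double M d0.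
rewrite -(ler_nat R) natrD [leRHS]natrD natrM.
by move: (M %/ d)%N%:R ((2 * M) %/ d)%N%:R (d <= M)%N%:R (d <= 2 * M)%N%:R => *;
  lra.
Qed.

Lemma ler_psi_sum B m n : (m <= n)%N -> psi_sum B m <= psi_sum B n.
Proof.
move=> mn; apply: ler_mangoldt_sum => d _; rewrite ler_nat.
by have [dm|//] := leqP d m; rewrite (leq_trans dm mn).
Qed.

Lemma psi_sum_small B N : (N <= 1)%N -> psi_sum B N = 0.
Proof.
move=> N1; rewrite /psi_sum /mangoldt_sum big1 // => p p_pr.
rewrite big_nat big1 // => j /andP[j0 _].
rewrite leqNgt (leq_ltn_trans N1) ?mulr0 //.
by rewrite -(exp1n j) ltn_exp2r // prime_gt1.
Qed.

Lemma psi_sum_upper B N : (N < B)%N -> psi_sum B N <= (4 * N)%:R.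
Proof.
elim/ltn_ind: N => N IHN NB.
have [N1|N1] := leqP N 1; first by rewrite psi_sum_small.
pose M := uphalf N; have MN : (M < N)%N by rewrite /M; lia.
apply: le_trans (ler_psi_sum B (_ : N <= 2 * M)%N) _; first by rewrite /M; lia.
apply: le_trans (psi_sum_double _) _; first by rewrite /M; lia.
apply: le_trans (_ : (4 * M)%:R + (2 * M)%:R <= _).
  by rewrite lerD2r IHN // (ltn_trans MN).
by rewrite -natrD ler_nat /M; lia.
Qed.

Definition inv_upto (N d : nat) : R := (d <= N)%N%:R / d%:R.

Lemma mertens_lower B N : (0 < N <= B)%N -> ln N%:R - 1 <= V B (inv_upto N).
Proof.
move=> /andP[N0 NB]; have N_gt0 : 0 < N%:R :> R by rewrite ltr0n.
rewrite -(ler_pM2l N_gt0) -mangoldt_sumZ mulrBr mulr1.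
apply: le_trans (log_fact_lower N0) _; rewrite (log_fact_mangoldt NB).
apply: ler_mangoldt_sum => d d0; rewrite /inv_upto.
have [dN|dN] := leqP d N; last by rewrite divn_small // mul0r mulr0.
by rewrite mul1r ler_pdivlMr ?ltr0n // -natrM ler_nat leq_trunc_div.
Qed.

Lemma mertens_upper B N : (0 < N < B)%N -> V B (inv_upto N) <= ln N%:R + 4.
Proof.
move=> /andP[N0 NB]; have N_gt0 : 0 < N%:R :> R by rewrite ltr0n.
rewrite -(ler_pM2l N_gt0) -mangoldt_sumZ.
apply: le_trans (_ : log_fact N + psi_sum B N <= _).
  rewrite (log_fact_mangoldt (ltnW NB)) -mangoldt_sumD.
  apply: ler_mangoldt_sum => d d0.
  rewrite /inv_upto; have [dN|dN] := leqP d N;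
    last by rewrite mul0r mulr0 addr_ge0.
  by rewrite mul1r ler_pdivrMr ?ltr0n // natr1 -natrM ler_nat ltnW // ltn_ceil.
apply: le_trans (lerD (log_fact_upper N) (psi_sum_upper NB)) _.
by rewrite mulrDr natrM [4 * _]mulrC.
Qed.

Lemma sum_multiples (g : nat -> R) d N : (0 < d)%N ->
  \sum_(1 <= n < N.+1) g n * (d %| n)%N%:R =
    \sum_(1 <= m < (N %/ d).+1) g (d * m)%N.
Proof.
move=> d0; elim: N => [|N IHN]; first by rewrite div0n !big_geq.
rewrite big_nat_recr //= IHN; have := divnS N d0.
have [dN|_] := boolP (d %| N.+1)%N => ->; last by rewrite mulr0 addr0 add0n.
rewrite mulr1 add1n [RHS]big_nat_recr //=; congr (_ + g _).
by have := divnS N d0; rewrite dN add1n => <-; rewrite mulnC divnK.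
Qed.

Definition L_sum (N : nat) : R := \sum_(1 <= m < N.+1) chi3 m * m%:R^-1.

Definition L_log_sum (N : nat) : R :=
  \sum_(1 <= n < N.+1) chi3 n * (ln n%:R / n%:R).

Lemma sum_chi3_inv s N : (0 < s)%N ->
  let S := \sum_(s <= m < N) chi3 m * m%:R^-1 in
  if (s %% 3 == 2)%N then - s%:R^-1 <= S <= 0 else 0 <= S <= s%:R^-1.
Proof.
move=> s0; apply: (@sum_chi3_decreasing (fun m => m%:R^-1)) => m sm; last first.
  by rewrite invr_ge0.
rewrite invr_ge0 ler0n /= lef_pV2 ?posrE ?ltr0n ?ler_nat //.
exact: leq_trans sm.
Qed.

Lemma L_sum_tail M N : (M <= N)%N -> `|L_sum N - L_sum M| <= M.+1%:R^-1.
Proof.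
move=> MN; rewrite /L_sum (big_cat_nat _ (n := M.+1)) //= addrAC subrr add0r.
have := sum_chi3_inv N.+1 (ltn0Sn M); move: (\sum_(_ <= _ < _) _) => S /=.
have := invr_ge0 (M.+1%:R : R).
move: (M.+1%:R^-1 : R) => x; rewrite ler0n => x_ge0.
by rewrite ler_norml; case: ifP => _; lra.
Qed.

Lemma L_sum_lower N : (0 < N)%N -> 2^-1 <= L_sum N.
Proof.
rewrite /L_sum; case: N => // -[_|N _].
  by rewrite big_nat1 /chi3 /= mul1r invr1; lra.
rewrite big_ltn // big_ltn //=; have /andP[] := @sum_chi3_inv 3 N.+3 isT.
by move: (\sum_(_ <= _ < _) _) => S; rewrite /chi3 /= invr1; lra.
Qed.

Lemma normr_L_log_sum N : `|L_log_sum N| <= 1.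
Proof.
have ln2_le := ln2_le1; have ln2_ge := ln2_ge_half; rewrite /L_log_sum.
case: N => [|[|[|N]]].
- by rewrite big_geq // normr0; lra.
- by rewrite big_nat1 ln1 mul0r mulr0 normr0.
- rewrite big_ltn // big_nat1 ln1 mul0r mulr0 add0r /chi3 /= ler_norml.
  by move: (ln 2) ln2_le ln2_ge => x; lra.
do 3!rewrite big_ltn //=; rewrite ln1 mul0r mulr0 add0r.
have ln_div_ge0 m : 0 <= ln m%:R / m%:R :> R by rewrite divr_ge0 ?ln_nat_ge0.
have /andP[] : 0 <= \sum_(4 <= m < N.+4) chi3 m * (ln m%:R / m%:R)
  <= ln 4%:R / 4%:R.
  apply: (@sum_chi3_decreasing (fun m => ln m%:R / m%:R) 4) => m m4;
    rewrite ln_div_ge0 //=.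
  exact: ler_ln_div_succ.
move: (\sum_(_ <= _ < _) _) => S; rewrite ln4E /chi3 /= ler_norml.
by move: (ln 2) (ln 3%:R / 3%:R) ln2_le ln2_ge => x y; lra.
Qed.

Lemma L_log_sum_mangoldt B N : (N <= B)%N ->
  L_log_sum N = V B (fun d => chi3 d / d%:R * L_sum (N %/ d)).
Proof.
move=> NB.
transitivity
  (\sum_(1 <= n < N.+1) (chi3 n / n%:R) * V B (fun d => (d %| n)%N%:R)).
  apply: eq_big_nat => n /andP[n0 nN];
    rewrite -ln_nat_mangoldt ?n0 ?(leq_trans _ NB) //.
  by rewrite mulrAC -mulrA.
rewrite mangoldt_sum_sum; apply: eq_mangoldt_sum => d d0.
rewrite sum_multiples // /L_sum mulr_sumr; apply: eq_bigr => m _.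
by rewrite chi3M natrM invfM; ring.
Qed.

Definition chi3_sum (B N : nat) : R := V B (fun d => chi3 d * inv_upto N d).

Lemma normr_L_log_sum_sub B N : (0 < N < B)%N ->
  `|L_log_sum N - L_sum N * chi3_sum B N| <= 4.
Proof.
move=> /andP[N0 NB]; have N_gt0 : 0 < N%:R :> R by rewrite ltr0n.
rewrite (L_log_sum_mangoldt (ltnW NB)) -mangoldt_sumZ -mangoldt_sumB.
apply: le_trans (_ : V B (fun d => N%:R^-1 * (d <= N)%N%:R) <= _); last first.
  by rewrite mangoldt_sumZ ler_pdivrMl // -natrM mulnC; apply: psi_sum_upper.
apply: ler_norm_mangoldt_sum => d d0; rewrite /inv_upto.
have [dN|dN] := leqP d N; last first.
  by rewrite divn_small // /L_sum big_geq // !(mul0r, mulr0) subr0 normr0.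
have -> : chi3 d / d%:R * L_sum (N %/ d) - L_sum N * (chi3 d * (1%:R / d%:R)) =
    chi3 d * (d%:R^-1 * (L_sum (N %/ d) - L_sum N)) by rewrite mul1r; ring.
rewrite !normrM mulr1.
apply: le_trans (_ : 1 * (d%:R^-1 * (N %/ d).+1%:R^-1) <= _).
  apply: ler_pM; rewrite ?mulr_ge0 ?normr_chi3 //.
  rewrite ger0_norm ?invr_ge0 // ler_wpM2l ?invr_ge0 // distrC.
  by apply: L_sum_tail; apply: leq_div.
rewrite mul1r -invfM lef_pV2 ?posrE ?mulr_gt0 ?ltr0n //.
by rewrite -natrM ler_nat mulnC ltnW // ltn_ceil.
Qed.

Lemma normr_chi3_sum B N : (0 < N < B)%N -> `|chi3_sum B N| <= 10.
Proof.
move=> N_range; have /andP[N0 _] := N_range.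
have L_log_le := normr_L_log_sum N; have diff_le := normr_L_log_sum_sub N_range.
have L_ge := L_sum_lower N0.
have : `|L_sum N * chi3_sum B N| <= 5.
  rewrite -[_ * _](subKr (L_log_sum N)); apply: le_trans (ler_normB _ _) _.
  by move: (`|_|) (`|_|) L_log_le diff_le => u v; lra.
rewrite normrM (ger0_norm (le_trans _ L_ge)); last by lra.
by move: (normr_ge0 (chi3_sum B N)) L_ge; move: (`|_|) (L_sum N) => u v; nra.
Qed.

Lemma mertens_2mod3 B M N : (0 < M)%N -> (M <= N)%N -> (N < B)%N ->
  ln N%:R - ln M%:R - 25 <=
    V B (fun d => (1 - chi3 d) * ((M < d <= N)%N%:R / d%:R)).
Proof.
move=> M0 MN NB; have N0 : (0 < N)%N by apply: leq_trans MN.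
have -> : V B (fun d => (1 - chi3 d) * ((M < d <= N)%N%:R / d%:R)) =
    (V B (inv_upto N) - chi3_sum B N) - (V B (inv_upto M) - chi3_sum B M).
  rewrite -!mangoldt_sumB; apply: eq_mangoldt_sum => d _; rewrite /inv_upto.
  have -> : (M < d <= N)%N%:R = (d <= N)%N%:R - (d <= M)%N%:R :> R.
    have [dM|dM] := leqP d M; first by rewrite (leq_trans dM MN) subrr.
    by rewrite subr0.
  ring.
have N_le : (0 < N <= B)%N by rewrite N0 ltnW.
have N_lt : (0 < N < B)%N by rewrite N0.
have M_lt : (0 < M < B)%N by rewrite M0 (leq_ltn_trans MN).
have := mertens_lower N_le; have := mertens_upper M_lt.
have := normr_chi3_sum N_lt; have := normr_chi3_sum M_lt; rewrite !ler_norml.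
by move: (V _ _) (V _ _) (chi3_sum _ _) (chi3_sum _ _) (ln _) (ln _) => *; lra.
Qed.

End Mertens.

Definition primes_2mod3 (N : nat) : seq nat :=
  [seq p <- iota 1 N | prime p && (p %% 3 == 2)%N].

Lemma mem_primes_2mod3 N p :
  (p \in primes_2mod3 N) = [&& prime p, (p %% 3 == 2)%N & (p <= N)%N].
Proof.
rewrite mem_filter mem_iota add1n ltnS -andbA.
by have [p_pr|//] := boolP (prime p); rewrite prime_gt0.
Qed.

Lemma primes_2mod3_uniq N : uniq (primes_2mod3 N).
Proof. by rewrite filter_uniq // iota_uniq. Qed.

Lemma size_primes_2mod3_above m N :
  (size (primes_2mod3 N) - m <= size [seq p <- primes_2mod3 N | m < p])%N.
Proof.
rewrite leq_subLR -(count_predC (fun p => m < p)%N) size_filter addnC leq_add2r.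
rewrite -size_filter -[leqRHS](size_iota 1 m); apply: uniq_leq_size.
  by rewrite filter_uniq // primes_2mod3_uniq.
move=> p; rewrite mem_filter mem_primes_2mod3 mem_iota /= -leqNgt add1n ltnS.
by move=> /andP[-> /and3P[/prime_gt0-> _ _]].
Qed.

Lemma sum_ltn_leq (s : seq nat) m : uniq s -> (\sum_(i <- s) (i < m) <= m)%N.
Proof.
move=> us; rewrite -big_mkcond sum1_count -size_filter -[leqRHS](size_iota 0 m).
apply: uniq_leq_size; first exact: filter_uniq.
by move=> i; rewrite mem_filter mem_iota => /andP[->].
Qed.

Section PrimesInWindow.
Variables (R : realType) (M N S : nat).
Hypotheses (M_gt2 : (2 < M)%N) (MN : (M <= N)%N) (NS : (N < S ^ 2)%N).

Let window (d : nat) : R := (1 - chi3 R d) * ((M < d <= N)%N%:R / d%:R).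
Let bound : R := 2 * (ln N%:R / M%:R).

Let bound_ge0 : 0 <= bound.
Proof. by rewrite mulr_ge0 // divr_ge0 // ln_nat_ge0. Qed.

Lemma ln_window_le d p : prime p -> (p %| d)%N -> (0 < d)%N ->
  ln p%:R * window d <= bound * (M < d <= N)%N%:R.
Proof.
move=> p_pr pd d0; rewrite /window /bound.
have [/andP[Md dN]|_] := boolP (M < d <= N)%N; last by rewrite mul0r !mulr0.
have chi3_le := normr_chi3 R d; rewrite mulr1 mul1r mulrCA.
have M0 : (0 < M)%N by apply: ltn_trans M_gt2.
apply: ler_pM.
- by move: chi3_le; rewrite ler_norml; lra.
- by rewrite mulr_ge0 ?ln_nat_ge0 ?invr_ge0.
- by move: chi3_le; rewrite ler_norml; lra.
apply: ler_pM; rewrite ?ln_nat_ge0 ?invr_ge0 //.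
  by apply: ler_ln_nat; rewrite prime_gt0 //= (leq_trans _ dN) // dvdn_leq.
by rewrite lef_pV2 ?posrE ?ltr0n // ler_nat ltnW.
Qed.

Lemma ln_window_prime_le p : prime p ->
  ln p%:R * window p <= bound * (p \in primes_2mod3 N)%:R.
Proof.
move=> p_pr; rewrite mem_primes_2mod3 p_pr /=.
have le_window := ln_window_le p_pr (dvdnn p) (prime_gt0 p_pr).
have [p2|p2] := eqVneq (p %% 3)%N 2%N.
  apply: le_trans le_window _.
  by rewrite (ler_wpM2l bound_ge0) // ler_nat; case: ltnP.
rewrite mulr0; have [p1|p1] := eqVneq (p %% 3)%N 1%N.
  by rewrite /window /chi3 p1 eqxx subrr mul0r mulr0.
have /eqP p3 : p == 3%N.
  by rewrite eq_sym -dvdn_prime2 // /dvdn; move: p1 p2; lia.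
by apply: le_trans le_window _; rewrite p3 ltnNge M_gt2 mulr0.
Qed.

Lemma ln_window_prime_powers_le p K : prime p ->
  \sum_(2 <= j < K) ln p%:R * window (p ^ j)
    <= bound * ((p < S) * (trunc_log 2 N).+1)%N%:R.
Proof.
move=> p_pr; have p1 := prime_gt1 p_pr.
apply: le_trans (_ : \sum_(2 <= j < K)
  bound * ((p < S) * (j < (trunc_log 2 N).+1))%N%:R <= _).
  rewrite [leLHS]big_nat [leRHS]big_nat; apply: ler_sum => j /andP[j2 _].
  apply: le_trans (ln_window_le p_pr _ _) _; rewrite ?expn_gt0 ?prime_gt0 //.
    by rewrite -{1}(expn1 p) dvdn_exp2l // ltnW.
  apply: (ler_wpM2l bound_ge0); rewrite ler_nat.
  have [/andP[_ pjN]|//] := boolP (M < p ^ j <= N)%N.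
  have -> : (p < S)%N.
    rewrite -(@ltn_exp2r _ _ 2) //; apply: leq_ltn_trans NS.
    by apply: leq_trans pjN; rewrite leq_pexp2l // prime_gt0.
  rewrite ltnS trunc_log_max //; apply: leq_trans pjN.
  by rewrite leq_exp2r // (leq_trans _ j2).
rewrite -mulr_sumr -natr_sum (ler_wpM2l bound_ge0) // ler_nat -big_distrr
  leq_mul2l.
by rewrite sum_ltn_leq ?orbT // iota_uniq.
Qed.

Lemma primes_2mod3_window :
  ln N%:R - ln M%:R - 25 <=
  bound * (size (primes_2mod3 N) + S * (trunc_log 2 N).+1)%N%:R.
Proof.
apply: le_trans
  (mertens_2mod3 R (ltn_trans (isT : (0 < 2)%N) M_gt2) MN (ltnSn N)) _.
rewrite /mangoldt_sum -/window.
apply: le_trans (_ : \sum_(1 <= p < N.+2 | prime p)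
    bound * ((p \in primes_2mod3 N) + (p < S) * (trunc_log 2 N).+1)%N%:R <= _).
  apply: ler_sum => p p_pr; rewrite big_ltn // expn1 natrD mulrDr.
  by apply: lerD; [apply: ln_window_prime_le|apply: ln_window_prime_powers_le].
rewrite -mulr_sumr -natr_sum (ler_wpM2l bound_ge0) // ler_nat big_split /=
  leq_add //.
  rewrite -big_mkcondr sum1_count -size_filter; apply: uniq_leq_size.
    exact/filter_uniq/iota_uniq.
  by move=> p; rewrite mem_filter => /andP[/andP[]].
rewrite -big_distrl leq_mul2r -big_filter sum_ltn_leq ?orbT //.
exact/filter_uniq/iota_uniq.
Qed.

End PrimesInWindow.

Lemma ln_mul_error_le (R : realType) e h : (2 < e)%N -> (2 < h)%N ->
  ln h%:R * ((h ^ e).+1 * (trunc_log 2 (h ^ (2 * e))).+1)%N%:R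
    <= 2 * (2 * e)%N%:R * (h ^ (2 * e).-1)%N%:R :> R.
Proof.
move=> e2 h2; set E := (2 * e)%N; have h0 : (0 < h)%N by apply: leq_trans h2.
have log_lt : (trunc_log 2 (h ^ E) < h * E)%N.
  rewrite -(@ltn_exp2l 2) //; apply: leq_ltn_trans (trunc_logP _ _) _;
    rewrite ?expn_gt0 ?h0 //.
  have E0 : (0 < E)%N by rewrite muln_gt0 (ltnW (ltnW e2)).
  by rewrite [(2 ^ (h * E))%N](expnM 2 h E) (ltn_exp2r _ _ E0) ltn_expl.
apply: le_trans (_ : h%:R * (2 * h ^ e * (h * E))%N%:R <= _).
  apply: ler_pM => //; first exact: ln_nat_ge0.
    by apply: ltW; apply: ln_sublinear; rewrite ltr0n.
  by rewrite ler_nat leq_mul // mul2n -addnn -addn1 leq_add2l expn_gt0 h0.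
rewrite -!natrM ler_nat (_ : h * _ = 2 * E * h ^ (e + 2))%N; last first.
  by rewrite expnD expnS expn1; ring.
by rewrite leq_mul2l leq_pexp2l ?orbT // /E; lia.
Qed.

Lemma ler_of_window (R : realFieldType) (l E M P T : R) :
  0 <= E -> 0 <= M -> 50 + 8 * E ^+ 2 <= l -> l * T <= 2 * E * M ->
  (l - 25) * M <= 2 * E * (l * (P + T)) -> M <= 4 * E * P.
Proof.
move=> E0 M0 l_large lT_le window.
have E2_ge0 : 0 <= E ^+ 2 by apply: exprn_ge0.
have l_gt0 : 0 < l by apply: lt_le_trans l_large; lra.
have ElT_le : 2 * E * (l * T) <= 2 * E * (2 * E * M).
  by rewrite ler_wpM2l // mulr_ge0.
have half_le : (25 + 4 * E ^+ 2) * M <= l / 2 * M.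
  by apply: ler_wpM2r => //; lra.
by rewrite -(ler_pM2l l_gt0); move: window ElT_le half_le; lra.
Qed.

(* The window from h^(2e-1) to h^(2e) has logarithmic length ln h, and Mertens'
   theorem loses only a constant on it. *)
Lemma primes_2mod3_lower (R : realType) e : (2 < e)%N ->
  exists h0, forall h, (h0 <= h)%N ->
    (h ^ (2 * e).-1 <= 8 * e * size (primes_2mod3 (h ^ (2 * e))))%N.
Proof.
move=> e2; pose E := (2 * e)%N; pose L : R := 50 + 8 * E%:R ^+ 2.
exists (Num.truncn (expR L)).+3 => h h_ge.
have h2 : (2 < h)%N by apply: leq_trans h_ge.
have h0 : (0 < h)%N by apply: leq_trans h2.
have ln_large : L <= ln h%:R.
  rewrite -[L]expRK ler_ln ?posrE ?expR_gt0 ?ltr0n //; apply: ltW.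
  apply: lt_le_trans (truncnS_gt (expR L)) _; rewrite ler_nat.
  by apply: leq_trans h_ge; do 2!apply: leqW.
set P := size _; pose M := (h ^ E.-1)%N.
have M0 : (0 < M)%N by rewrite expn_gt0 h0.
have NhM : (h ^ E = h * M)%N by rewrite /M -expnS prednK // /E; lia.
have M_gt2 : (2 < M)%N.
  by apply: leq_trans h2 _; rewrite -{1}(expn1 h) leq_pexp2l // /E; lia.
have MN : (M <= h ^ E)%N by rewrite NhM leq_pmull.
have NS : (h ^ E < (h ^ e).+1 ^ 2)%N by rewrite /E mulnC expnM ltn_exp2r.
have := primes_2mod3_window R M_gt2 MN NS; rewrite -/P.
have -> : ln (h ^ E)%N%:R - ln M%:R = ln h%:R :> R.
  by rewrite NhM natrM lnM ?posrE ?ltr0n // addrK.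
rewrite natrX lnXn ?ltr0n // -[ln _ *+ _]mulr_natr.
have error_le := ln_mul_error_le R e2 h2; rewrite -/E -/M in error_le.
rewrite natrD; move: (_ * _)%N%:R error_le => T error_le window.
have {}window : (ln h%:R - 25) * M%:R <= 2 * E%:R * (ln h%:R * (P%:R + T)).
  rewrite -ler_pdivlMr ?ltr0n //; apply: le_trans window _.
  by rewrite le_eqVlt; apply/orP; left; apply/eqP; ring.
have M_le := ler_of_window (ler0n R E) (ler0n R M) ln_large error_le window.
have : M%:R <= (4 * E * P)%N%:R :> R by rewrite (natrM _ (4 * E)) (natrM _ 4).
by rewrite ler_nat (_ : 8 * e = 4 * E)%N // /E; lia.
Qed.

(** * Local solubility *)

Lemma intr_eq0_of_natr (A : nzRingType) (N : nat) (m : int) :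
  (forall k : nat, (k%:R == 0 :> A) = (N %| k)%N) ->
  (m%:~R == 0 :> A) = (N%:Z %| m)%Z.
Proof.
move=> natr_eq0; case: m => k; first by rewrite -pmulrn natr_eq0 dvdzE.
by rewrite NegzE mulrNz oppr_eq0 -pmulrn natr_eq0 dvdzE abszN.
Qed.

Lemma intr_Zp_eq0 N (m : int) :
  (1 < N)%N -> (m%:~R == 0 :> 'Z_N) = (N%:Z %| m)%Z.
Proof.
move=> N1; apply: intr_eq0_of_natr => k.
by rewrite -val_eqE /= val_Zp_nat.
Qed.

Lemma intr_Fp_eq0 p (m : int) : prime p -> (m%:~R == 0 :> 'F_p) = (p%:Z %| m)%Z.
Proof.
move=> p_pr; apply: intr_eq0_of_natr => k.
by rewrite (dvdn_pcharf (pchar_Fp p_pr)).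
Qed.

Lemma eq_intr_Zp N (m m' : int) : (1 < N)%N ->
  (m%:~R = m'%:~R :> 'Z_N) <-> (N%:Z %| m - m')%Z.
Proof.
by move=> N1; rewrite -intr_Zp_eq0 // intrB subr_eq0; split=> [->|/eqP].
Qed.

Lemma Fp_natE p (x : 'F_p) : x = (x : nat)%:Z%:~R.
Proof. by rewrite -pmulrn natr_Zp. Qed.

Lemma inverse_mod p (c : int) : prime p -> ~~ (p%:Z %| c)%Z ->
  exists x : int, (p%:Z %| c * x - 1)%Z.
Proof.
move=> p_pr pc; have /coprimezP[[x d] /= xd] : coprimez c p%:Z.
  by rewrite coprimez_sym coprimezE /= prime_coprime // -dvdzE.
by exists x; apply/dvdzP; exists (- d); rewrite -xd; ring.
Qed.

Lemma horner_taylor2 (R : comNzRingType) (g : {poly R}) (y t : R) :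
  exists q, g.[y + t] = g.[y] + g^`().[y] * t + t ^+ 2 * q.
Proof.
elim/poly_ind: g => [|g c [q IHg]].
  by exists 0; rewrite deriv0 !horner0; ring.
exists (g^`().[y] + q * (y + t)).
rewrite derivD derivM derivX derivC !hornerE IHg; ring.
Qed.

Lemma solvable_overC (A : comNzRingType) k a b :
  solvable_over A k a b -> solvable_over A k b a.
Proof. by move=> [x [y e]]; exists y, x; rewrite addrC. Qed.

Section PadicIntegers.
Variables (p : nat) (p_pr : prime p).
Local Notation Zp := (padic_int p_pr).

Let ppow_gt1 n : (1 < p ^ n.+1)%N.
Proof. by rewrite -{1}(exp1n n.+1) ltn_exp2r // prime_gt1. Qed.

Definition padic_proj (n : nat) (z : Zp) : 'Z_(p ^ n.+1) := z n.

HB.instance Definition _ n :=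
  GRing.isZmodMorphism.Build Zp 'Z_(p ^ n.+1) (padic_proj n) (fun x y => erefl).
HB.instance Definition _ n :=
  GRing.isMonoidMorphism.Build Zp 'Z_(p ^ n.+1) (padic_proj n)
    (conj erefl (fun x y => erefl)).

Lemma Zpow_red_intr n (m : int) : Zpow_red (m%:~R : 'Z_(p ^ n.+2)) = m%:~R.
Proof.
rewrite /Zpow_red [LHS]pmulrn; apply/(eq_intr_Zp _ _ (ppow_gt1 n)).
apply: (@dvdz_trans (p ^ n.+2)%N); first by rewrite dvdzE /= dvdn_exp2l.
by apply/(eq_intr_Zp _ _ (ppow_gt1 n.+1)); rewrite -pmulrn natr_Zp.
Qed.

Lemma padic_limit (P : nat -> int -> Prop) (y0 : int) : P 0%N y0 ->
  (forall n y, P n y ->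
    exists2 y', P n.+1 y' & ((p ^ n.+1)%N%:Z %| y' - y)%Z) ->
  exists z : Zp, forall n, exists2 y, P n y & padic_proj n z = y%:~R.
Proof.
move=> P0 step; pose T n := {y : int | P n y}.
have next n (s : T n) : {s' : T n.+1 | ((p ^ n.+1)%N%:Z %| sval s' - sval s)%Z}.
  apply: cid; case: s => y Py; have [y' Py' yy'] := step n y Py.
  by exists (exist _ y' Py').
pose fix s n : T n := if n is m.+1 then sval (next m (s m)) else exist _ y0 P0.
have coherent n :
    Zpow_red ((sval (s n.+1))%:~R : 'Z_(p ^ n.+2)) = (sval (s n))%:~R.
  by rewrite Zpow_red_intr;
    apply/(eq_intr_Zp _ _ (ppow_gt1 n))/(svalP (next n (s n))).
exists (@PadicSeq p (fun n => (sval (s n))%:~R) coherent) => n.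
by exists (sval (s n)); first exact: svalP (s n).
Qed.

Lemma hensel_step (g : {poly int}) r n (y : int) :
  ((p ^ (2 * r + n).+1)%N%:Z %| g.[y])%Z -> ((p ^ r)%N%:Z %| g^`().[y])%Z ->
  ~~ ((p ^ r.+1)%N%:Z %| g^`().[y])%Z ->
  exists2 t : int, ((p ^ (r + n).+1)%N%:Z %| t)%Z &
    ((p ^ (2 * r + n).+2)%N%:Z %| g.[y + t])%Z.
Proof.
move=> /dvdzP[e gE] /dvdzP[u g'E]; rewrite g'E => pu.
have {}pu : ~~ (p%:Z %| u)%Z.
  by apply: contra pu => pu; rewrite expnS PoszM dvdz_mul.
have [c /dvdzP[d cuE]] := inverse_mod p_pr pu.
exists (- (e * c) * (p ^ (r + n).+1)%N%:Z); first exact: dvdz_mull.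
have [q ->] := horner_taylor2 g y (- (e * c) * (p ^ (r + n).+1)%N%:Z).
rewrite gE g'E; set t := - (e * c) * _.
have -> : e * (p ^ (2 * r + n).+1)%N%:Z + u * (p ^ r)%N%:Z * t =
    (- (e * d)) * (p ^ (2 * r + n).+2)%N%:Z.
  rewrite /t mul2n -addnn !PoszX !exprS !exprD.
  by transitivity
    (- e * (u * c - 1) * (p%:Z * (p%:Z ^+ r * p%:Z ^+ r * p%:Z ^+ n)));
    [ring|rewrite cuE; ring].
apply: rpredD; first exact: dvdz_mull.
rewrite /t exprMn dvdz_mulr // dvdz_mull //.
by rewrite -PoszX -expnM dvdzE /= dvdn_exp2l //; lia.
Qed.

(* Hensel's lemma for |g(y0)| < |g'(y0)|^2. *)
Lemma hensel (g : {poly int}) r (y0 : int) :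
  ((p ^ (2 * r).+1)%N%:Z %| g.[y0])%Z -> ((p ^ r)%N%:Z %| g^`().[y0])%Z ->
  ~~ ((p ^ r.+1)%N%:Z %| g^`().[y0])%Z ->
  exists z : Zp, (map_poly intr g).[z] = 0.
Proof.
move=> g_y0 g'_y0 g'_y0_exact.
pose P n y := [/\ ((p ^ (2 * r + n).+1)%N%:Z %| g.[y])%Z,
  ((p ^ r)%N%:Z %| g^`().[y])%Z & ~~ ((p ^ r.+1)%N%:Z %| g^`().[y])%Z].
have [|n y [gy g'y g'y_exact]|z zP] := @padic_limit P y0.
- by split; rewrite ?addn0.
- have [t pt gyt] := hensel_step gy g'y g'y_exact; exists (y + t); last first.
    rewrite addrAC subrr add0r; apply: dvdz_trans pt.
    by rewrite dvdzE /= dvdn_exp2l // ltnS leq_addl.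
  have pt_r : ((p ^ r.+1)%N%:Z %| t)%Z.
    by apply: dvdz_trans pt; rewrite dvdzE /= dvdn_exp2l // ltnS leq_addr.
  have [q g'yt] := horner_taylor2 g^`() y t.
  have {}g'yt : g^`().[y + t] = g^`().[y] + t * (g^`()^`().[y] + t * q).
    by rewrite g'yt; ring.
  split; first by rewrite addnS.
    by rewrite g'yt rpredD ?dvdz_mulr // (dvdz_trans _ pt_r) // dvdzE /=
      dvdn_exp2l.
  by rewrite g'yt rpredDr // dvdz_mulr.
exists z; apply: padic_ext => n; have [y [gy _ _] zy] := zP n.
rewrite -[LHS]/(padic_proj n _) -horner_map -map_poly_comp /= zy.
rewrite (eq_map_poly (fun m => rmorph_int (padic_proj n) m)) horner_map.
apply/eqP; rewrite (intr_Zp_eq0 _ (ppow_gt1 n)); apply: dvdz_trans gy.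
by rewrite dvdzE /= dvdn_exp2l // ltnS leq_addl.
Qed.

Lemma hensel_power k (a b x0 y0 : int) : ~~ (p %| k)%N -> ~~ (p%:Z %| b)%Z ->
  ~~ (p%:Z %| y0)%Z -> (p%:Z %| a * x0 ^+ k + b * y0 ^+ k - 1)%Z ->
  solvable_over Zp k a b.
Proof.
move=> pk pb py0 root_mod_p.
pose g : {poly int} := b *: 'X^k + (a * x0 ^+ k - 1)%:P.
have gE y : g.[y] = a * x0 ^+ k + b * y ^+ k - 1.
  by rewrite hornerD hornerZ hornerXn hornerC addrCA addrA.
have g'E y : g^`().[y] = b * (k%:Z * y ^+ k.-1).
  by rewrite derivD derivC addr0 derivZ derivXn hornerZ hornerMn hornerXn
    -mulr_natl natz.
have [|||z gz] := @hensel g 0 y0.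
- by rewrite gE expn1.
- exact: dvd1z.
- rewrite g'E expn1 !dvdzE !abszM abszX in pb py0 *.
  by rewrite !Euclid_dvdM // !negb_or pb pk /= Euclid_dvdX // negb_and py0.
exists x0%:~R, z; apply/eqP; rewrite -subr_eq0; apply/eqP; rewrite -[RHS]gz.
rewrite rmorphD /= map_polyZ map_polyXn map_polyC hornerD hornerZ hornerXn
  hornerC /=.
by rewrite rmorphB rmorphM rmorphXn /= addrCA addrA.
Qed.

Lemma solvable_of_root k (a b x0 : int) : (0 < k)%N -> ~~ (p %| k)%N ->
  ~~ (p%:Z %| a)%Z -> (p%:Z %| a * x0 ^+ k - 1)%Z -> solvable_over Zp k a b.
Proof.
move=> k0 pk pa root_mod_p; apply: solvable_overC.
apply: (@hensel_power k b a 0 x0) => //;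
  last by rewrite expr0n gtn_eqF // mulr0 add0r.
apply: contraTN root_mod_p => px; rewrite rpredDl.
  by rewrite dvdzE /= dvdn1; apply: contraTneq p_pr => ->.
by rewrite dvdz_mull // -(prednK k0) exprS dvdz_mulr.
Qed.

End PadicIntegers.

(* With a = 1 + 9 c, the number 1 - 3 c is a root of a y^3 = 1 modulo 27. *)
Lemma cubic_solvable_3adic (p_pr : prime 3) (a b : int) : (9 %| a - 1)%Z ->
  solvable_over (padic_int p_pr) 3 a b.
Proof.
move=> /dvdzP[c a_c].
have {a_c} aE : a = 1 + 9 * c by rewrite mulrC -a_c addrC subrK.
pose g : {poly int} := a *: 'X^3 - 1.
have g'E y : g^`().[y] = a * y ^+ 2 * 3.
  by rewrite derivB derivC subr0 derivZ derivXn hornerZ hornerMn hornerXn; ring.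
have [|||z gz] := @hensel 3 p_pr g 1 (1 - 3 * c).
- rewrite hornerD hornerN hornerZ hornerXn hornerC; apply/dvdzP.
  by exists (c ^+ 2 * (1 - c) * (1 + 9 * c) - 3 * c ^+ 2); rewrite aE; ring.
- by rewrite g'E expn1 dvdz_mull.
- rewrite g'E; apply/negP => /dvdzP[m]; rewrite aE => mE.
  have : (3 %| 1)%Z by apply/dvdzP;
    exists (m - 3 * (c - 2 * c + 9 * c ^+ 2 + 3 * c ^+ 2)); lia.
  by [].
exists z, 0; apply/eqP; rewrite -subr_eq0; apply/eqP; rewrite -[RHS]gz.
rewrite expr0n mulr0 addr0 rmorphB /= map_polyZ map_polyXn rmorph1.
by rewrite hornerD hornerN hornerZ hornerXn hornerC.
Qed.

Lemma cube_root_mod p (c : int) :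
  prime p -> (p %% 3 = 2)%N -> ~~ (p%:Z %| c)%Z ->
  exists x : int, (p%:Z %| c * x ^+ 3 - 1)%Z.
Proof.
move=> p_pr p2 pc; exists (c ^+ (p %/ 3)).
rewrite -intr_Fp_eq0 // intrB -exprM -exprS.
rewrite (_ : (p %/ 3 * 3).+1 = #|'F_p|.-1)%N.
  by rewrite rmorphXn /= expf_card_pred ?subrr // intr_Fp_eq0.
by rewrite card_Fp //; lia.
Qed.

Lemma cubic_solvable_2mod3 p (p_pr : prime p) (a b : int) : (p %% 3 = 2)%N ->
  coprimez a b -> solvable_over (padic_int p_pr) 3 a b.
Proof.
move=> p2 co_ab.
have p3 : ~~ (p %| 3)%N.
  by rewrite dvdn_prime2 //; apply/eqP => pE; rewrite pE in p2.
have [pa|pa] := boolP (p%:Z %| a)%Z; last first.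
  by have [x xP] := cube_root_mod p_pr p2 pa;
    apply: (solvable_of_root p_pr _ _ p3 pa xP).
have pb : ~~ (p%:Z %| b)%Z.
  apply/negP => pb; have : (p%:Z %| gcdz a b)%Z by rewrite dvdz_gcd pa.
  by rewrite (eqP co_ab) dvdzE dvdn1 => /eqP/= p1; rewrite p1 in p_pr.
have [x xP] := cube_root_mod p_pr p2 pb.
by apply/solvable_overC/(solvable_of_root p_pr _ _ p3 pb xP).
Qed.

Lemma cubic_solvable_1mod3 p (p_pr : prime p) (a b : int) : (p %% 3 = 1)%N ->
  (7 < p)%N -> ~~ (p%:Z %| a)%Z -> ~~ (p%:Z %| b)%Z ->
  solvable_over (padic_int p_pr) 3 a b.
Proof.
move=> p1 p7 pa pb.
have p3 : ~~ (p %| 3)%N.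
  by rewrite dvdn_prime2 //; apply/eqP => pE; rewrite pE in p1.
have cardF : #|'F_p| = (3 * (p %/ 3)).+1 by rewrite card_Fp //; lia.
have f_gt2 : (2 < p %/ 3)%N by lia.
have [|||x [y e]] := @diagonal_cubic_solvable _ _ cardF _ a%:~R b%:~R f_gt2.
- exact: ltnW (ltnW f_gt2).
- by rewrite intr_Fp_eq0.
- by rewrite intr_Fp_eq0.
have root_mod_p : (p%:Z %| a * (x : nat)%:Z ^+ 3 + b * (y : nat)%:Z ^+ 3 - 1)%Z.
  by rewrite -intr_Fp_eq0 // intrB intrD (intrM _ a) (intrM _ b) !rmorphXn /=
    -!Fp_natE e subrr.
have [y0|y0] := eqVneq y 0; last first.
  by apply: hensel_power root_mod_p; rewrite // -intr_Fp_eq0 // -Fp_natE.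
rewrite [X in X - 1]addrC in root_mod_p.
apply: solvable_overC; apply: hensel_power root_mod_p => //.
rewrite -intr_Fp_eq0 // -Fp_natE; apply: contra_eq_neq e => ->.
by rewrite y0 !expr0n !mulr0 addr0 eq_sym oner_neq0.
Qed.

Section LocallySolvable.
Variable R : realType.

Lemma solvable_over_real k a b : (0 < k)%N -> 0 < b -> solvable_over R k a b.
Proof.
move=> k0 b0; have bR_gt0 : 0 < b%:~R :> R by rewrite ltr0z.
exists 0, (b%:~R^-1 `^ k%:R^-1).
rewrite expr0n gtn_eqF // mulr0 add0r -powR_mulrn ?powR_ge0 // -powRrM.
by rewrite mulVf ?pnatr_eq0 -?lt0n // powRr1 ?invr_ge0 ?ltW // mulfV // gt_eqF.
Qed.

(* (1/u, 0) is a solution away from u, and (0, y) lifts from F_u at u. *)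
Lemma power_locally_solvable k u (b : nat) (w : 'F_u) : (0 < k)%N -> prime u ->
  (k < u)%N -> w != 0 -> (0 < b)%N -> b%:R = w ^+ k ->
  solvable_locally R k (u ^ k)%N%:Z b%:Z.
Proof.
move=> k0 u_pr ku w0 b0 bw; split; first by apply: solvable_over_real.
move=> p p_pr; have [pu|pu] := eqVneq p u.
  move: p_pr; rewrite pu => u_pr'; apply: solvable_overC.
  apply: (@solvable_of_root u u_pr' k b%:Z (u ^ k)%N%:Z (w^-1 : 'F_u)) => //.
    by rewrite gtnNdvd.
    by rewrite -intr_Fp_eq0 // -pmulrn bw expf_neq0.
  rewrite -intr_Fp_eq0 // intrB intrM rmorphXn /= -Fp_natE -pmulrn bw.
  by rewrite -exprMn mulfV // expr1n subrr.
have p_u : ~~ (p%:Z %| u%:Z)%Z by rewrite dvdzE /= dvdn_prime2.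
have [x0 x0P] := inverse_mod p_pr p_u.
have [x [y e]] : solvable_over (padic_int p_pr) 1 u%:Z 0.
  by apply: (@solvable_of_root p p_pr 1 u%:Z 0 x0); rewrite // dvdn1;
    apply: contraTneq p_pr => ->.
exists x, 0; move: e; rewrite mul0r addr0 expr1 => e.
by rewrite expr0n gtn_eqF // mulr0 addr0 PoszX rmorphXn /= -exprMn e expr1n.
Qed.

Lemma cubic_locally_solvable (a b : nat) : (a %% 63 = 1)%N -> (0 < b)%N ->
  (forall p, prime p -> (p %| a * b)%N -> (p %% 3 = 2)%N) -> coprime a b ->
  solvable_locally R 3 a%:Z b%:Z.
Proof.
move=> a63 b0 ab_2mod3 co_ab; split; first by apply: solvable_over_real.
move=> p p_pr; have [p3|p3] := eqVneq p 3%N.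
  move: p_pr; rewrite p3 => p_pr; apply: cubic_solvable_3adic.
  by apply/dvdzP; exists (a %/ 63 * 7)%N%:Z; lia.
have [p2|p_n2] := eqVneq (p %% 3)%N 2%N; first by apply: cubic_solvable_2mod3.
have p1 : (p %% 3 = 1)%N.
  have : ~~ (3 %| p)%N by rewrite dvdn_prime2 // eq_sym.
  by move: p_n2; rewrite /dvdn; lia.
have pa : ~~ (p%:Z %| a%:Z)%Z.
  by rewrite dvdzE /=;
    apply: contra p_n2 => /(dvdn_mulr b)/(ab_2mod3 _ p_pr) ->.
have pb : ~~ (p%:Z %| b%:Z)%Z.
  by rewrite dvdzE /=;
    apply: contra p_n2 => /(dvdn_mull a)/(ab_2mod3 _ p_pr) ->.
have [p7|p_n7] := eqVneq p 7%N; last first.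
  apply: cubic_solvable_1mod3 => //.
  have p4 : p != 4%N by apply: contraTneq p_pr => ->.
  by move: p_n7 p4 (prime_gt1 p_pr) p1; clear; lia.
apply: (@solvable_of_root p p_pr 3 a%:Z b%:Z 1); rewrite // p7 //.
by apply/dvdzP; exists (a %/ 63 * 9)%N%:Z; lia.
Qed.

End LocallySolvable.

(** * Many locally soluble pairs *)

(* 2 and 5, both 2 modulo 3, generate the units modulo 63, so the default (0, 0)
   is never taken on units. *)
Definition exponents63 (r : nat) : nat * nat :=
  head (0, 0)%N [seq ij <- [seq (i, j) | i <- iota 0 6, j <- iota 0 6] |
    ((r * ((2 ^ ij.1 * (5 ^ ij.2 %% 63)) %% 63)) %% 63 == 1)%N].

Lemma exponents63_check : all (fun r => coprime r 63 ==>
  [&& (exponents63 r).1 < 6, (exponents63 r).2 < 6 &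
    (r * ((2 ^ (exponents63 r).1 * (5 ^ (exponents63 r).2 %% 63)) %% 63)) %% 63
      == 1])%N (iota 0 63).
Proof. by vm_compute. Qed.

Definition multiplier63 (p : nat) : nat :=
  (2 ^ (exponents63 (p %% 63)).1 * 5 ^ (exponents63 (p %% 63)).2)%N.

Lemma multiplier63P p : coprime p 63 ->
  (multiplier63 p <= 2 ^ 5 * 5 ^ 5)%N /\ ((p * multiplier63 p) %% 63 = 1)%N.
Proof.
rewrite -coprime_modl /multiplier63 => co_p63.
have p_lt : (p %% 63)%N \in iota 0 63 by rewrite mem_iota ltn_pmod.
have /implyP/(_ co_p63) := allP exponents63_check _ p_lt.
move: (exponents63 _) => [i j] /= /and3P[i6 j6 /eqP ij_inv].
split; first by rewrite leq_mul // leq_exp2l.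
by move: ij_inv; rewrite modnMm mulnA modnMmr -mulnA.
Qed.

Lemma prime_dvd_multiplier63 p q : prime q -> (q %| multiplier63 p)%N ->
  q = 2%N \/ q = 5%N.
Proof.
move=> q_pr; rewrite Euclid_dvdM // !Euclid_dvdX // !dvdn_prime2 //.
by case/orP => /andP[/eqP-> _]; [left|right].
Qed.

Lemma coprime63_prime p : prime p -> (7 < p)%N -> coprime p 63.
Proof.
move=> p_pr p7; rewrite -[63%N]/(3 ^ 2 * 7)%N coprimeMr coprimeXr //=;
  by rewrite prime_coprime // dvdn_prime2 //; apply: contraTN p7 => /eqP->.
Qed.

Lemma prime_dvd_lift63 p q : prime p -> prime q -> (7 < q)%N ->
  (q %| p * multiplier63 p)%N -> q = p.
Proof.
move=> p_pr q_pr q7; rewrite Euclid_dvdM // dvdn_prime2 // => /orP[/eqP //|].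
by move=> /(prime_dvd_multiplier63 q_pr)[] qE; rewrite qE in q7.
Qed.

Section LocalCount.
Variable R : realType.

Definition locally_soluble (k n : nat) (z : int * int) : Prop :=
  coef_bounded n z /\ solvable_locally R k z.1 z.2.

Lemma coef_bounded_nat n a b : (0 < a <= n)%N -> (0 < b <= n)%N ->
  coef_bounded n (a%:Z, b%:Z).
Proof. by move=> /andP[a0 an] /andP[b0 bn]; split; rewrite //= -lt0n. Qed.

Lemma locally_soluble_many k n N : (0 < k)%N -> (N ^ k <= n)%N ->
  exists s : seq (int * int),
    [/\ uniq s, forall z, z \in s -> locally_soluble k n z &
    (n * (size (primes_2mod3 N) - k) <= 4 * k * size s)%N].
Proof.
move=> k0 Nn; pose us := [seq u <- primes_2mod3 N | (k < u)%N].
have usP u : u \in us -> [/\ prime u, (k < u)%N & (u ^ k <= n)%N].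
  rewrite mem_filter mem_primes_2mod3 => /and4P[ku u_pr _ uN]; split=> //.
  by apply: leq_trans Nn; rewrite leq_exp2r.
have residues_ex u : exists bs : seq nat, u \in us -> [/\ uniq bs,
    (n <= 4 * k * size bs)%N & forall b, b \in bs ->
      (0 < b <= n)%N /\ exists2 w : 'F_u, w != 0 & b%:R = w ^+ k].
  have [/usP[u_pr _ ukn]|_] := boolP (u \in us); last by exists [::].
  have [|bs bsP] := @power_residues_many k n u k0 u_pr; last by exists bs.
  by apply: leq_trans ukn; rewrite -{1}(expn1 u) leq_pexp2l // prime_gt0.
have [bs bsP] := choice residues_ex.
exists [seq ((u ^ k)%N%:Z, (b : nat)%:Z) | u <- us, b <- bs u]; split.
- apply: allpairs_uniq_dep => [|u /bsP[]//|[u b] [v c] _ _ /= [uv bc]].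
    by rewrite filter_uniq // primes_2mod3_uniq.
  have -> : u = v by apply/eqP; rewrite -(eqn_exp2r _ _ k0) uv.
  by rewrite bc.
- move=> z /allpairsPdep[u [b [uu bb ->]]]; have [u_pr ku ukn] := usP u uu.
  have [_ _ /(_ b bb)[b_range [w w0 bw]]] := bsP u uu.
  split; first by apply: coef_bounded_nat; rewrite // ukn expn_gt0 prime_gt0.
  by apply: power_locally_solvable w0 _ bw; case/andP: b_range.
rewrite size_allpairs_dep sumnE big_map.
apply: leq_trans (_ : n * size us <= _)%N.
  by rewrite leq_mul2l size_primes_2mod3_above orbT.
rewrite -iter_addn_0 -(count_predT us) -big_const_seq big_distrr /=.
by rewrite big_seq [leqRHS]big_seq; apply: leq_sum => u /bsP[].
Qed.

Lemma lift63_locally_soluble n p q :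
  prime p -> prime q -> (7 < p)%N -> (7 < q)%N ->
  (p %% 3 = 2)%N -> (q %% 3 = 2)%N -> p != q ->
  (2 ^ 5 * 5 ^ 5 * p <= n)%N -> (q <= n)%N ->
  locally_soluble 3 n ((p * multiplier63 p)%N%:Z, q%:Z).
Proof.
move=> p_pr q_pr p7 q7 p2 q2 pq pn qn.
have [mult_le mod63] := multiplier63P (coprime63_prime p_pr p7).
have lift_gt0 : (0 < p * multiplier63 p)%N.
  by rewrite !muln_gt0 !expn_gt0 prime_gt0.
split.
  apply: coef_bounded_nat; last by rewrite prime_gt0.
  by rewrite lift_gt0 mulnC (leq_trans _ pn) // leq_mul.
apply: cubic_locally_solvable; rewrite ?prime_gt0 //.
  move=> l l_pr; rewrite Euclid_dvdM // (dvdn_prime2 l_pr q_pr) =>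
    /orP[|/eqP-> //].
  rewrite Euclid_dvdM // dvdn_prime2 // => /orP[/eqP-> //|].
  by case/(prime_dvd_multiplier63 l_pr) => ->.
rewrite coprime_sym prime_coprime //; apply: contra pq.
by move=> /(prime_dvd_lift63 p_pr q_pr q7) ->.
Qed.

Lemma cubic_locally_soluble_many n N : (2 ^ 5 * 5 ^ 5 * N <= n)%N ->
  exists s : seq (int * int),
    [/\ uniq s, forall z, z \in s -> locally_soluble 3 n z &
    ((size (primes_2mod3 N) - 8) ^ 2 <= size s)%N].
Proof.
move=> Nn; pose ps := [seq p <- primes_2mod3 N | (7 < p)%N].
have psP p : p \in ps -> [/\ prime p, (p %% 3 = 2)%N, (7 < p)%N & (p <= N)%N].
  by rewrite mem_filter mem_primes_2mod3 => /and4P[? ? /eqP ? ?].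
have ps_uniq : uniq ps by rewrite filter_uniq // primes_2mod3_uniq.
exists
  [seq ((p * multiplier63 p)%N%:Z, (q : nat)%:Z) | p <- ps, q <- rem p ps];
  split.
- apply: allpairs_uniq_dep => // [p _|[p q] [p' q']]; first exact: rem_uniq.
  move=> /allpairsPdep[r [s [rps _ [-> _]]]].
  move=> /allpairsPdep[r' [s' [r'ps _ [-> _]]]].
  move=> /= [lift_eq ->].
  have [r_pr _ r7 _] := psP r rps; have [r'_pr _ _ _] := psP r' r'ps.
  suff -> : r = r' by [].
  by apply: (prime_dvd_lift63 r'_pr r_pr r7); rewrite -lift_eq dvdn_mulr.
- move=> z /allpairsPdep[p [q [pps + ->]]].
  rewrite mem_rem_uniq // => /andP[/= qp qps].
  have [p_pr p2 p7 pN] := psP p pps; have [q_pr q2 q7 qN] := psP q qps.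
  apply: lift63_locally_soluble; rewrite // 1?eq_sym //.
    by apply: leq_trans Nn; rewrite leq_mul2l pN orbT.
  by apply: leq_trans qN (leq_trans _ Nn); rewrite leq_pmull.
rewrite size_allpairs_dep sumnE big_map.
rewrite (eq_big_seq (fun=> (size ps).-1)); last first.
  by move=> p pps; rewrite size_rem.
rewrite big_const_seq count_predT iter_addn_0.
have ps_large : (size (primes_2mod3 N) - 7 <= size ps)%N.
  exact: size_primes_2mod3_above.
by rewrite -mulnn; apply: leq_mul;
  move: (size _) (size ps) ps_large; clear; lia.
Qed.

End LocalCount.

(** * Comparison of the two counts *)

Lemma floor_root_ge m h0 : (0 < m)%N -> exists n0, forall n, (n0 <= n)%N ->
  exists h, [/\ (h0 <= h)%N, (h ^ m <= n)%N & (n <= 2 ^ m * h ^ m)%N].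
Proof.
move=> m0; exists (h0.+1 ^ m)%N => n n_ge.
have root_le h : (h ^ m <= n)%N -> (h <= n)%N.
  by apply: leq_trans; case: h => // h; rewrite -{1}(expn1 h.+1) leq_pexp2l.
case: (ex_maxnP (ex_intro (fun h => h ^ m <= n)%N _ n_ge) root_le).
move=> h hn h_max.
have h0_lt : (h0 < h)%N by apply: h_max.
exists h; split=> //; first exact: ltnW.
rewrite -expnMn ltnW // ltnNge; apply/negP => hn2.
by have := h_max _ hn2; lia.
Qed.

Lemma expn_le_mul_sub c h e j P : (0 < e)%N -> (1 < h)%N -> (c * j <= h)%N ->
  (h ^ e.+1 <= c * P -> h ^ e <= c * (P - j))%N.
Proof.
move=> e0 h1 cj_le; rewrite expnS mulnBr => cP_ge.
have h_le : (h <= h ^ e)%N by rewrite -{1}(expn1 h) leq_pexp2l // ltnW.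
have : (2 * h ^ e <= c * P)%N.
  by apply: leq_trans cP_ge; rewrite leq_mul2r h1 orbT.
by move: (h ^ e)%N (c * P)%N (c * j)%N h_le cj_le; clear; lia.
Qed.

Section Comparison.
Variable R : realType.

Definition global_sparse (k M n : nat) : Prop :=
  exists (s : seq (int * int)) (m : nat),
    [/\ at_most (globally_soluble k n) m, uniq s,
        forall z, z \in s -> locally_soluble R k n z,
        (M * m <= size s)%N & (0 < size s)%N].

Lemma global_sparse_ge4 k M : abc_conjecture R -> (3 < k)%N ->
  exists n0, forall n, (n0 <= n)%N -> global_sparse k M n.
Proof.
move=> abc k3; have k0 : (0 < k)%N by apply: ltn_trans k3.
have [C [h0 upper]] := globally_soluble_upper_ge4 abc k3.
have [h1 lower] := primes_2mod3_lower R (isT : (2 < 3)%N).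
have m0 : (0 < 6 * k)%N by rewrite muln_gt0.
have [n0 n0P] := floor_root_ge (h0 + h1 + 24 * k + 96 * k * (M * C) + 2)%N m0.
exists n0 => n /n0P[h [h_ge hn nh]].
have [h_ge0 h_ge1 kh Mh h_gt1] : [/\ (h0 <= h)%N, (h1 <= h)%N, (24 * k <= h)%N,
    (96 * k * (M * C) <= h)%N & (1 < h)%N].
  by move: h_ge; move: (24 * k)%N (96 * k * (M * C))%N => u v; clear;
    split; lia.
have [s [us s_loc size_s]] : exists s : seq (int * int), [/\ uniq s,
    forall z, z \in s -> locally_soluble R k n z &
    (n * (size (primes_2mod3 (h ^ 6)) - k) <= 4 * k * size s)%N].
  by apply: locally_soluble_many; rewrite // -expnM.
have primes_ge : (h ^ 4 <= 24 * (size (primes_2mod3 (h ^ 6)) - k))%N.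
  exact: expn_le_mul_sub kh (lower h h_ge1).
have s_ge : (h ^ (6 * k + 4) <= 96 * k * size s)%N.
  rewrite expnD; apply: leq_trans (leq_mul hn primes_ge) _.
  by rewrite mulnCA (_ : 96 = 24 * 4)%N // -!mulnA leq_mul2l mulnA size_s.
exists s, (C * h ^ (6 * k + 2))%N; split=> //; first exact: upper.
  rewrite -(@leq_pmul2l (96 * k)) ?muln_gt0 //; apply: leq_trans s_ge.
  rewrite (_ : 96 * k * _ = 96 * k * (M * C) * h ^ (6 * k + 2))%N; last by ring.
  by apply: leq_mul_expn => //; rewrite ltn_add2l.
rewrite lt0n; apply: contraTneq s_ge => ->.
by rewrite muln0 -ltnNge expn_gt0 ltnW.
Qed.

Lemma global_sparse_cubic M : abc_conjecture R ->
  exists n0, forall n, (n0 <= n)%N -> global_sparse 3 M n.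
Proof.
move=> abc; have A0 : (0 < 2 ^ 1000)%N by rewrite expn_gt0.
move: (2 ^ 1000)%N A0 (@floor_root_ge 1000) => A A0 root.
have [C [h0 upper]] := globally_soluble_upper_cubic abc A0.
have [c [h1 lower]] : exists c h1, forall h, (h1 <= h)%N ->
    (h ^ 997 <= c * size (primes_2mod3 (h ^ 998)))%N.
  by exists (8 * 499)%N; apply: primes_2mod3_lower.
have [n0 n0P] :=
  root (h0 + h1 + 2 ^ 5 * 5 ^ 5 + c * 8 + M * C * c ^ 2 + 2)%N isT.
exists n0 => n /n0P[h [h_ge hn nh]].
have [h_ge0 h_ge1 lift_le c_le [M_le h_gt1]] : [/\ (h0 <= h)%N, (h1 <= h)%N,
    (2 ^ 5 * 5 ^ 5 <= h)%N, (c * 8 <= h)%N &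
    (M * C * c ^ 2 <= h)%N /\ (1 < h)%N].
  move: h_ge; move: (2 ^ 5 * 5 ^ 5)%N (c * 8)%N (M * C * c ^ 2)%N => u v w.
  by clear; split; [..|split]; lia.
have [|s [us s_loc size_s]] := @cubic_locally_soluble_many R n (h ^ 998).
  by apply: leq_trans hn; apply: leq_mul_expn.
have primes_ge : (h ^ 996 <= c * (size (primes_2mod3 (h ^ 998)) - 8))%N.
  exact: expn_le_mul_sub c_le (lower h h_ge1).
have s_ge : (h ^ 1992 <= c ^ 2 * size s)%N.
  rewrite (_ : 1992 = 996 * 2)%N // expnM.
  apply: leq_trans (_ : (c * (size (primes_2mod3 (h ^ 998)) - 8)) ^ 2 <= _)%N.
    by rewrite leq_exp2r.
  by rewrite expnMn leq_mul2l size_s orbT.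
have /andP[c2_gt0 s_gt0] : (0 < c ^ 2)%N && (0 < size s)%N.
  by rewrite -muln_gt0; apply: leq_trans s_ge; rewrite expn_gt0 ltnW.
exists s, (C * h ^ 1990)%N; split=> //.
  rewrite (_ : 1990 = 10 * 199)%N // expnM.
  apply: upper; last by rewrite -expnM.
  by apply: leq_trans h_ge0 _; rewrite -{1}(expn1 h) leq_pexp2l // ltnW.
rewrite -(leq_pmul2l c2_gt0); apply: leq_trans s_ge.
rewrite (_ : c ^ 2 * _ = M * C * c ^ 2 * h ^ 1990)%N; first exact: leq_mul_expn.
by move: (h ^ 1990)%N => u; ring.
Qed.

Lemma norm_le_truncn (H : R) (a : int) : 0 <= H ->
  (`|a|%:~R <= H) = (`|a| <= (Num.truncn H)%:Z).
Proof. by move=> H0; rewrite -abszE lez_nat -pmulrn truncn_ge_nat. Qed.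

Lemma coef_boxE (H : R) z :
  0 <= H -> coef_box H z <-> coef_bounded (Num.truncn H) z.
Proof.
move=> H0; rewrite /coef_box /coef_bounded /= !norm_le_truncn // !normr_gt0.
by split=> -[].
Qed.

Lemma card_fset_set_le (T : choiceType) (A : set T) m :
  at_most A m -> (#|` fset_set A| <= m)%N.
Proof.
move=> [s [size_s sA]]; apply: leq_trans size_s.
have A_fin : finite_set A by apply: sub_finite_set (finite_seq s) => z /sA.
apply: uniq_leq_size; first exact: fset_uniq.
by move=> z; rewrite in_fset_set // => /set_mem /sA.
Qed.

Lemma card_fset_set_ge (T : choiceType) (A : set T) (s : seq T) :
  finite_set A -> uniq s -> (forall z, z \in s -> A z) ->
  (size s <= #|` fset_set A|)%N.
Proof.
move=> A_fin us sA; apply: uniq_leq_size => // z /sA Az.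
by rewrite in_fset_set //; apply/mem_set.
Qed.

Lemma N_glob_le k (H : R) m : 0 <= H ->
  at_most (globally_soluble k (Num.truncn H)) m -> (N_glob k H <= m)%N.
Proof.
move=> H0 few; apply: card_fset_set_le; apply: at_most_le few _ (leqnn m) => z.
by move=> [/(coef_boxE _ H0) z_bounded z_sol]; split.
Qed.

Lemma N_loc_ge k (H : R) s : 0 <= H -> uniq s ->
  (forall z, z \in s -> locally_soluble R k (Num.truncn H) z) ->
  (size s <= N_loc k H)%N.
Proof.
move=> H0 us s_loc; apply: card_fset_set_ge => //; last first.
  by move=> z /s_loc[z_bounded z_sol]; split=> //; apply/coef_boxE.
have [r [_ rP]] := at_most_box (Num.truncn H) (Num.truncn H).
apply: sub_finite_set (finite_seq r) => z [/(coef_boxE _ H0)[an bn _ _] _].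
exact: rP.
Qed.

Lemma N_glob_small k M : (2 < k)%N -> abc_conjecture R ->
  exists n0 : nat, forall H : R, n0%:R <= H ->
    (M * N_glob k H <= N_loc k H)%N /\ (0 < N_loc k H)%N.
Proof.
move=> k2 abc.
have [n0 sparse] : exists n0, forall n, (n0 <= n)%N -> global_sparse k M n.
  move: k2; rewrite leq_eqVlt => /predU1P[<-|k3].
    exact: global_sparse_cubic.
  exact: global_sparse_ge4.
exists n0 => H H_ge; have H0 : 0 <= H by apply: le_trans H_ge.
have [|s [m [few us s_loc ratio s_gt0]]] := sparse (Num.truncn H).
  by rewrite truncn_ge_nat.
have glob_le := N_glob_le H0 few; have loc_ge := N_loc_ge H0 us s_loc.
split; last exact: leq_trans loc_ge.
by apply: leq_trans loc_ge; apply: leq_trans ratio;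
  rewrite leq_mul2l glob_le orbT.
Qed.

End Comparison.

Import numFieldNormedType.Exports.
Local Open Scope classical_set_scope.

Theorem theorem1 (R : realType) (k : nat) (hk : (3 <= k)%N)
    (habc : abc_conjecture R) :
  (N_glob k H)%:R / (N_loc k H)%:R @[H --> +oo_R] --> (0 : R).
Proof.
apply/cvgr0Pnorm_lt => e e_gt0; pose M := (Num.truncn e^-1).+1.
have [n0 small] := N_glob_small M hk habc.
near=> H; have [|glob_le loc_gt0] := small H.
  by near: H; apply: nbhs_pinfty_ge; rewrite num_real.
have M_large : 1 < M%:R * e by rewrite -ltr_pdivrMr // div1r truncnS_gt.
rewrite ger0_norm ?divr_ge0 // ltr_pdivrMr ?ltr0n //.
rewrite -(@ltr_pM2l _ M%:R) ?ltr0n //.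
apply: (@le_lt_trans _ _ (N_loc k H)%:R); first by rewrite -natrM ler_nat.
by rewrite mulrA ltr_pMl ?ltr0n.
Unshelve. all: by end_near.
Qed.
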